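(* Let $(M,F)$ be an $m$-th root metric space with $(g_{ij})$ positive definite. Then $(M,F)$ is Riemann-projective if and only if there exist (in each coordinate chart of $M$) functions $\Gamma^i_{\ jk}(x)$ such that, for all $i,i_1,\dots,i_m,j_1,\dots,j_m\in\{1,\dots,n\}$, the following equality holds after symmetrization of both sides over the $2m$ indices $i_1,\dots,i_m,j_1,\dots,j_m$: $$a_{j_1\dots j_m}\,\gamma_{i\,i_1\dots i_m}-\frac1m\,a_{ij_2\dots j_m}\,a_{i_1\dots i_m,\,j_1}=\Gamma^j_{\ i_1j_1}\{-a_{ii_2\dots i_m}\,a_{jj_2\dots j_m}+a_{iji_3\dots i_m}\,a_{i_2j_2j_3\dots j_m}\},$$ and which, with respect to coordinate changes on $M$, obey the rules of transformation of the coefficients of a linear connection.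
   Context: Let $M$ be a smooth $n$-dimensional manifold with induced coordinates $(x^i,y^i)$ on $TM$. An $m$-th root metric space ($m\ge 2$) is $(M,F)$ with $F=\sqrt[m]{a_{i_1\dots i_m}(x)y^{i_1}\cdots y^{i_m}}$, $a_{i_1\dots i_m}$ totally symmetric, with nondegenerate (here: positive definite) Finsler metric $g_{ij}=\frac12\frac{\partial^2F^2}{\partial y^i\partial y^j}$ on $TM\setminus\{0\}$. Here $a_{i_1\dots i_m,\,r}=\partial a_{i_1\dots i_m}/\partial x^r$ and $\gamma_{i\,i_1\dots i_m}=\frac1{m(m-1)}\Big(\sum_{(i_1,\dots,i_m)}\frac{\partial a_{ii_2\dots i_m}}{\partial x^{i_1}}-\frac{\partial a_{i_1\dots i_m}}{\partial x^i}\Big)$, where $\sum_{(i_1,\dots,i_m)}$ is the cyclic sum. The repeated index $j$ is summed. Symmetrization means summing over all permutations of the listed indices, i.e. the equality is the identification of coefficients of homogeneous polynomials of degree $2m$ in $y$. Two Finsler metrics on $M$ are projective (to each other) if every geodesic of either one coincides, as a set of points, with a geodesic of the other. $(M,F)$ is Riemann-projective if it is projective to some Riemannian space on $M$. *)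

(* Defs.v *)
From mathcomp Require Import all_boot all_order all_algebra all_fingroup.
From mathcomp Require Import all_classical all_reals all_analysis.

Set Implicit Arguments.
Unset Strict Implicit.
Unset Printing Implicit Defensive.

Import Order.TTheory GRing.Theory Num.Theory.
Import numFieldNormedType.Exports.

Local Open Scope classical_set_scope.
Local Open Scope ring_scope.

(* C^k on an open set U, through iterated directional derivatives; only the
   germs of f at the points of U matter. *)
Fixpoint Ck (R : realType) (V W : normedModType R) (U : set V) (k : nat)
    (f : V -> W) : Prop :=
  (forall x, U x -> {for x, continuous f}) /\
  if k is k'.+1 then
    forall v, (forall x, U x -> derivable f x v) /\ Ck U k' ('D_v f)
  else True.

Definition smooth (R : realType) (V W : normedModType R) (U : set V)
  (f : V -> W) : Prop := forall k, Ck U k f.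

Definition basis_vec (R : realType) (n : nat) (i : 'I_n) : 'rV[R]_n :=
  delta_mx ord0 i.

Definition partial (R : realType) (n : nat) (i : 'I_n) (f : 'rV[R]_n -> R)
  (x : 'rV[R]_n) : R := 'D_(basis_vec R i) f x.

(* The values of cmap outside cdom, and of cinv outside the image of cdom,
   are irrelevant. *)
Record chart (R : realType) (n : nat) (M : topologicalType) := Chart {
  cdom : set M;
  cmap : M -> 'rV[R]_n;
  cinv : 'rV[R]_n -> M;
  cdom_open : open cdom;
  cimage_open : open (cmap @` cdom);
  cmapK : forall p, cdom p -> cinv (cmap p) = p;
  cmap_continuous : forall p, cdom p -> {for p, continuous cmap};
  cinv_continuous : forall x, (cmap @` cdom) x -> {for x, continuous cinv}
}.

Section Charts.
Variables (R : realType) (n : nat) (M : topologicalType).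
Implicit Types phi psi : chart R n M.

Definition cimage phi : set 'rV[R]_n := cmap phi @` cdom phi.

(* Coordinate change from phi to psi, on the image of the common domain. *)
Definition overlap phi psi : set 'rV[R]_n :=
  cmap phi @` (cdom phi `&` cdom psi).
Definition transition phi psi (x : 'rV[R]_n) : 'rV[R]_n :=
  cmap psi (cinv phi x).
Definition transition_coord phi psi (i : 'I_n) (x : 'rV[R]_n) : R :=
  transition phi psi x ord0 i.

Definition compatible phi psi : Prop :=
  smooth (overlap phi psi) (transition phi psi) /\
  smooth (overlap psi phi) (transition psi phi).

End Charts.

(* atlas is the maximal atlas: its elements are all the coordinate charts. *)
Record smooth_manifold (R : realType) (n : nat) := SmoothManifold {
  carrier :> topologicalType;
  carrier_hausdorff : hausdorff_space carrier;
  carrier_second_countable : @second_countable carrier;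
  atlas : set (chart R n carrier);
  atlas_cover : forall p, exists2 phi, atlas phi & cdom phi p;
  atlas_compatible :
    forall phi psi, atlas phi -> atlas psi -> compatible phi psi;
  atlas_maximal :
    forall phi, (forall psi, atlas psi -> compatible phi psi) -> atlas phi
}.

(* A function on TM, given by its expressions F phi x y in the induced
   coordinates (x, y) of each chart phi. *)
Definition TM_function (R : realType) (n : nat) (M : smooth_manifold R n) :=
  chart R n M -> 'rV[R]_n -> 'rV[R]_n -> R.

(* Components of a covariant m-tensor in each chart: a phi x [:: i1; ...; im].
   Only lists of length m are used. *)
Definition components (R : realType) (n : nat) (M : smooth_manifold R n) :=
  chart R n M -> 'rV[R]_n -> seq 'I_n -> R.

Section Finsler.
Variables (R : realType) (n : nat) (M : smooth_manifold R n).
Implicit Types (F G : TM_function M) (phi psi : chart R n M).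

(* The tangent part of a change of induced coordinates is the derivative of
   the transition map in the direction y. *)
Definition TM_invariant F : Prop :=
  forall phi psi, atlas phi -> atlas psi ->
  forall x y, overlap phi psi x ->
    F phi x y = F psi (transition phi psi x) ('D_y (transition phi psi) x).

Definition fundamental_tensor F phi (x y : 'rV[R]_n) (i j : 'I_n) : R :=
  2^-1 * partial i (partial j (fun z => F phi x z ^+ 2)) y.

Definition finsler_metric F : Prop :=
  TM_invariant F /\
  forall phi, atlas phi ->
  [/\ smooth [set z : 'rV[R]_n * 'rV[R]_n | cimage phi z.1 /\ z.2 != 0]
        (fun z : 'rV[R]_n * 'rV[R]_n => F phi z.1 z.2),
      forall (x y : 'rV[R]_n), cimage phi x -> y != 0 -> 0 < F phi x y,
      forall (x y : 'rV[R]_n) (l : R), cimage phi x -> 0 < l ->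
        F phi x (l *: y) = l * F phi x y
    & forall (x y v : 'rV[R]_n), cimage phi x -> y != 0 -> v != 0 ->
        0 < \sum_(i < n) \sum_(j < n)
              fundamental_tensor F phi x y i j * v ord0 i * v ord0 j].

Definition mform (m : nat) (b : 'rV[R]_n -> seq 'I_n -> R)
    (x y : 'rV[R]_n) : R :=
  \sum_(I : m.-tuple 'I_n) b x I * \prod_(i <- I) y ord0 i.

(* The tensor law for a follows from the invariance of F on TM and the
   symmetry of a. *)
Definition mth_root_metric (m : nat) (a : components M) F : Prop :=
  finsler_metric F /\
  forall phi, atlas phi ->
  [/\ forall I, size I = m -> smooth (cimage phi) (fun x => a phi x I),
      forall x I J, cimage phi x -> size I = m -> perm_eq I J ->
        a phi x I = a phi x J
    & forall x y, cimage phi x ->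
        0 <= mform m (a phi) x y /\
        F phi x y = mform m (a phi) x y `^ (m%:R)^-1].

Definition riemannian_metric G : Prop :=
  finsler_metric G /\
  exists h : chart R n M -> 'rV[R]_n -> 'I_n -> 'I_n -> R,
  forall phi, atlas phi ->
  [/\ forall i j, smooth (cimage phi) (fun x => h phi x i j),
      forall x i j, cimage phi x -> h phi x i j = h phi x j i
    & forall x y, cimage phi x ->
        G phi x y = Num.sqrt
          (\sum_(i < n) \sum_(j < n) h phi x i j * y ord0 i * y ord0 j)].

(* A smooth regular curve on a nonempty open interval that is an extremal of
   the length integral of F (in an arbitrary parametrization): it satisfies
   the Euler-Lagrange equations d/dt F_{y^i} = F_{x^i} in every chart. *)
Definition geodesic F (T : set R) (c : R -> M) : Prop :=
  [/\ open T, is_interval T, T !=set0,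
      (forall t, T t -> {for t, continuous c})
    & forall phi, atlas phi ->
      let Tphi := [set t | T t /\ cdom phi (c t)] in
      let x := fun t => cmap phi (c t) in
      [/\ smooth Tphi x,
          forall t, Tphi t -> derive1 x t != 0
        & forall t i, Tphi t ->
            derive1 (fun s => partial i (F phi (x s)) (derive1 x s)) t
            = partial i (fun z => F phi z (derive1 x t)) (x t)]].

Definition projective F G : Prop :=
  (forall T c, geodesic F T c ->
     exists T' c', geodesic G T' c' /\ c @` T = c' @` T') /\
  (forall T c, geodesic G T c ->
     exists T' c', geodesic F T' c' /\ c @` T = c' @` T').

Definition riemann_projective F : Prop :=
  exists G, riemannian_metric G /\ projective F G.

(* Smooth functions Gam phi x i j k = Gamma^i_{jk}(x) in each chart with
   Gamma'^l_{pq}(x') = dx'^l/dx^i (Gamma^i_{jk}(x) dx^j/dx'^p dx^k/dx'^q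
                                   + d^2 x^i / dx'^p dx'^q). *)
Definition linear_connection
    (Gam : chart R n M -> 'rV[R]_n -> 'I_n -> 'I_n -> 'I_n -> R) : Prop :=
  (forall phi, atlas phi -> forall i j k,
     smooth (cimage phi) (fun x => Gam phi x i j k)) /\
  forall phi psi, atlas phi -> atlas psi ->
  forall x, overlap phi psi x -> forall l p q,
    let x' := transition phi psi x in
    Gam psi x' l p q =
    \sum_(i < n) partial i (transition_coord phi psi l) x *
      (\sum_(j < n) \sum_(k < n) Gam phi x i j k
         * partial p (transition_coord psi phi j) x'
         * partial q (transition_coord psi phi k) x'
       + partial p (partial q (transition_coord psi phi i)) x').

End Finsler.

Section RootCoefficients.
Variables (R : realType) (n m : nat) (b : 'rV[R]_n -> seq 'I_n -> R).
Implicit Types (x : 'rV[R]_n) (i : 'I_n) (I J : seq 'I_n).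

(* a_{I,r}(x) *)
Definition da x I (r : 'I_n) : R := partial r (fun z => b z I) x.

(* In the list accesses below i is only a default value: the lists I, J have
   length m >= 2. *)
Definition gam x i I : R :=
  (m%:R * (m%:R - 1))^-1 *
  (\sum_(r < m) da x (i :: behead (rot r I)) (head i (rot r I)) - da x I i).

Definition root_lhs x i I J : R :=
  b x J * gam x i I - m%:R^-1 * b x (i :: behead J) * da x I (head i J).

Definition root_rhs (Gam : 'rV[R]_n -> 'I_n -> 'I_n -> 'I_n -> R) x i I J : R :=
  \sum_(j < n) Gam x j (head i I) (head i J) *
    (- (b x (i :: behead I) * b x (j :: behead J))
     + b x [:: i, j & drop 2 I] * b x (nth i I 1 :: behead J)).

End RootCoefficients.

Definition symmetrize (R : realType) (n m : nat)
    (f : seq 'I_n -> seq 'I_n -> R) (I J : m.-tuple 'I_n) : R :=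
  \sum_(s : 'S_(m + m))
    let K := [tuple tnth [tuple of I ++ J] (s r) | r < m + m] in
    f (take m K) (drop m K).

(* Main.v *)
Require Import Defs.
From mathcomp Require Import all_boot all_order all_algebra all_fingroup.
From mathcomp Require Import all_classical all_reals all_analysis.
From mathcomp Require Import complex spectral ring lra zify.

(* Write F = A^(1/m), with A(x, .) a form of degree m. By polarization the
   equation of the statement is the vanishing, for every direction y, of the
   Euler-Lagrange expression of F on the geodesics of Gamma (Rapcsak's
   equation).
   If the equation holds, let B be the covariant derivative of A along y.
   Restricting Rapcsak's equation to a generic line of a fibre makes A divide
   B: the first derivatives of A are multiples of gcd (P, P'), for P the
   restriction of A, because a one-parameter deformation of P cannot lower the
   multiplicity of a root by more than one, and P has no real root. Hence
   B = theta A with theta linear in y, and correcting Gamma by theta yields a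
   connection with the same unparametrized geodesics for which A is parallel.
   Parallel transport then preserves the unit balls of F, hence their ellipsoids
   of least volume (Loewner), so that these define a smooth Riemannian metric
   that is parallel for the same connection.
   Conversely, let Gamma be the Levi-Civita connection of a Riemannian metric
   projective to F. Its geodesics, parametrized by one of the coordinates, solve
   an ordinary differential equation, and are geodesics of F after a change of
   parameter; evaluating the Euler-Lagrange equations of F at the initial point
   gives Rapcsak's equation there. *)

Set Implicit Arguments.
Unset Strict Implicit.
Unset Printing Implicit Defensive.

Import Order.TTheory GRing.Theory Num.Theory.
Import numFieldNormedType.Exports.

Local Open Scope classical_set_scope.
Local Open Scope ring_scope.

(** * Calculus of functions of class C^k *)

(** The obstacle is that A may have multiple factors: Rapcsak's equation, of the shape A (...) = (m
    - 1) A_i B, does not make A divide B by coprimality. On a line it is a first order relation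
    between P and the restriction Q of B. Comparing lowest order terms at a complex root of
    multiplicity k of P raises the order of Q from k - 1 to k through the factor k - m, and k = m
    would make P a pure power with a real root. Genericity of the line means that the degree of gcd
    (P, P') is minimal on an open set; that set is taken to be the one where the conclusion fails,
    which avoids a density argument. A Loewner form is defined by an extremum, so nothing is known
    beforehand on its regularity in x. Its uniqueness compensates: transport gives an explicit
    derivative on every line, and the resulting linear equation bootstraps to smoothness. Uniqueness
    also gives the tensor law. Projectivity compares geodesics as point sets only. With a coordinate
    as parameter, the change of parameter can be read off from the points, and no uniqueness theorem
    for geodesics is invoked. *)

Section Derivations.
Variables (R : realType) (V : normedModType R).
Implicit Types (f g : V -> R) (x v : V).

Lemma isd_add f g x v df dg : is_derive x v f df -> is_derive x v g dg ->
  is_derive x v (fun z => f z + g z) (df + dg).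
Proof. by move=> df' dg'; exact: (@is_deriveD _ _ _ f g). Qed.

Lemma isd_sub f g x v df dg : is_derive x v f df -> is_derive x v g dg ->
  is_derive x v (fun z => f z - g z) (df - dg).
Proof. by move=> df' dg'; exact: (@is_deriveB _ _ _ f g). Qed.

Lemma isd_mul f g x v df dg : is_derive x v f df -> is_derive x v g dg ->
  is_derive x v (fun z => f z * g z) (df * g x + f x * dg).
Proof.
move=> df' dg'; apply: is_derive_eq (@is_deriveM _ _ f g x v df dg _ _) _.
by rewrite /GRing.scale /= addrC mulrC.
Qed.

Lemma isd_cst (c : R) x v : is_derive x v (fun _ : V => c) 0.
Proof. exact: is_derive_cst. Qed.

Lemma isd_mull (c : R) f x v df : is_derive x v f df ->
  is_derive x v (fun z => c * f z) (c * df).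
Proof.
by move=> df'; apply: is_derive_eq (isd_mul (isd_cst c x v) df') _; rewrite mul0r add0r.
Qed.

Lemma isd_mulr (c : R) f x v df : is_derive x v f df ->
  is_derive x v (fun z => f z * c) (df * c).
Proof.
move=> df'; apply: is_derive_eq (isd_mul df' (isd_cst c x v)) _.
by rewrite mulr0 addr0.
Qed.

Lemma isd_sum (I : Type) (r : seq I) (P : pred I) (f : I -> V -> R) x v
    (df : I -> R) :
  (forall i, P i -> is_derive x v (f i) (df i)) ->
  is_derive x v (fun z => \sum_(i <- r | P i) f i z) (\sum_(i <- r | P i) df i).
Proof.
move=> H; elim: r => [|i r IH].
  rewrite big_nil (_ : (fun _ => _) = fun _ => 0); first exact: isd_cst.
  by apply/funext => z; rewrite big_nil.
rewrite big_cons (_ : (fun _ => _) =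
  fun z => if P i then f i z + \sum_(j <- r | P j) f j z
           else \sum_(j <- r | P j) f j z); last first.
  by apply/funext => z; rewrite big_cons.
by case: ifPn => // Pi; apply: isd_add => //; exact: H.
Qed.

(** Reduction to one real variable, where the chain rule and the mean value theorem are applied. *)
Lemma isd_line (W : normedModType R) (f : V -> W) x v t l :
  is_derive (x + t *: v) v f l <->
  is_derive t 1 (fun h : R => f (x + h *: v)) l.
Proof.
have E : (fun h : R => h^-1 *: ((f \o shift (x + t *: v)) (h *: v)
                                 - f (x + t *: v))) =
  (fun h : R => h^-1 *: (((fun h => f (x + h *: v)) \o shift t) (h *: 1)
                                 - f (x + t *: v))).
  apply/funext => h /=; congr (_ *: (f _ - _)).
  by rewrite [h *: 1]mulr1 scalerDl addrCA.
have D : 'D_v f (x + t *: v) = 'D_1 (fun h : R => f (x + h *: v)) t.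
  by rewrite /derive E.
split=> -[d e]; split; rewrite -?e ?D //; move: d; rewrite /derivable E //.
Qed.

Lemma isd_line0 (W : normedModType R) (f : V -> W) x v l :
  is_derive x v f l <-> is_derive (0 : R) 1 (fun h : R => f (x + h *: v)) l.
Proof. by rewrite -isd_line scale0r addr0. Qed.

Lemma isd_comp1 (g : R -> R) f x v df dg :
  is_derive x v f df -> is_derive (f x) (1 : R) g dg ->
  is_derive x v (fun z => g (f z)) (dg * df).
Proof.
move=> /isd_line0 df' dg'.
have df1 : derivable (fun h : R => f (x + h *: v)) 0 1 by [].
apply/isd_line0; have := df'; have := dg'.
rewrite -{1}[x]addr0 -[X in x + X](scale0r v) => dg2 df2.
have H : derivable (g \o (fun h : R => f (x + h *: v))) 0 1.
  apply/derivable1_diffP/differentiable_comp; apply/derivable1_diffP => //.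
split=> //.
rewrite -derive1E (derive1_comp df1) ?derive1E; last exact: ex_derive.
by rewrite !derive_val.
Qed.

Lemma isd_powR (a : R) f x v df : 0 < f x -> is_derive x v f df ->
  is_derive x v (fun z => f z `^ a) (a * f x `^ (a - 1) * df).
Proof.
move=> f0 df'.
exact: (isd_comp1 df' (is_derive1_powR a f0)).
Qed.

Lemma isd_near (W : normedModType R) (U : set V) (f g : V -> W) x v l :
  open U -> U x -> (forall z, U z -> f z = g z) ->
  is_derive x v f l -> is_derive x v g l.
Proof.
move=> oU Ux fg; apply: near_eq_is_derive.
by near do apply: fg; apply: open_nbhs_nbhs.
Unshelve. all: by end_near. Qed.

Lemma isd_unique (W : normedModType R) (f : V -> W) x v l l' :
  is_derive x v f l -> is_derive x v f l' -> l = l'.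
Proof. by move=> [_ <-] [_ <-]. Qed.

End Derivations.

Section CkLemmas.
Variables (R : realType).
Implicit Types (V W : normedModType R).

Lemma continuous_near_eq V W (U : set V) (f g : V -> W) x : open U -> U x ->
  (forall x, U x -> f x = g x) -> {for x, continuous f} -> {for x, continuous g}.
Proof.
move=> oU Ux fg cf.
have : g @ x --> f x.
  apply: cvg_trans cf; apply: near_eq_cvg.
  by near do apply: fg; exact: open_nbhs_nbhs.
by rewrite (fg x Ux).
Unshelve. all: by end_near. Qed.

Lemma Ck_eq V W (U : set V) k (f g : V -> W) : open U ->
  (forall x, U x -> f x = g x) -> Ck U k f -> Ck U k g.
Proof.
move=> oU; elim: k f g => [|k IH] f g fg /= [cf df].
  by split=> // x Ux; exact: (continuous_near_eq oU Ux fg (cf x Ux)).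
have nfg x : U x -> \near x, f x = g x.
  by move=> Ux; near do apply: fg; exact: open_nbhs_nbhs.
split.
  by move=> x Ux; exact: (continuous_near_eq oU Ux fg (cf x Ux)).
move=> v; split.
  by move=> x Ux; apply: near_eq_derivable (nfg x Ux) _; exact: (df v).1.
apply: IH (df v).2 => x Ux; exact: near_eq_derive (nfg x Ux).
Unshelve. all: by end_near. Qed.

Lemma CkS V W (U : set V) k (f : V -> W) : Ck U k.+1 f -> Ck U k f.
Proof.
elim: k f => [|k IH] f [cf df]; first by split.
by split=> // v; split; [exact: (df v).1|exact: IH (df v).2].
Qed.

Lemma CkW V W (U : set V) k l (f : V -> W) : (l <= k)%N -> Ck U k f -> Ck U l f.
Proof.
move=> /subnK <-; elim: (k - l)%N => // j IH /CkS; exact: IH.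
Qed.

Lemma Ck_sub V W (U U' : set V) k (f : V -> W) : U' `<=` U -> Ck U k f -> Ck U' k f.
Proof.
move=> sU; elim: k f => [|k IH] f [cf df]; split=> //; try by move=> x /sU/cf.
by move=> v; split; [move=> x /sU; exact: (df v).1|exact: IH (df v).2].
Qed.

Lemma Ck_cont V W (U : set V) k (f : V -> W) x :
  Ck U k f -> U x -> {for x, continuous f}.
Proof. by case: k => [|k] [cf _]; exact: cf. Qed.

Lemma Ck_derive V W (U : set V) k (f : V -> W) x v :
  Ck U k.+1 f -> U x -> is_derive x v f ('D_v f x).
Proof. by move=> [_ /(_ v)[d _]] Ux; apply: derivableP; exact: d. Qed.

Lemma Ck_D V W (U : set V) k (f : V -> W) v : Ck U k.+1 f -> Ck U k ('D_v f).
Proof. by case=> _ /(_ v) []. Qed.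

(* Induction step: the directional derivatives only have to be known on [U]. *)
Lemma Ck_step V W (U : set V) k (f : V -> W) (df : V -> V -> W) : open U ->
  (forall x, U x -> {for x, continuous f}) ->
  (forall v x, U x -> is_derive x v f (df v x)) ->
  (forall v, Ck U k (df v)) -> Ck U k.+1 f.
Proof.
move=> oU cf dfE Cdf; split=> // v; split; first by move=> x /(dfE v)[].
by apply: Ck_eq (Cdf v) => // x /(dfE v) [].
Qed.

Lemma Ck_cst V W (U : set V) k (c : W) : open U -> Ck U k (fun _ => c).
Proof.
move=> oU; elim: k c => [|k IH] c; first by split=> // x _; exact: cvg_cst.
apply: (@Ck_step _ _ _ _ _ (fun _ _ => 0)) => //.
by move=> x _; exact: cvg_cst.
Qed.

Lemma Ck_add V (U : set V) k (f g : V -> R) : open U ->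
  Ck U k f -> Ck U k g -> Ck U k (fun x => f x + g x).
Proof.
move=> oU; elim: k f g => [|k IH] f g Cf Cg.
  by split=> // x Ux; apply: cvgD; [exact: Ck_cont Cf Ux|exact: Ck_cont Cg Ux].
apply: (@Ck_step _ _ _ _ _ (fun v x => 'D_v f x + 'D_v g x)) => //.
- by move=> x Ux; apply: cvgD; [exact: Ck_cont Cf Ux|exact: Ck_cont Cg Ux].
- by move=> v x Ux; apply: isd_add; [exact: Ck_derive Cf Ux|exact: Ck_derive Cg Ux].
- by move=> v; apply: IH; [exact: (Cf.2 v).2|exact: (Cg.2 v).2].
Qed.

Lemma Ck_mul V (U : set V) k (f g : V -> R) : open U ->
  Ck U k f -> Ck U k g -> Ck U k (fun x => f x * g x).
Proof.
move=> oU; elim: k f g => [|k IH] f g Cf Cg.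
  by split=> // x Ux; apply: cvgM; [exact: Ck_cont Cf Ux|exact: Ck_cont Cg Ux].
apply: (@Ck_step _ _ _ _ _ (fun v x => 'D_v f x * g x + f x * 'D_v g x)) => //.
- by move=> x Ux; apply: cvgM; [exact: Ck_cont Cf Ux|exact: Ck_cont Cg Ux].
- by move=> v x Ux; apply: isd_mul; [exact: Ck_derive Cf Ux|exact: Ck_derive Cg Ux].
- move=> v; apply: Ck_add => //; apply: IH; try exact: CkS.
    exact: (Cf.2 v).2.
  exact: (Cg.2 v).2.
Qed.

Lemma Ck_mull V (U : set V) k c (f : V -> R) : open U ->
  Ck U k f -> Ck U k (fun x => c * f x).
Proof. by move=> oU; apply: Ck_mul => //; exact: Ck_cst. Qed.

Lemma Ck_opp V (U : set V) k (f : V -> R) : open U ->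
  Ck U k f -> Ck U k (fun x => - f x).
Proof.
move=> oU /(Ck_mull (-1) oU) C; apply: (Ck_eq oU _ C) => x _.
by rewrite mulN1r.
Qed.

Lemma Ck_sub_fun V (U : set V) k (f g : V -> R) : open U ->
  Ck U k f -> Ck U k g -> Ck U k (fun x => f x - g x).
Proof. by move=> oU Cf Cg; apply: Ck_add => //; exact: Ck_opp. Qed.

Lemma Ck_sum V (U : set V) k (I : Type) (r : seq I) (P : pred I)
    (f : I -> V -> R) : open U ->
  (forall i, P i -> Ck U k (f i)) -> Ck U k (fun x => \sum_(i <- r | P i) f i x).
Proof.
move=> oU H; elim: r => [|i r IH].
  by apply: (Ck_eq oU _ (Ck_cst k (0 : R) oU)) => x _; rewrite big_nil.
case: (boolP (P i)) => Pi.
  by apply: (Ck_eq oU _ (Ck_add oU (H i Pi) IH)) => x _; rewrite big_cons Pi.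
by apply: (Ck_eq oU _ IH) => x _; rewrite big_cons (negbTE Pi).
Qed.

Lemma Ck_prod V (U : set V) k (I : Type) (r : seq I) (P : pred I)
    (f : I -> V -> R) : open U ->
  (forall i, P i -> Ck U k (f i)) -> Ck U k (fun x => \prod_(i <- r | P i) f i x).
Proof.
move=> oU H; elim: r => [|i r IH].
  by apply: (Ck_eq oU _ (Ck_cst k (1 : R) oU)) => x _; rewrite big_nil.
case: (boolP (P i)) => Pi.
  by apply: (Ck_eq oU _ (Ck_mul oU (H i Pi) IH)) => x _; rewrite big_cons Pi.
by apply: (Ck_eq oU _ IH) => x _; rewrite big_cons (negbTE Pi).
Qed.

(** The derivative involves the exponent a - 1, so the induction on k runs over all exponents at
    once. *)
Lemma Ck_powR V (U : set V) k (a : R) (f : V -> R) : open U ->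
  (forall x, U x -> 0 < f x) -> Ck U k f -> Ck U k (fun x => f x `^ a).
Proof.
move=> oU f0.
have cont (g : V -> R) (b : R) : (forall x, U x -> {for x, continuous g}) ->
    (forall x, U x -> 0 < g x) ->
    forall x, U x -> {for x, continuous (fun x : V => g x `^ b)}.
  move=> cg g0 x Ux.
  apply: (@continuous_comp _ _ _ g (fun z => z `^ b)); first exact: cg.
  apply/differentiable_continuous/derivable1_diffP.
  by have [] := is_derive1_powR b (g0 x Ux).
elim: k a => [|k IH] a Cf; first by split=> //; apply: cont => //; apply: Cf.1.
apply: (@Ck_step _ _ _ _ _ (fun v x => a * f x `^ (a - 1) * 'D_v f x)) => //.
- by apply: cont => // x Ux; exact: Ck_cont Cf Ux.
- by move=> v x Ux; apply: isd_powR; [exact: f0|exact: Ck_derive Cf Ux].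
- move=> v; apply: Ck_mul => //; last exact: (Cf.2 v).2.
  by apply: Ck_mull => //; apply: IH; exact: CkS.
Qed.

(** Since f may have either sign, the inverse is written as f times the power -1 of the positive
    function f^2. *)
Lemma Ck_inv V (U : set V) k (f : V -> R) : open U ->
  (forall x, U x -> f x != 0) -> Ck U k f -> Ck U k (fun x => (f x)^-1).
Proof.
move=> oU f0 Cf.
have C2 : Ck U k (fun x => (f x * f x) `^ (-1)).
  apply: Ck_powR => //; last exact: Ck_mul.
  by move=> x Ux; rewrite -expr2 exprn_even_gt0 //= f0.
apply: (Ck_eq oU _ (Ck_mul oU Cf C2)) => x Ux.
rewrite powR_inv1 -?expr2 ?sqr_ge0 //.
by rewrite expr2 invfM mulrA divff ?f0 // mul1r.
Qed.

Lemma Ck_linear V (U : set V) k (f : V -> R) : open U -> linear f ->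
  continuous f -> Ck U k f.
Proof.
move=> oU lf cf; case: k => [|k]; first by split=> // x _; exact: cf.
apply: (@Ck_step _ _ _ _ _ (fun v _ => f v)) => //.
- by move=> x _; exact: cf.
- move=> v x _; apply/isd_line0.
  have -> : (fun h : R => f (x + h *: v)) = (fun h => f x + h * f v).
    by apply/funext => h; rewrite addrC lf addrC.
  have H := isd_mulr (f v) (is_derive_id (0 : R) (1 : R)).
  apply: is_derive_eq (isd_add (isd_cst (f x) (0 : R) (1 : R)) H) _.
  by rewrite add0r mul1r.
- by move=> v; exact: Ck_cst.
Qed.

End CkLemmas.

Section RowCalculus.
Variables (R : realType).
Implicit Types (V W : normedModType R) (n : nat).

Lemma cvg_sumr (T : Type) (F : set_system T) {FF : Filter F} (I : Type)
    (r : seq I) (P : pred I) (f : I -> T -> R) (l : I -> R) :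
  (forall i, P i -> f i x @[x --> F] --> l i) ->
  \sum_(i <- r | P i) f i x @[x --> F] --> \sum_(i <- r | P i) l i.
Proof.
move=> H; elim: r => [|i r IH].
  rewrite big_nil (_ : (fun _ => _) = fun _ => 0); first exact: cvg_cst.
  by apply/funext => z; rewrite big_nil.
rewrite big_cons (_ : (fun _ => _) =
  fun z => if P i then f i z + \sum_(j <- r | P j) f j z
           else \sum_(j <- r | P j) f j z); last first.
  by apply/funext => z; rewrite big_cons.
by case: ifPn => // Pi; apply: cvgD => //; exact: H.
Qed.

Lemma mx_coord_le m n (x : 'M[R]_(m, n)) i j : `|x i j| <= `|x|.
Proof.
rewrite [leRHS]/Num.Def.normr /= mx_normrE.
exact: (le_bigmax _ (fun p : 'I_m * 'I_n => `|x p.1 p.2|) (i, j)).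
Qed.

Lemma mx_norm_le m n (x : 'M[R]_(m, n)) (c : R) : 0 <= c ->
  (forall i j, `|x i j| <= c) -> `|x| <= c.
Proof.
move=> c0 H; rewrite [leLHS]/Num.Def.normr /= mx_normrE.
by apply: bigmax_le => // -[i j] _; exact: H.
Qed.

Lemma cvg_mx (T : Type) (F : set_system T) {FF : Filter F} m n
    (f : T -> 'M[R]_(m, n)) (l : 'M[R]_(m, n)) :
  f @ F --> l <-> forall i j, f x i j @[x --> F] --> l i j.
Proof.
split=> [fl i j|H].
  apply/cvgrPdist_le => e e0; move/cvgrPdist_le: fl => /(_ e e0).
  apply: filterS => x; apply: le_trans.
  by have := mx_coord_le (l - f x) i j; rewrite !mxE.
apply/cvgrPdist_le => e e0; near=> x.
apply: mx_norm_le; first exact: ltW.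
suff : forall p : 'I_m * 'I_n, `|l p.1 p.2 - f x p.1 p.2| <= e.
  by move=> K i j; rewrite !mxE; exact: (K (i, j)).
near: x; apply: filter_forall => -[i j] /=.
by have /cvgrPdist_le := H i j; exact.
Unshelve. all: by end_near. Qed.

Lemma continuous_coord m n (i : 'I_m) (j : 'I_n) :
  continuous (fun x : 'M[R]_(m, n) => x i j).
Proof.
move=> x.
have := (@cvg_mx _ (nbhs x) _ m n id x).1; apply.
exact: cvg_id.
Qed.

Lemma isd_mx V m n (f : V -> 'M[R]_(m, n)) x v (l : 'M[R]_(m, n)) :
  is_derive x v f l <->
  forall i j, is_derive x v (fun z => f z i j) (l i j).
Proof.
split=> [[d e] i j|H].
  have d' := (derivable_mxP f x v).1 d i j; split=> //.
  by move: e; rewrite derive_mx // => /matrixP /(_ i j); rewrite mxE.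
have d : derivable f x v.
  by apply/derivable_mxP => i j; have [] := H i j.
split=> //; rewrite derive_mx //; apply/matrixP => i j; rewrite mxE.
by have [] := H i j.
Qed.

Lemma Ck_mx V (U : set V) k m n (f : V -> 'M[R]_(m, n)) : open U ->
  Ck U k f <-> forall i j, Ck U k (fun x => f x i j).
Proof.
move=> oU; split.
  elim: k f => [|k IH] f Cf i j.
    by split=> // x Ux; move: i j; apply/cvg_mx; exact: Cf.1.
  apply: (@Ck_step _ _ _ _ _ _ (fun v x => 'D_v f x i j)) => //.
  - by move=> x Ux; move: i j; apply/cvg_mx; exact: Cf.1.
  - by move=> v x Ux; move: i j; apply/isd_mx; exact: Ck_derive Cf Ux.
  - by move=> v; apply: IH; exact: Ck_D.
elim: k f => [|k IH] f Cf.
  by split=> // x Ux; apply/cvg_mx => i j; exact: (Cf i j).1.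
apply: (@Ck_step _ _ _ _ _ _
  (fun v x => \matrix_(i, j) 'D_v (fun x => f x i j) x)) => //.
- by move=> x Ux; apply/cvg_mx => i j; exact: (Cf i j).1.
- by move=> v x Ux; apply/isd_mx => i j; rewrite mxE; exact: Ck_derive (Cf i j) Ux.
- move=> v; apply: IH => i j.
  by apply: (Ck_eq oU _ (Ck_D v (Cf i j))) => x _; rewrite mxE.
Qed.

Lemma isd_scale V (f : V -> R) x v l c :
  is_derive x v f l -> is_derive x (c *: v) f (c * l).
Proof.
move=> /isd_line0 H; apply/isd_line0.
have -> : (fun h : R => f (x + h *: (c *: v))) =
          (fun h : R => (fun h => f (x + h *: v)) (h * c)).
  by apply/funext => h; rewrite scalerA.
have K := isd_mulr c (is_derive_id (0 : R) (1 : R)).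
have H' : is_derive ((0 : R) * c) (1 : R) (fun h : R => f (x + h *: v)) l.
  by rewrite mul0r.
by apply: is_derive_eq (isd_comp1 K H') _; rewrite mul1r mulrC.
Qed.

Lemma is_derive_continuous (W : normedModType R) (f : R -> W) (t : R) l :
  is_derive t 1 f l -> {for t, continuous f}.
Proof.
by move=> [d _]; apply/differentiable_continuous/derivable1_diffP.
Qed.

Lemma MVT_line V (U : set V) (f : V -> R) x w : Ck U 1 f ->
  (forall h : R, 0 <= h <= 1 -> U (x + h *: w)) ->
  exists2 h : R, 0 <= h <= 1 & f (x + w) - f x = 'D_w f (x + h *: w).
Proof.
move=> Cf Uw; pose g (h : R) := f (x + h *: w).
have dg (h : R) : 0 <= h <= 1 -> is_derive h 1 g ('D_w f (x + h *: w)).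
  by move=> hh; apply: (isd_line f x w h _).1; apply: (Ck_derive w Cf); exact: Uw.
have [] := @MVT R g (fun h => 'D_w f (x + h *: w)) 0 1 ltr01.
- move=> h; rewrite in_itv /= => /andP[h0 h1].
  by apply: dg; rewrite !ltW.
- apply: continuous_in_subspaceT => h; rewrite inE /= in_itv /= => hh.
  exact: is_derive_continuous (dg h hh).
- move=> h; rewrite in_itv /= => /andP[h0 h1]; rewrite /g subr0 mulr1.
  rewrite scale1r scale0r addr0 => E.
  by exists h => //; rewrite !ltW.
Qed.

Lemma row_basis n (w : 'rV[R]_n) :
  w = \sum_(i < n) w ord0 i *: basis_vec R i.
Proof. exact: row_sum_delta. Qed.

(* The increment is split along the coordinate axes, one at a time. *)
Lemma MVT_row n (f : 'rV[R]_n -> R) (x0 : 'rV[R]_n) (r : R) : 0 < r ->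
  Ck (ball x0 r) 1 f -> forall w, `|w| < r -> exists xi : 'I_n -> 'rV[R]_n,
    (forall i, `|xi i - x0| <= `|w|) /\
    f (x0 + w) - f x0 = \sum_(i < n) w ord0 i * partial i f (xi i).
Proof.
move=> r0 Cf w wr.
pose W (k : nat) : 'rV[R]_n := \row_j (if (j < k)%N then w ord0 j else 0).
have WS (i : 'I_n) : W i.+1 = W i + w ord0 i *: basis_vec R i.
  apply/rowP => j; rewrite !mxE eqxx /= ltnS leq_eqVlt.
  have [->|ji] := eqVneq j i; first by rewrite eqxx ltnn /= mulr1 add0r.
  have -> : (j == i :> nat) = false by apply/negbTE.
  by rewrite /= mulr0 addr0.
have Wi (i : 'I_n) (h : R) : 0 <= h <= 1 ->
    `|W i + h *: (w ord0 i *: basis_vec R i)| <= `|w|.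
  move=> /andP[h0 h1]; apply: mx_norm_le => // a j; rewrite !mxE.
  rewrite {a}(ord1 a) eqxx /=.
  have [->|ji] := eqVneq j i.
    rewrite ltnn add0r mulr1 normrM (ger0_norm h0).
    apply: le_trans (mx_coord_le w ord0 i).
    by rewrite ler_piMl.
  rewrite mulr0 mulr0 addr0; case: ifP => _; first exact: mx_coord_le.
  by rewrite normr0.
have step (i : 'I_n) : exists xi, `|xi - x0| <= `|w| /\
    f (x0 + W i.+1) - f (x0 + W i) = w ord0 i * partial i f xi.
  have inb (h : R) : 0 <= h <= 1 ->
      ball x0 r (x0 + W i + h *: (w ord0 i *: basis_vec R i)).
    move=> hh; rewrite -ball_normE /ball_ /= -addrA opprD addNKr normrN.
    exact: le_lt_trans (Wi i h hh) wr.
  have [h hh E] := MVT_line Cf inb.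
  exists (x0 + W i + h *: (w ord0 i *: basis_vec R i)); split.
    by rewrite -(addrA x0) [X in `|X|]addrC addKr; exact: Wi.
  rewrite WS addrA E.
  have H := isd_scale (w ord0 i) (Ck_derive (basis_vec R i) Cf (inb h hh)).
  by have [_ ->] := H.
pose xi i := projT1 (cid (step i)).
exists xi; split=> [i|]; first by have [] := projT2 (cid (step i)).
have {1}-> : w = W n by apply/rowP => j; rewrite !mxE ltn_ord.
have -> : f x0 = f (x0 + W 0%N).
  by congr (f _); rewrite -[LHS]addr0; congr (_ + _); apply/rowP => j; rewrite !mxE.
rewrite -(telescope_sumr (fun k => f (x0 + W k)) (leq0n n)) big_mkord.
by apply: eq_bigr => i _; have [_ ->] := projT2 (cid (step i)).
Qed.

(** [Ck] speaks of directional derivatives only, so the chain rule comes from the mean value form of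
    the increment in [MVT_row]: the intermediate points tend to g x and the partial derivatives of f
    are continuous there. *)
Lemma isd_comp V n (U : set 'rV[R]_n) (f : 'rV[R]_n -> R) (g : V -> 'rV[R]_n)
    x v (dg : 'rV[R]_n) : open U -> Ck U 1 f -> U (g x) ->
  is_derive x v g dg ->
  is_derive x v (fun z => f (g z)) (\sum_(i < n) partial i f (g x) * dg ord0 i).
Proof.
move=> oU Cf Ugx /isd_line0 dg'; apply/isd_line0.
pose G (h : R) := g (x + h *: v).
have G0 : G 0 = g x by rewrite /G scale0r addr0.
have cG : {for (0 : R), continuous G} := is_derive_continuous dg'.
have [r /= r0 rU] : exists2 r : R, 0 < r & ball (g x) r `<=` U.
  have /nbhs_ballP [r r0 rU] : nbhs (g x) U by exact: open_nbhs_nbhs.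
  by exists r.
have Cfr := Ck_sub rU Cf.
pose P (h : R) (xi : 'I_n -> 'rV[R]_n) := `|G h - g x| < r ->
  (forall i, `|xi i - g x| <= `|G h - g x|) /\
  f (G h) - f (g x) = \sum_(i < n) (G h - g x) ord0 i * partial i f (xi i).
have /choice[xi Pxi] : forall h, exists xi, P h xi.
  move=> h; rewrite /P.
  have [Gr|_] := ltP (`|G h - g x|) r; last by exists (fun _ => 0).
  have [xi [H1 H2]] := MVT_row r0 Cfr Gr.
  exists xi => _; split=> //; rewrite -H2; congr (f _ - _).
  by rewrite addrC subrK.
have nG : \forall h \near (0 : R), `|G h - g x| < r.
  have /cvgrPdist_lt /(_ r r0) := cG; rewrite G0.
  by apply: filterS => h; rewrite distrC.
have cxi i : xi h i @[h --> 0^'] --> g x.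
  apply/cvgrPdist_lt => e e0.
  have /cvgrPdist_lt /(_ e e0) := cG; rewrite G0 => nGe.
  near=> h; rewrite distrC.
  have hr : `|G h - g x| < r by near: h; exact: cvg_within.
  have [/(_ i) K _] := Pxi h hr; apply: le_lt_trans K _.
  rewrite distrC; near: h; exact: cvg_within.
have cp i : partial i f (xi h i) @[h --> 0^'] --> partial i f (g x).
  have C := Ck_cont (Ck_D (basis_vec R i) Cf) Ugx.
  exact: (cvg_comp _ _ (cxi i) C).
have cd i : h^-1 * (G h - g x) ord0 i @[h --> 0^'] --> dg ord0 i.
  have : h^-1 *: ((G \o shift 0) (h *: (1 : R)) - G 0) @[h --> 0^'] --> dg.
    by have [d <-] := dg'; exact: d.
  rewrite G0 => /cvg_mx /(_ ord0 i); apply: cvg_trans.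
  apply: near_eq_cvg; near=> h.
  by rewrite !mxE /= addr0 [h *: 1]mulr1.
have cvgS : h^-1 *: (f (G h) - f (g x)) @[h --> 0^']
    --> \sum_(i < n) dg ord0 i * partial i f (g x).
  apply: (@cvg_trans _ (fmap (fun h : R => \sum_(i < n)
    (h^-1 * (G h - g x) ord0 i) * partial i f (xi h i)) 0^')).
    apply: near_eq_cvg; near=> h.
    have hr : `|G h - g x| < r by near: h; exact: cvg_within.
    have [_ ->] := Pxi h hr; rewrite scaler_sumr; apply: eq_bigr => i _.
    by rewrite /GRing.scale /= mulrA.
  have K (i : 'I_n) : true -> (h^-1 * (G h - g x) ord0 i) * partial i f (xi h i)
      @[h --> 0^'] --> dg ord0 i * partial i f (g x).
    by move=> _; apply: cvgM; [exact: cd|exact: cp].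
  by have := @cvg_sumr _ _ _ _ (index_enum 'I_n) xpredT _ _ K; apply.
have cvgS' : h^-1 *: (((fun h => f (G h)) \o shift 0) (h *: (1 : R)) - f (G 0))
    @[h --> 0^'] --> \sum_(i < n) partial i f (g x) * dg ord0 i.
  rewrite G0; under eq_bigr do rewrite mulrC.
  apply: cvg_trans cvgS; apply: near_eq_cvg; near=> h.
  by rewrite /= addr0 [h *: 1]mulr1.
split; first by apply/cvg_ex; eexists; exact: cvgS'.
by apply/cvg_lim => //; exact: cvgS'.
Unshelve. all: by end_near. Qed.

Lemma derive_partial n (U : set 'rV[R]_n) (f : 'rV[R]_n -> R) x v :
  open U -> Ck U 1 f -> U x ->
  is_derive x v f (\sum_(i < n) partial i f x * v ord0 i).
Proof.
by move=> oU Cf Ux; have := @isd_comp _ n U f id x v v oU Cf Ux; apply.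
Qed.

Lemma Ck_comp V n (T : set V) (U : set 'rV[R]_n) k (f : 'rV[R]_n -> R)
    (g : V -> 'rV[R]_n) : open T -> open U -> (forall x, T x -> U (g x)) ->
  Ck U k f -> Ck T k g -> Ck T k (fun x => f (g x)).
Proof.
move=> oT oU TU; elim: k f g TU => [|k IH] f g TU Cf Cg.
  split=> // x Tx; apply: (@continuous_comp _ _ _ g f).
    exact: Ck_cont Cg Tx.
  exact: Ck_cont Cf (TU x Tx).
apply: (@Ck_step _ _ _ _ _ _ (fun v x =>
  \sum_(i < n) partial i f (g x) * ('D_v g x) ord0 i)) => //.
- move=> x Tx; apply: (@continuous_comp _ _ _ g f).
    exact: Ck_cont Cg Tx.
  exact: Ck_cont Cf (TU x Tx).
- move=> v x Tx; apply: (isd_comp oU) => //; last exact: Ck_derive Cg Tx.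
    exact: CkW Cf.
  exact: TU.
- move=> v; apply: Ck_sum => // i _; apply: Ck_mul => //.
    apply: IH => //; last exact: CkS.
    exact: (Ck_D (basis_vec R i) Cf).
  exact: ((Ck_mx _ _ oT).1 (Ck_D v Cg)).
Qed.

End RowCalculus.

Section Schwarz.
Variables (R : realType) (V : normedModType R).
Implicit Types (f : V -> R) (x v w : V).

Lemma derive_scale2 (U : set V) f x v w s : open U -> Ck U 2 f -> U x ->
  'D_(s *: w) ('D_(s *: v) f) x = s ^+ 2 * 'D_w ('D_v f) x.
Proof.
move=> oU Cf Ux.
have E z : U z -> s * 'D_v f z = 'D_(s *: v) f z.
  by move=> Uz; have [_ ->] := isd_scale s (Ck_derive v (CkS Cf) Uz).
have H := isd_mull s (isd_scale s (Ck_derive w (Ck_D v Cf) Ux)).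
have [_ ->] := isd_near oU Ux E H.
by rewrite expr2 mulrA.
Qed.

(** The mean value theorem is applied twice: along v to the difference of f between x + w and x,
    then along w to the derivative so obtained. *)
Lemma second_difference (U : set V) f x v w : open U -> Ck U 2 f ->
  (forall h k : R, 0 <= h <= 1 -> 0 <= k <= 1 -> U (x + h *: v + k *: w)) ->
  exists h k : R, [/\ 0 <= h <= 1, 0 <= k <= 1 &
    f (x + v + w) - f (x + v) - (f (x + w) - f x)
    = 'D_w ('D_v f) (x + h *: v + k *: w)].
Proof.
move=> oU Cf Uvw.
have i0 : 0 <= (0 : R) <= 1 by rewrite lexx ler01.
have i1 : 0 <= (1 : R) <= 1 by rewrite lexx ler01.
pose g (h : R) := f (x + w + h *: v) - f (x + h *: v).
have dg (h : R) : 0 <= h <= 1 ->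
    is_derive h 1 g ('D_v f (x + w + h *: v) - 'D_v f (x + h *: v)).
  move=> hh; apply: isd_sub; apply: (isd_line f _ v h _).1;
    apply: Ck_derive (CkS Cf) _.
    by have := Uvw h 1 hh i1; rewrite scale1r addrAC.
  by have := Uvw h 0 hh i0; rewrite scale0r addr0.
have [] := @MVT R g (fun h => 'D_v f (x + w + h *: v) - 'D_v f (x + h *: v))
  0 1 ltr01.
- by move=> h; rewrite in_itv /= => /andP[h0 h1]; apply: dg; rewrite !ltW.
- apply: continuous_in_subspaceT => h; rewrite inE /= in_itv /= => hh.
  exact: is_derive_continuous (dg h hh).
- move=> h; rewrite in_itv /= => /andP[/ltW h0 /ltW h1].
  rewrite /g subr0 mulr1 !scale1r scale0r !addr0 => E.
  have hh : 0 <= h <= 1 by rewrite h0 h1.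
  have [||k kk E'] := @MVT_line R V U ('D_v f) (x + h *: v) w.
  + exact: Ck_D.
  + by move=> k kk; exact: Uvw.
  + exists h, k; split=> //.
    by rewrite (addrAC x v w) E -E' (addrAC x w).
Qed.

(** The second difference over a parallelogram is symmetric in v and w. Read in the two orders, it
    is a value near x of each of the mixed derivatives, and both are continuous. *)
Lemma Schwarz (U : set V) f x v w : open U -> Ck U 2 f -> U x ->
  'D_w ('D_v f) x = 'D_v ('D_w f) x.
Proof.
move=> oU Cf Ux.
have [F FE] : {F : V -> R | F = 'D_w ('D_v f)} := exist _ _ erefl.
have [G GE] : {G : V -> R | G = 'D_v ('D_w f)} := exist _ _ erefl.
have cF : {for x, continuous F}.
  by rewrite FE; apply: Ck_cont (Ck_D w (Ck_D v Cf)) Ux.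
have cG : {for x, continuous G}.
  by rewrite GE; apply: Ck_cont (Ck_D v (Ck_D w Cf)) Ux.
suff : F x = G x by rewrite FE GE.
apply/eqP; rewrite -subr_eq0 -normr_le0; apply/ler_addgt0Pl => e e0.
rewrite addr0.
have e2 : 0 < e / 2 by rewrite divr_gt0.
have nF : \forall z \near x, U z /\ `|F x - F z| < e / 2 /\ `|G x - G z| < e / 2.
  have n1 : nbhs x U by exact: open_nbhs_nbhs.
  have /cvgrPdist_lt /(_ _ e2) n2 := cF.
  have /cvgrPdist_lt /(_ _ e2) n3 := cG.
  by apply: filterS3 n1 n2 n3 => z.
have /nbhs_ballP[r /= r0 rP] := nF.
(* The parallelogram with sides s v and s w lies in the ball; the summand 1 keeps the denominator
   positive. *)
pose s := r / 2 / (`|v| + `|w| + 1).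
have d0 : 0 < `|v| + `|w| + 1 by rewrite ltr_wpDl // addr_ge0.
have s0 : 0 < s by rewrite /s !divr_gt0.
have sE : s * (`|v| + `|w| + 1) = r / 2 by rewrite /s divfK ?gt_eqF.
clearbody s.
have inb (h k : R) : 0 <= h <= 1 -> 0 <= k <= 1 ->
    ball x r (x + h *: (s *: v) + k *: (s *: w)).
  move=> /andP[h0 h1] /andP[k0 k1].
  rewrite -ball_normE /ball_ /= -addrA opprD addNKr normrN.
  apply: le_lt_trans (ler_normD _ _) _; rewrite !normrZ.
  rewrite !(ger0_norm h0, ger0_norm k0, gtr0_norm s0).
  apply: (@le_lt_trans _ _ (s * (`|v| + `|w| + 1))).
    rewrite !mulrDr mulr1 -[leLHS]addr0; apply: lerD; last exact: ltW.
    by apply: lerD; rewrite ler_piMl // mulr_ge0 // ltW.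
  by rewrite sE ltr_pdivrMr // ltr_pMr // ltr1n.
have inb' (h k : R) : 0 <= h <= 1 -> 0 <= k <= 1 ->
    ball x r (x + h *: (s *: w) + k *: (s *: v)).
  by move=> hh kk; rewrite addrAC; exact: inb.
have [h [k [hh kk E]]] := second_difference oU Cf
  (fun h k hh kk => (rP _ (inb h k hh kk)).1).
have [h' [k' [hh' kk' E']]] := second_difference oU Cf
  (fun h k hh kk => (rP _ (inb' h k hh kk)).1).
have [Uz [Fz _]] := rP _ (inb h k hh kk).
have [Uz' [_ Gz']] := rP _ (inb' h' k' hh' kk').
rewrite (derive_scale2 _ _ _ oU Cf Uz) in E.
rewrite (derive_scale2 _ _ _ oU Cf Uz') in E'.
have FG : F (x + h *: (s *: v) + k *: (s *: w))
        = G (x + h' *: (s *: w) + k' *: (s *: v)).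
  apply: (@mulfI _ (s ^+ 2)); first by rewrite expf_neq0 // gt_eqF.
  have swap (p q o t : R) : p - q - (o - t) = p - o - (q - t) by ring.
  have FEz z : 'D_w ('D_v f) z = F z by rewrite FE.
  have GEz z : 'D_v ('D_w f) z = G z by rewrite GE.
  by rewrite FEz in E; rewrite GEz in E'; rewrite -E -E' (addrAC x (s *: v)) swap.
have -> : F x - G x = (F x - F (x + h *: (s *: v) + k *: (s *: w)))
   - (G x - G (x + h' *: (s *: w) + k' *: (s *: v))).
  by rewrite FG; ring.
apply: le_trans (ler_normB _ _) _; rewrite (splitr e).
by apply: lerD; exact: ltW.
Qed.

End Schwarz.

(** * Ordinary differential equations *)

Section Picard.
Variable R : realType.

Definition loclip (V W : normedModType R) (f : V -> W) (x0 : V) : Prop :=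
  exists K r : R, [/\ 0 < r, 0 <= K & forall x y, `|x - x0| < r ->
    `|y - x0| < r -> `|f x - f y| <= K * `|x - y|].

Lemma geometric_small (C e : R) : 0 < e -> exists k, C * 2^-1 ^+ k < e.
Proof.
move=> e0; have := @cvg_geometric R C 2^-1; rewrite gtr0_norm // invf_lt1 // ltr1n.
move=> /(_ isT) /cvgrPdist_lt /(_ e e0) [k _ kP].
exists k; have := kP k (leqnn k); rewrite /= sub0r normrN => H.
exact: le_lt_trans (ler_norm _) H.
Qed.

(** With d_k = 2 C 2^-k, the tail of the geometric series, u - d is nondecreasing and u + d
    nonincreasing; the limit is the supremum of the former. *)
Lemma geometric_limit (u : nat -> R) (C : R) :
  (forall k, `|u k.+1 - u k| <= C * 2^-1 ^+ k) ->
  exists l, forall k, `|l - u k| <= 2 * C * 2^-1 ^+ k.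
Proof.
move=> H; pose d k : R := 2 * C * 2^-1 ^+ k.
have dS k : d k.+1 = d k - C * 2^-1 ^+ k by rewrite /d exprS; field.
have d0 k : 0 <= d k.
  rewrite /d -mulrA mulr_ge0 //; exact: le_trans (H k).
have aS k : u k - d k <= u k.+1 - d k.+1.
  by have := H k; rewrite ler_norml dS => /andP[]; lra.
have bS k : u k.+1 + d k.+1 <= u k + d k.
  by have := H k; rewrite ler_norml dS => /andP[]; lra.
have aM k j : u k - d k <= u (k + j)%N - d (k + j)%N.
  elim: j => [|j IH]; first by rewrite addn0.
  by rewrite addnS; exact: le_trans IH (aS _).
have bM k j : u (k + j)%N + d (k + j)%N <= u k + d k.
  elim: j => [|j IH]; first by rewrite addn0.
  by rewrite addnS; exact: le_trans (bS _) IH.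
have ab j k : u j - d j <= u k + d k.
  apply: (@le_trans _ _ (u (j + k)%N + d (j + k)%N)).
    by apply: le_trans (aM j k) _; rewrite lerD2l ge0_cp.
  by rewrite addnC; exact: bM.
pose A := [set u k - d k | k in [set: nat]].
have Aub k : ubound A (u k + d k) by move=> _ [j _ <-]; exact: ab.
exists (sup A) => k; rewrite -/(d k) ler_norml.
have h1 : u k - d k <= sup A.
  by apply: sup_upper_bound; [split; [exists (u 0%N - d 0%N), 0%N|exists (u 0%N + d 0%N)]|exists k].
have h2 : sup A <= u k + d k.
  by apply: ge_sup => //; exists (u 0%N - d 0%N), 0%N.
by apply/andP; split; lra.
Qed.

(** The base point -2 is some point to the left of [-1, 1], the range of times used in
    [Picard_global]. *)
Lemma exists_primitive (h : R -> R) : continuous h ->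
  exists H : R -> R, forall t : R, -2 < t -> is_derive t 1 H (h t).
Proof.
move=> ch; exists (fun y => (\int[lebesgue_measure]_(t in `[-2, y]) h t)%R).
move=> t t2; have [] := @continuous_FTC1_closed R h (-2) t (t + 1) _ _ t2 (ch t).
- by rewrite ltrDl.
- apply: continuous_compact_integrable; first exact: segment_compact.
  exact: continuous_subspaceT.
- by move=> d; rewrite derive1E => e; split.
Qed.

Lemma exists_primitive_mx p q (h : R -> 'M[R]_(p, q)) : continuous h ->
  exists H : R -> 'M[R]_(p, q), forall t : R, -2 < t -> is_derive t 1 H (h t).
Proof.
move=> ch.
have P (ij : 'I_p * 'I_q) : exists H : R -> R, forall t : R, -2 < t ->
    is_derive t 1 H (h t ij.1 ij.2).
  apply: exists_primitive => t.
  by have := ch t; rewrite /continuous_at => /cvg_mx; apply.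
have /choice[H HP] := P.
exists (fun t => \matrix_(i, j) H (i, j) t) => t t2; apply/isd_mx => i j.
have E : (fun z => (\matrix_(i, j) H (i, j) z) i j) = H (i, j).
  by apply/funext => z; rewrite mxE.
by rewrite E; exact: (HP (i, j) t t2).
Qed.

Lemma isd_bound (D d : R -> R) (e delta : R) :
  (forall s : R, `|s| <= e -> is_derive s 1 D (d s)) ->
  (forall s, `|s| <= e -> `|d s| <= delta) ->
  forall t : R, `|t| <= e -> `|D t - D 0| <= delta * `|t|.
Proof.
move=> dD dd t te.
have K (h : R) : 0 <= h <= 1 -> `|h * t| <= e.
  move=> /andP[h0 h1]; rewrite normrM (ger0_norm h0).
  by apply: le_trans te; rewrite ler_piMl.
have dg (h : R) : 0 <= h <= 1 ->
    is_derive h 1 (fun h => D (h * t)) (d (h * t) * t).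
  move=> hh; have A := isd_mulr t (is_derive_id h (1 : R)).
  by apply: is_derive_eq (isd_comp1 A (dD _ (K h hh))) _; rewrite mul1r.
have [] := @MVT R (fun h => D (h * t)) (fun h => d (h * t) * t) 0 1 ltr01.
- by move=> h; rewrite in_itv /= => /andP[h0 h1]; apply: dg; rewrite !ltW.
- apply: continuous_in_subspaceT => h; rewrite inE /= in_itv /= => hh.
  exact: is_derive_continuous (dg h hh).
- move=> h; rewrite in_itv /= mul1r mul0r subr0 mulr1 => /andP[/ltW h0 /ltW h1] ->.
  by rewrite normrM ler_wpM2r // dd // K // h0 h1.
Qed.

Lemma isd_bound_mx p q (D d : R -> 'M[R]_(p, q)) (e delta : R) : 0 <= delta ->
  (forall s : R, `|s| <= e -> is_derive s 1 D (d s)) ->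
  (forall s, `|s| <= e -> `|d s| <= delta) ->
  forall t : R, `|t| <= e -> `|D t - D 0| <= delta * `|t|.
Proof.
move=> d0 dD dd t te; apply: mx_norm_le; first by rewrite mulr_ge0.
move=> i j; rewrite !mxE.
apply: (@isd_bound (fun t => D t i j) (fun t => d t i j) e) => //.
  by move=> s se; have /isd_mx := dD s se; exact.
by move=> s se; exact: le_trans (mx_coord_le _ i j) (dd s se).
Qed.

(** For r >= 0, the projection of the line onto [a - r, a + r]. Composing with it turns local
    hypotheses into global ones without any change near a. *)
Definition clamp (a r x : R) : R := Num.max (a - r) (Num.min (a + r) x).

Lemma max_lip (a x y : R) : `|Num.max a x - Num.max a y| <= `|x - y|.
Proof.
have h1 := ler_norm (x - y); have h2 := ler_norm (y - x); rewrite distrC in h2.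
by rewrite !maxEle; case: (lerP a x) => ?; case: (lerP a y) => ?; rewrite ler_norml; lra.
Qed.

Lemma min_lip (a x y : R) : `|Num.min a x - Num.min a y| <= `|x - y|.
Proof.
have h1 := ler_norm (x - y); have h2 := ler_norm (y - x); rewrite distrC in h2.
by rewrite !minEle; case: (lerP a x) => ?; case: (lerP a y) => ?; rewrite ler_norml; lra.
Qed.

Lemma clamp_lip a r x y : `|clamp a r x - clamp a r y| <= `|x - y|.
Proof. exact: le_trans (max_lip _ _ _) (min_lip _ _ _). Qed.

Lemma clamp_in a r x : 0 <= r -> `|clamp a r x - a| <= r.
Proof.
move=> r0; rewrite /clamp minEle maxEle.
case: (lerP (a + r) x) => ?; [case: (lerP (a - r) (a + r))|case: (lerP (a - r) x)];
  by move=> ?; rewrite ler_norml; lra.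
Qed.

Lemma clamp_id a r x : `|x - a| <= r -> clamp a r x = x.
Proof.
rewrite ler_norml => /andP[h1 h2]; rewrite /clamp.
by rewrite (min_idPr _) 1?(max_idPr _) //; lra.
Qed.

Lemma lip_continuous (V W : normedModType R) (f : V -> W) (K : R) :
  (forall x y, `|f x - f y| <= K * `|x - y|) -> continuous f.
Proof.
move=> H x; apply/cvgrPdist_lt => e e0.
have K0 : 0 < `|K| + 1 by rewrite ltr_wpDl.
have n1 : \forall y \near x, `|x - y| < e / (`|K| + 1).
  by have /cvgrPdist_lt := @cvg_id _ (nbhs x); apply; rewrite divr_gt0.
near=> y; apply: le_lt_trans (H x y) _.
have n2 : `|x - y| < e / (`|K| + 1) by near: y.
apply: (@le_lt_trans _ _ ((`|K| + 1) * `|x - y|)).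
  by rewrite ler_wpM2r // ler_wpDr // ler_norm.
by rewrite mulrC -ltr_pdivlMr.
Unshelve. all: by end_near. Qed.

(** Picard iteration. Each iterate is a primitive of g along the previous iterate composed with
    [tau], the projection of time onto [-e, e]; this keeps the integrands continuous on the whole
    line. *)
Lemma Picard_global p q (g : 'M[R]_(p, q) -> 'M[R]_(p, q)) (K : R) x0 :
  0 < K -> (forall x y, `|g x - g y| <= K * `|x - y|) ->
  exists (e : R) (x : R -> 'M[R]_(p, q)), [/\ 0 < e, x 0 = x0 &
    forall t : R, `|t| < e -> is_derive t 1 x (g (x t))].
Proof.
(* K e <= 1/2 makes every step halve distances on [-e, e], and e <= 1 keeps this interval to the
   right of -2. *)
move=> K0 gK; pose e : R := Num.min 1 (2 * K)^-1.
have e0 : 0 < e by rewrite lt_min ltr01 invr_gt0 mulr_gt0.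
have e1 : e <= 1 by rewrite ge_min lexx.
have eK : K * e <= 2^-1.
  have : e <= (2 * K)^-1 by rewrite ge_min lexx orbT.
  move/(ler_wpM2l (ltW K0)) => /le_trans; apply.
  by rewrite invfM mulrCA divff ?gt_eqF // mulr1.
clearbody e.
have cg : continuous g := lip_continuous gK.
pose tau : R -> R := clamp 0 e.
have ctau : continuous tau.
  by apply: (@lip_continuous _ _ _ 1) => x y; rewrite mul1r; exact: clamp_lip.
have tauE t : `|t| <= e -> tau t = t by move=> te; rewrite /tau clamp_id ?subr0.
have tauin t : `|tau t| <= e.
  by have := @clamp_in 0 e t (ltW e0); rewrite subr0.
have in2 (s : R) : `|s| <= e -> -2 < s.
  by rewrite ler_norml => /andP[h _]; apply: lt_le_trans h; lra.
pose adm (u : R -> 'M[R]_(p, q)) := forall t : R, -2 < t -> {for t, continuous u}.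
have cadm u : adm u -> continuous (fun t => u (tau t)).
  move=> au t; apply: (@continuous_comp _ _ _ tau u); first exact: ctau.
  by apply: au; apply: in2.
have stepex u : adm u -> exists v, [/\ adm v, v 0 = x0 &
    forall t : R, -2 < t -> is_derive t 1 v (g (u (tau t)))].
  move=> au.
  have ch : continuous (fun t => g (u (tau t))).
    move=> t; apply: (@continuous_comp _ _ _ (fun t => u (tau t)) g).
      exact: cadm.
    exact: cg.
  have [H HP] := exists_primitive_mx ch.
  pose v t := x0 + (H t - H 0).
  have dv (t : R) : -2 < t -> is_derive t 1 v (g (u (tau t))).
    move=> t2; have D1 := HP t t2.
    have D2 := @is_deriveB _ _ _ _ _ _ _ _ _ D1 (is_derive_cst (H 0) t (1 : R)).
    have D3 := @is_deriveD _ _ _ _ _ _ _ _ _ (is_derive_cst x0 t (1 : R)) D2.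
    by apply: is_derive_eq D3 _; rewrite add0r subr0.
  exists v; split=> //; last by rewrite /v subrr addr0.
  by move=> t t2; exact: is_derive_continuous (dv t t2).
pose st := {u | adm u}.
have ax : adm (fun _ => x0) by move=> t _; exact: cvg_cst.
pose nxt (u : st) : st := let w := cid (stepex (projT1 u) (projT2 u)) in
  exist _ (projT1 w) (let: And3 h _ _ := projT2 w in h).
pose U k := projT1 (iter k nxt (exist _ (fun _ => x0) ax)).
have aU k : adm (U k) := projT2 (iter k nxt (exist _ (fun _ => x0) ax)).
have US0 k : U k.+1 0 = x0.
  rewrite /U iterS /nxt /=.
  by case: (cid _) => w [? ? ?].
have dU k (t : R) : -2 < t -> is_derive t 1 (U k.+1) (g (U k (tau t))).
  rewrite /U iterS /nxt /=.
  by case: (cid _) => w [? ? /= H]; exact: H.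
have U00 (t : R) : U 0%N t = x0 by [].
clearbody U.
have U0 k : U k.+1 0 = x0 := US0 k.
have contr (v1 v2 u1 u2 : R -> 'M[R]_(p, q)) (del : R) : 0 <= del ->
    v1 0 = x0 -> v2 0 = x0 ->
    (forall t : R, -2 < t -> is_derive t 1 v1 (g (u1 (tau t)))) ->
    (forall t : R, -2 < t -> is_derive t 1 v2 (g (u2 (tau t)))) ->
    (forall t : R, `|t| <= e -> `|u1 t - u2 t| <= del) ->
    forall t : R, `|t| <= e -> `|v1 t - v2 t| <= del * 2^-1.
  move=> del0 v10 v20 d1 d2 udel t te.
  have := @isd_bound_mx _ _ (fun t => v1 t - v2 t)
    (fun t => g (u1 (tau t)) - g (u2 (tau t))) e (K * del).
  move=> /(_ _ _ _ t te); rewrite v10 v20 subrr subr0 => H.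
  apply: le_trans (H _ _ _) _.
  - by rewrite mulr_ge0 // ltW.
  - by move=> s /in2 s2; apply: is_deriveB; [exact: d1|exact: d2].
  - move=> s se; apply: le_trans (gK _ _) _; rewrite ler_pM2l //.
    exact: udel.
  - rewrite mulrAC [leRHS]mulrC ler_wpM2r //; apply: le_trans eK.
    by rewrite ler_pM2l.
pose C := `|g x0|.
have C0 : 0 <= C := normr_ge0 _.
have UC k (t : R) : `|t| <= e -> `|U k.+1 t - U k t| <= C * 2^-1 ^+ k.
  elim: k t => [|k IH] t te; last first.
    rewrite exprSr mulrA.
    by apply: (contr _ _ (U k.+1) (U k)) => //; apply: mulr_ge0.
  rewrite expr0 mulr1 U00 -(U0 0%N).
  apply: le_trans (@isd_bound_mx _ _ (U 1%N) (fun t => g (U 0%N (tau t))) e C _ _ _ t te) _ => //.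
  - by move=> s /in2; exact: dU.
  - by move=> s _; rewrite U00.
  - by rewrite ler_piMr // (le_trans te).
have lim (t : R) : exists l : 'M[R]_(p, q), `|t| <= e ->
    forall k, `|l - U k t| <= 2 * C * 2^-1 ^+ k.
  have [te|] := leP `|t| e; last by exists 0.
  have ex (ij : 'I_p * 'I_q) : exists l,
      forall k, `|l - U k t ij.1 ij.2| <= 2 * C * 2^-1 ^+ k.
    apply: geometric_limit => k; apply: le_trans (UC k t te).
    by have := mx_coord_le (U k.+1 t - U k t) ij.1 ij.2; rewrite !mxE.
  have /choice[l lP] := ex.
  exists (\matrix_(i, j) l (i, j)) => _ k; apply: mx_norm_le.
    by rewrite !mulr_ge0.
  by move=> i j; rewrite !mxE; exact: (lP (i, j) k).
have /choice[u uP] := lim.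
pose u' t := u (tau t).
have cu' : continuous u'.
  move=> t; apply/cvgrPdist_lt => d d0.
  have [|k kP] := @geometric_small (2 * C) (d / 3); first by rewrite divr_gt0.
  have d3 : 0 < d / 3 by rewrite divr_gt0.
  have /cvgrPdist_lt /(_ (d / 3) d3) := cadm _ (aU k) t.
  apply: filterS => s Hs; rewrite /u'.
  have h1 := uP _ (tauin t) k; have h2 := uP _ (tauin s) k.
  have -> : u (tau t) - u (tau s) = (u (tau t) - U k (tau t))
      + (U k (tau t) - U k (tau s)) - (u (tau s) - U k (tau s)).
    by rewrite subrKA opprB subrKA.
  apply: le_lt_trans (ler_normB _ _) _.
  have h3 := ler_normD (u (tau t) - U k (tau t)) (U k (tau t) - U k (tau s)).
  lra.
have au' : adm u' by move=> t _; exact: cu'.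
(* The limit u is only known pointwise. One more step gives a differentiable v, and the contraction
   estimate against the iterates shows that v = u on [-e, e]. *)
have [v [av v0 dv]] := stepex u' au'.
have uv (t : R) : `|t| <= e -> v t = u t.
  move=> te; apply/eqP; rewrite -subr_eq0 -normr_le0.
  apply/ler_addgt0Pl => d d0; rewrite addr0.
  have [|k kP] := @geometric_small (2 * C) (d / 2); first by rewrite divr_gt0.
  have g0 : 0 <= 2 * C * 2^-1 ^+ k by rewrite !mulr_ge0.
  have h1 : `|v t - U k.+1 t| <= 2 * C * 2^-1 ^+ k * 2^-1.
    apply: (contr v (U k.+1) u' (U k)) => //.
    by move=> s se; rewrite /u' tauE //; exact: uP.
  have h2 := uP t te k.+1; rewrite exprSr mulrA in h2.
  have -> : v t - u t = (v t - U k.+1 t) - (u t - U k.+1 t).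
    by rewrite opprB subrKA.
  apply: le_trans (ler_normB _ _) _.
  lra.
exists e, v; split=> // t te.
have te' := ltW te.
have := dv t (in2 _ te'); rewrite /u' !tauE //.
by rewrite -uv.
Qed.

(** Precomposed with the projection onto the cube of radius r/2 about x0, the field becomes globally
    Lipschitz; for small times the solution stays in that cube, where nothing was changed. *)
Theorem Picard p q (f : 'M[R]_(p, q) -> 'M[R]_(p, q)) x0 : loclip f x0 ->
  exists (e : R) (x : R -> 'M[R]_(p, q)), [/\ 0 < e, x 0 = x0 &
    forall t : R, `|t| < e -> is_derive t 1 x (f (x t))].
Proof.
move=> [K [r [r0 K0 fK]]].
pose c (x : 'M[R]_(p, q)) : 'M[R]_(p, q) := \matrix_(i, j) clamp (x0 i j) (r / 2) (x i j).
have r20 : 0 <= r / 2 by rewrite divr_ge0 // ltW.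
have cin x : `|c x - x0| < r.
  apply: (@le_lt_trans _ _ (r / 2)); last by rewrite ltr_pdivrMr // ltr_pMr // ltr1n.
  by apply: mx_norm_le => // i j; rewrite !mxE; exact: clamp_in.
have clip x y : `|c x - c y| <= `|x - y|.
  apply: mx_norm_le => // i j; rewrite !mxE; apply: le_trans (clamp_lip _ _ _ _) _.
  by have := mx_coord_le (x - y) i j; rewrite !mxE.
have gK x y : `|f (c x) - f (c y)| <= (K + 1) * `|x - y|.
  apply: le_trans (fK _ _ (cin x) (cin y)) _.
  apply: ler_pM => //; lra.
have K1 : 0 < K + 1 by lra.
have [e [x [e0 x00 dx]]] := Picard_global x0 K1 gK.
have cx : {for 0, continuous x}.
  by apply: (@is_derive_continuous _ _ _ _ (f (c (x 0)))); apply: dx; rewrite normr0.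
have /cvgrPdist_lt /(_ (r / 2)) := cx; rewrite x00 divr_gt0 // => /(_ isT).
move=> /nbhs_ballP[d /= d0 dP].
exists (Num.min e d), x; split=> //; first by rewrite lt_min e0.
move=> t; rewrite lt_min => /andP[te td].
have : `|x0 - x t| < r / 2.
  by apply: dP; rewrite -ball_normE /ball_ /= sub0r normrN.
rewrite distrC => xt.
have E : c (x t) = x t.
  apply/matrixP => i j; rewrite mxE; apply: clamp_id.
  apply: le_trans (ltW xt).
  by have := mx_coord_le (x t - x0) i j; rewrite !mxE.
by have := dx t te; rewrite E.
Qed.

End Picard.

Section ODE.
Variable R : realType.

Lemma C1_loclip_scalar n (U : set 'rV[R]_n) (f : 'rV[R]_n -> R) x0 :
  open U -> U x0 -> Ck U 1 f -> loclip f x0.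
Proof.
move=> oU Ux0 Cf.
pose M := \sum_(i < n) (`|partial i f x0| + 1).
have M0 : 0 <= M by apply: sumr_ge0 => i _; rewrite addr_ge0.
have near_i (i : 'I_n) : \forall z \near x0, `|partial i f z| <= `|partial i f x0| + 1.
  have /cvgrPdist_lt /(_ 1 ltr01) := Ck_cont (Ck_D (basis_vec R i) Cf) Ux0.
  apply: filterS => z; rewrite -/(partial i f z) -/(partial i f x0) => H.
  rewrite -lerBlDl; apply: le_trans (lerB_dist _ _) _.
  by rewrite distrC ltW.
have nU : \forall z \near x0, U z /\
    forall i : 'I_n, `|partial i f z| <= `|partial i f x0| + 1.
  have n1 : nbhs x0 U by exact: open_nbhs_nbhs.
  have n2 : \forall z \near x0, forall i : 'I_n,
      `|partial i f z| <= `|partial i f x0| + 1 by exact: (@filter_forall _ 'I_n (fun i z => `|partial i f z| <= `|partial i f x0| + 1) (nbhs x0) _ near_i).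
  by apply: filterS2 n1 n2 => z.
have /nbhs_ballP[r /= r0 rP] := nU.
(* Two points within r/4 of x0 are less than r/2 apart, and the ball of radius r/2 about either of
   them stays in the ball of radius r about x0. *)
exists M, (r / 4); split=> //; first by rewrite divr_gt0.
move=> x y; rewrite ![`|_ - x0|]distrC => hx hy.
have r2 : 0 < r / 2 by rewrite divr_gt0.
have rE : r / 4 = r / 2 / 2 by field.
have sub : ball y (r / 2) `<=` ball x0 r.
  move=> z; rewrite -!ball_normE /ball_ /= => hz.
  rewrite -(subrKA y); apply: le_lt_trans (ler_normD _ _) _.
  rewrite [ltRHS]splitr; apply: ltrD => //; apply: lt_trans hy _.
  by rewrite rE ltr_pdivrMr // ltr_pMr // ltr1n.
have xy : `|x - y| < r / 2.
  rewrite -(subrKA x0); apply: le_lt_trans (ler_normD _ _) _.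
  by rewrite [ltRHS]splitr -rE distrC; apply: ltrD.
have Cfy : Ck (ball y (r / 2)) 1 f.
  by apply: Ck_sub Cf => z /sub/rP [].
have [xi [xiP]] := MVT_row r2 Cfy xy.
rewrite [y + _]addrC subrK => ->.
apply: le_trans (ler_norm_sum _ _ _) _; rewrite mulr_suml; apply: ler_sum => i _.
rewrite normrM mulrC; apply: ler_pM => //; last exact: mx_coord_le.
apply: (rP _ _).2; apply: sub; rewrite -ball_normE /ball_ /= distrC.
exact: le_lt_trans (xiP i) xy.
Qed.

Lemma C1_loclip n p q (U : set 'rV[R]_n) (f : 'rV[R]_n -> 'M[R]_(p, q)) x0 :
  open U -> U x0 -> Ck U 1 f -> loclip f x0.
Proof.
move=> oU Ux0 /(Ck_mx _ _ oU) Cf.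
have H (ij : 'I_p * 'I_q) : exists Kr : R * R, [/\ 0 < Kr.2, 0 <= Kr.1 &
   forall x y, `|x - x0| < Kr.2 ->
    `|y - x0| < Kr.2 -> `|f x ij.1 ij.2 - f y ij.1 ij.2| <= Kr.1 * `|x - y|].
  have [K [r H]] := C1_loclip_scalar oU Ux0 (Cf ij.1 ij.2).
  by exists (K, r).
have /choice[Kr KrP] := H.
exists (\sum_ij (Kr ij).1), (\big[Num.min/1]_ij (Kr ij).2); split.
- by apply: lt_bigmin => // ij _; have [] := KrP ij.
- by apply: sumr_ge0 => ij _; have [] := KrP ij.
- move=> x y hx hy; apply: mx_norm_le.
    by rewrite mulr_ge0 // sumr_ge0 // => ij _; have [] := KrP ij.
  move=> i j; rewrite !mxE; have [_ K0 K] := KrP (i, j).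
  have le_r : \big[Num.min/1]_ij (Kr ij).2 <= (Kr (i, j)).2.
    exact: bigmin_le_cond (fun ij => (Kr ij).2) _.
  apply: le_trans (K x y _ _) _.
  + exact: lt_le_trans hx le_r.
  + exact: lt_le_trans hy le_r.
  + rewrite ler_wpM2r // (bigD1 (i, j)) //= lerDl sumr_ge0 // => ij _.
    by have [] := KrP ij.
Qed.

(** Regularity bootstraps: if x is of class C^k, so is f (x t), which is its derivative. *)
Theorem ODE_solution n (U : set 'rV[R]_n) (f : 'rV[R]_n -> 'rV[R]_n) x0 :
  open U -> U x0 -> smooth U f ->
  exists (e : R) (x : R -> 'rV[R]_n), [/\ 0 < e, x 0 = x0,
    forall t : R, ball 0 e t -> U (x t),
    forall t : R, ball 0 e t -> is_derive t 1 x (f (x t)) &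
    smooth (ball (0 : R) e) x].
Proof.
move=> oU Ux0 Cf; have [d [x [d0 x00 dx]]] := Picard (C1_loclip oU Ux0 (Cf 1%N)).
have cx : {for 0, continuous x}.
  by apply: (@is_derive_continuous _ _ _ _ (f (x 0))); apply: dx; rewrite normr0.
have nU : \forall t \near (0 : R), U (x t).
  by apply: cx; rewrite x00; exact: open_nbhs_nbhs.
have /nbhs_ballP[r /= r0 rP] := nU.
pose e := Num.min d r.
have e0 : 0 < e by rewrite lt_min d0.
have inU (t : R) : ball 0 e t -> U (x t).
  rewrite -ball_normE /ball_ /= sub0r normrN lt_min => /andP[_ tr].
  by apply: rP; rewrite -ball_normE /ball_ /= sub0r normrN.
have der (t : R) : ball 0 e t -> is_derive t 1 x (f (x t)).
  by rewrite -ball_normE /ball_ /= sub0r normrN lt_min => /andP[td _]; exact: dx.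
exists e, x; split=> //.
have oB : open (ball (0 : R) e) by exact: ball_open.
have cB (t : R) : ball 0 e t -> {for t, continuous x}.
  by move=> /der; exact: is_derive_continuous.
elim=> [|k IH]; first by split.
apply: (@Ck_step R R _ _ _ _ (fun (v : R) t => v *: f (x t))) => //.
- move=> v t /der /isd_mx H; apply/isd_mx => i j; rewrite mxE.
  by have := isd_scale v (H i j); rewrite [v *: 1]mulr1.
- move=> v; apply/(Ck_mx _ _ oB) => i j.
  have C : Ck (ball 0 e) k (fun t => f (x t) i j).
    have /(Ck_mx _ _ oU) /(_ i j) Cfij := Cf k.
    exact: (Ck_comp oB oU inU Cfij IH).
  by apply: (Ck_eq oB _ (Ck_mull v oB C)) => t _; rewrite mxE.
Qed.

End ODE.

(** * Symmetric forms and polarization *)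

Section Forms.
Variables (S : comNzRingType) (n : nat).
Implicit Types (c : seq 'I_n -> S) (y : 'I_n -> S) (k l : nat).

(** The form of degree k with coefficients c, by recursion on the degree so that proofs treat one
    index at a time. The ring is general because y is also taken with polynomial entries, to
    restrict forms to lines. *)
Fixpoint pform k c y : S :=
  if k is k'.+1 then \sum_(i < n) y i * pform k' (fun I => c (i :: I)) y
  else c [::].

Definition symk k c : Prop :=
  forall I J, size I = k -> perm_eq I J -> c I = c J.

Lemma symk_cons k c i : symk k.+1 c -> symk k (fun I => c (i :: I)).
Proof. by move=> H I J sI IJ; apply: H; rewrite /= ?sI // perm_cons. Qed.

Lemma eq_pform k c c' y y' : (forall I, size I = k -> c I = c' I) -> y =1 y' ->
  pform k c y = pform k c' y'.
Proof.
elim: k c c' => [|k IH] c c' cc yy /=; first exact: cc.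
apply: eq_bigr => i _; rewrite yy; congr (_ * _); apply: IH => // I sI.
by apply: cc; rewrite /= sI.
Qed.

Lemma pform_swap k c i j y : symk k.+2 c ->
  pform k (fun I => c [:: i, j & I]) y = pform k (fun I => c [:: j, i & I]) y.
Proof.
move=> H; apply: eq_pform => // I sI; apply: H; first by rewrite /= sI.
by rewrite -[[:: i, j & I]]/([:: i; j] ++ I) -[[:: j, i & I]]/([:: j; i] ++ I)
  perm_cat2r (perm_catC [:: i] [:: j]).
Qed.

Lemma pform_sum k (T : Type) (r : seq T) (w : T -> S) (c : T -> seq 'I_n -> S) y :
  pform k (fun I => \sum_(j <- r) w j * c j I) y
  = \sum_(j <- r) w j * pform k (c j) y.
Proof.
elim: k c => [|k IH] c //=.
under eq_bigr do rewrite IH mulr_sumr.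
rewrite exchange_big; apply: eq_bigr => j _; rewrite mulr_sumr.
by apply: eq_bigr => i _; rewrite mulrCA.
Qed.

Lemma pformD k c c' y :
  pform k (fun I => c I + c' I) y = pform k c y + pform k c' y.
Proof.
elim: k c c' => [|k IH] c c' //=.
by rewrite -big_split; apply: eq_bigr => i _; rewrite IH mulrDr.
Qed.

Lemma pformZ k c y a : pform k (fun I => a * c I) y = a * pform k c y.
Proof.
elim: k c => [|k IH] c //=.
by rewrite mulr_sumr; apply: eq_bigr => i _; rewrite IH mulrCA.
Qed.

Lemma pformN k c y : pform k (fun I => - c I) y = - pform k c y.
Proof.
rewrite -mulN1r -pformZ; apply: eq_pform => // I _; by rewrite mulN1r.
Qed.

Lemma pform_homog k c y (a : S) :
  pform k c (fun i => a * y i) = a ^+ k * pform k c y.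
Proof.
elim: k c => [|k IH] c /=; first by rewrite mul1r.
rewrite mulr_sumr; apply: eq_bigr => i _; rewrite IH exprS; ring.
Qed.

Lemma pform_cat k l c y :
  pform (k + l) c y = pform k (fun I => pform l (fun J => c (I ++ J)) y) y.
Proof.
elim: k c => [|k IH] c //=.
by apply: eq_bigr => i _; rewrite IH.
Qed.

Lemma pform_tuple k c y :
  \sum_(I : k.-tuple 'I_n) c I * \prod_(i <- I) y i = pform k c y.
Proof.
elim: k c => [|k IH] c /=.
  rewrite (bigD1 [tuple]) //= big_nil mulr1 big1 ?addr0 // => I /negP[].
  by apply/eqP; rewrite tuple0.
under [RHS]eq_bigr do rewrite -IH mulr_sumr.
rewrite pair_bigA /=.
rewrite (reindex (fun p : 'I_n * k.-tuple 'I_n => [tuple of p.1 :: p.2])) /=.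
  by apply: eq_bigr => -[i I] _ /=; rewrite big_cons mulrCA.
exists (fun I : k.+1.-tuple 'I_n => (thead I, [tuple of behead I])).
  by move=> [i I] _ /=; congr pair; apply/val_inj.
by move=> I _ /=; apply/val_inj; case/tupleP: I.
Qed.

End Forms.

Lemma pform_rmorph (S S' : comNzRingType) (f : {rmorphism S -> S'}) n k
    (c : seq 'I_n -> S) y :
  f (pform k c y) = pform k (fun I => f (c I)) (fun i => f (y i)).
Proof.
elim: k c => [|k IH] c //=; rewrite rmorph_sum; apply: eq_bigr => i _.
by rewrite rmorphM IH.
Qed.

(* [Der f f'] stands for: [f'] is the derivative at [t0] of the [S]-valued
   map [f]; only additivity and the Leibniz rule matter. *)
Section PformDerivation.
Variables (T : Type) (S : comNzRingType) (n : nat) (t0 : T).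
Variable Der : (T -> S) -> S -> Prop.
Hypothesis Der0 : Der (fun _ => 0) 0.
Hypothesis DerD : forall f g f' g', Der f f' -> Der g g' ->
  Der (fun t => f t + g t) (f' + g').
Hypothesis DerM : forall f g f' g', Der f f' -> Der g g' ->
  Der (fun t => f t * g t) (f' * g t0 + f t0 * g').

Lemma Der_sum (I : Type) (r : seq I) (f : I -> T -> S) f' :
  (forall i, Der (f i) (f' i)) ->
  Der (fun t => \sum_(i <- r) f i t) (\sum_(i <- r) f' i).
Proof.
move=> H; elim: r => [|i r IH].
  rewrite big_nil (_ : (fun _ => _) = fun _ => 0) //.
  by apply/funext => z; rewrite big_nil.
rewrite big_cons (_ : (fun _ => _) =
  fun z => f i z + \sum_(j <- r) f j z); last first.
  by apply/funext => z; rewrite big_cons.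
exact: DerD.
Qed.

(** By symmetry of c t0 the k terms in which one argument is differentiated coincide. The derivation
    is abstract since three are needed: the analytic one, the formal one on polynomials, and the
    coefficientwise one on families of polynomials. *)
Lemma pform_Der k (c : T -> seq 'I_n -> S) c' (y : T -> 'I_n -> S) y' :
  (forall I, size I = k -> Der (c ^~ I) (c' I)) ->
  (forall i, Der (y ^~ i) (y' i)) -> symk k (c t0) ->
  Der (fun t => pform k (c t) (y t)) (pform k c' (y t0) +
    k%:R * \sum_(i < n) y' i * pform k.-1 (fun I => c t0 (i :: I)) (y t0)).
Proof.
move=> + Dy; elim: k c c' => [|k IH] c c' Dc sc /=.
  by rewrite mul0r addr0; exact: Dc.
pose d i := pform k (fun I => c' (i :: I)) (y t0) +
  k%:R * \sum_(j < n) y' j * pform k.-1 (fun I => c t0 [:: i, j & I]) (y t0).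
rewrite (_ : (_ + _) = \sum_(i < n)
  (y' i * pform k (fun I => c t0 (i :: I)) (y t0) + y t0 i * d i)).
  apply: Der_sum => i; apply: DerM => //.
  apply: (IH (fun t I => c t (i :: I)) (fun I => c' (i :: I))).
    by move=> I sI; apply: Dc; rewrite /= sI.
  exact: symk_cons.
rewrite big_split /=; set A := \sum_(i < n) y' i * _.
have -> : \sum_(i < n) y t0 i * d i =
    \sum_(i < n) y t0 i * pform k (fun I => c' (i :: I)) (y t0) + k%:R * A.
  rewrite -[k%:R * A]add0r /d; under eq_bigr do rewrite mulrDr.
  rewrite big_split /= add0r; congr (_ + _); rewrite {}/A.
  case: k {IH Dc d} sc => [|k] sc.
    by rewrite mul0r big1 // => i _; rewrite mul0r mulr0.
  rewrite mulr_sumr; under eq_bigr do rewrite mulrCA mulr_sumr mulr_sumr.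
  rewrite exchange_big; apply: eq_bigr => j _; rewrite /= mulr_sumr mulr_sumr.
  apply: eq_bigr => i _; rewrite (pform_swap _ _ _ sc); ring.
by rewrite -[in LHS]natr1; ring.
Qed.

End PformDerivation.

Lemma pform_isd (R : realType) (V : normedModType R) n (x v : V) k
    (c : V -> seq 'I_n -> R) c' (y : V -> 'I_n -> R) y' :
  (forall I, size I = k -> is_derive x v (c ^~ I) (c' I)) ->
  (forall i, is_derive x v (y ^~ i) (y' i)) -> symk k (c x) ->
  is_derive x v (fun t => pform k (c t) (y t)) (pform k c' (y x) +
    k%:R * \sum_(i < n) y' i * pform k.-1 (fun I => c x (i :: I)) (y x)).
Proof.
apply: (@pform_Der V R n x (fun f f' => is_derive x v f f')).
- exact: isd_cst.
- by move=> *; exact: isd_add.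
- by move=> *; exact: isd_mul.
Qed.

Lemma pform_deriv (S : comNzRingType) n k (c : seq 'I_n -> {poly S}) y :
  symk k c -> (pform k c y)^`() = pform k (fun I => (c I)^`()) y +
    k%:R * \sum_(i < n) (y i)^`() * pform k.-1 (fun I => c (i :: I)) y.
Proof.
move=> sc.
apply: (@pform_Der unit {poly S} n tt (fun f f' => (f tt)^`() = f')
  _ _ _ k (fun _ => c) (fun I => (c I)^`()) (fun _ => y) (fun i => (y i)^`())) => //.
- exact: derivC.
- by move=> f g f' g' <- <-; rewrite derivD.
- by move=> f g f' g' <- <-; rewrite derivM.
Qed.

Section CoefficientwiseDerivative.
Variable R : realType.

Definition pder (t0 : R) (f : R -> {poly R}) (f' : {poly R}) : Prop :=
  forall j, is_derive t0 1 (fun t => (f t)`_j) f'`_j.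

Lemma pform_pder n (t0 : R) k (c : R -> seq 'I_n -> {poly R}) c'
    (y : R -> 'I_n -> {poly R}) y' :
  (forall I, size I = k -> pder t0 (c ^~ I) (c' I)) ->
  (forall i, pder t0 (y ^~ i) (y' i)) -> symk k (c t0) ->
  pder t0 (fun t => pform k (c t) (y t)) (pform k c' (y t0) +
    k%:R * \sum_(i < n) y' i * pform k.-1 (fun I => c t0 (i :: I)) (y t0)).
Proof.
apply: (@pform_Der R {poly R} n t0 (pder t0)).
- by move=> j; rewrite !coef0; exact: isd_cst.
- move=> f g f' g' Hf Hg j; rewrite coefD.
  rewrite (_ : (fun _ => _) = fun t => (f t)`_j + (g t)`_j).
    by apply: isd_add; [exact: Hf|exact: Hg].
  by apply/funext => t; rewrite coefD.
- move=> f g f' g' Hf Hg j; rewrite coefD !coefM -big_split /=.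
  rewrite (_ : (fun _ => _) = fun t => \sum_(i < j.+1) (f t)`_i * (g t)`_(j - i)).
    by apply: isd_sum => i _; apply: isd_mul; [exact: Hf|exact: Hg].
  by apply/funext => t; rewrite coefM.
Qed.

End CoefficientwiseDerivative.

Section Polarization.
Variable R : realType.

(** Differentiating the vanishing form in the direction of the i-th basis vector gives, up to the
    nonzero factor k, the form of degree one less with the index i fixed. *)
Lemma polarization n k (c : seq 'I_n -> R) : symk k c ->
  (forall y, pform k c y = 0) -> forall I, size I = k -> c I = 0.
Proof.
elim: k c => [|k IH] c sc c0 [|i I] //= => [_|[sI]]; first exact: (c0 (fun _ => 0)).
apply: (IH (fun I => c (i :: I))) => //; first exact: symk_cons.
move=> y; pose Y (t : R) (j : 'I_n) := y j + t * (j == i)%:R.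
have D : is_derive (0 : R) 1 (fun t => pform k.+1 c (Y t))
    (pform k.+1 (fun _ => 0) (Y 0) + k.+1%:R *
      \sum_(j < n) (j == i)%:R * pform k (fun I => c (j :: I)) (Y 0)).
  apply: (pform_isd (c := fun _ => c)) => // [J _|j]; first exact: isd_cst.
  have H := isd_mulr (j == i)%:R (is_derive_id (0 : R) (1 : R)).
  by apply: is_derive_eq (isd_add (isd_cst (y j) (0 : R) (1 : R)) H) _; rewrite add0r mul1r.
have D0 : is_derive (0 : R) 1 (fun t => pform k.+1 c (Y t)) 0.
  rewrite (_ : (fun _ => _) = fun _ => 0); first exact: isd_cst.
  by apply/funext => t; exact: c0.
have z0 : pform k.+1 (fun _ => 0) (Y 0) = 0.
  rewrite -[RHS](mul0r (pform k.+1 (fun _ => 0) (Y 0))) -pformZ.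
  by apply: eq_pform => // J _; rewrite mulr0.
have := isd_unique D D0; rewrite z0 (bigD1 i) //= eqxx mul1r big1 ?addr0; last first.
  by move=> j /negbTE ->; rewrite mul0r.
rewrite add0r => /eqP; rewrite mulf_eq0 pnatr_eq0 /= => /eqP <-.
by apply: eq_pform => // j; rewrite /Y mul0r addr0.
Qed.

Section Symmetrize.
Variables (n m : nat).
Implicit Types (f g : seq 'I_n -> seq 'I_n -> R).

Let N := (m + m)%N.
Let sig f (K : N.-tuple 'I_n) : R :=
  \sum_(s : 'S_N) let K' := [tuple tnth K (s r) | r < N] in
    f (take m K') (drop m K').

Lemma sig_perm f (K : N.-tuple 'I_n) (p : 'S_N) :
  sig f [tuple tnth K (p r) | r < N] = sig f K.
Proof.
rewrite /sig [RHS](reindex (fun s : 'S_N => (s * p)%g)); last first.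
  exists (fun s => (s * p^-1)%g) => s _; first by rewrite mulgK.
  by rewrite mulgKV.
apply: eq_bigr => s _.
suff -> : [tuple tnth [tuple tnth K (p r) | r < N] (s r) | r < N]
  = [tuple tnth K ((s * p)%g r) | r < N] by [].
by apply: eq_from_tnth => r; rewrite !tnth_mktuple permM.
Qed.

(** The symmetrization as a function of lists, 0 on lists of the wrong length, so that [pform] and
    [polarization] apply to it. *)
Let hseq f (L : seq 'I_n) : R := oapp (sig f) 0 (insub L).

Lemma hseqE f (K : N.-tuple 'I_n) : hseq f K = sig f K.
Proof. by rewrite /hseq valK. Qed.

Lemma symk_hseq f : symk N (hseq f).
Proof.
move=> I J sI; rewrite perm_sym => IJ.
have sJ : size J = N by rewrite (perm_size IJ).
have /tuple_permP[p Jp] : perm_eq J (Tuple (introT eqP sI)) by [].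
rewrite Jp -[I]/(val (Tuple (introT eqP sI))) !hseqE.
by rewrite sig_perm.
Qed.

(** A monomial is unchanged when its indices are permuted, so symmetrization only multiplies the
    form by N!. *)
Lemma pform_hseq f y : pform N (hseq f) y =
  N`!%:R * pform m (fun I => pform m (fun J => f I J) y) y.
Proof.
rewrite -pform_tuple; under eq_bigr do rewrite hseqE.
pose g (K : N.-tuple 'I_n) := f (take m K) (drop m K) * \prod_(i <- K) y i.
transitivity (\sum_(s : 'S_N) \sum_(K : N.-tuple 'I_n) g K).
  under eq_bigr do rewrite /sig mulr_suml.
  rewrite exchange_big /=; apply: eq_bigr => s _.
  rewrite [RHS](reindex (fun K : N.-tuple 'I_n => [tuple tnth K (s r) | r < N])) /=.
    apply: eq_bigr => K _; rewrite /g /=; congr (_ * _).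
    by rewrite big_tuple [LHS](reindex_inj (@perm_inj _ s)) /= big_map big_enum.
  exists (fun K : N.-tuple 'I_n => [tuple tnth K (s^-1%g r) | r < N]) => K _;
    apply: eq_from_tnth => r; rewrite !tnth_mktuple.
    by rewrite permKV.
  by rewrite permK.
rewrite sumr_const card_Sn -[LHS]mulr_natl; congr (_ * _).
pose c (L : seq 'I_n) := f (take m L) (drop m L).
transitivity (pform N c y); first by rewrite -pform_tuple.
rewrite /N pform_cat; apply: eq_pform => // I sI; apply: eq_pform => // J sJ.
by rewrite /c -sI take_size_cat // drop_size_cat.
Qed.

Lemma symmetrize_sig f (I J : m.-tuple 'I_n) :
  symmetrize f I J = sig f [tuple of I ++ J].
Proof. by []. Qed.

(** Contraction with y leads from symmetrized coefficients to forms, since N! is invertible;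
    polarization leads back. *)
Lemma symmetrize_pform f g :
  (forall I J : m.-tuple 'I_n, symmetrize f I J = symmetrize g I J) <->
  (forall y, pform m (fun I => pform m (fun J => f I J) y) y =
             pform m (fun I => pform m (fun J => g I J) y) y).
Proof.
have NF0 : (N`!%:R : R) != 0 by rewrite pnatr_eq0 -lt0n fact_gt0.
split=> H.
  move=> y; apply: (mulfI NF0); rewrite -!pform_hseq -!pform_tuple.
  apply: eq_bigr => K _; congr (_ * _); rewrite !hseqE.
  have s1 : size (take m K) = m by rewrite size_takel // size_tuple leq_addr.
  have s2 : size (drop m K) = m by rewrite size_drop size_tuple addnK.
  have := H (Tuple (introT eqP s1)) (Tuple (introT eqP s2)).
  rewrite !symmetrize_sig.
  suff -> : [tuple of Tuple (introT eqP s1) ++ Tuple (introT eqP s2)] = K by [].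
  by apply/val_inj; rewrite /= cat_take_drop.
move=> I J; rewrite !symmetrize_sig -!hseqE.
apply/eqP; rewrite -subr_eq0; apply/eqP.
apply: (polarization (k := N) (c := fun L => hseq f L + - hseq g L)).
- by move=> I' J' sI' IJ'; rewrite (symk_hseq f sI' IJ') (symk_hseq g sI' IJ').
- by move=> y; rewrite pformD pformN !pform_hseq H subrr.
- by rewrite size_tuple.
Qed.

End Symmetrize.
End Polarization.

(** * Divisibility of polynomials and limits *)

Section Multiplicities.
Variable C : numClosedFieldType.
Implicit Types (P Q X p q x : {poly C}) (a : C) (k : nat).

Local Notation rho a := ('X - a%:P).

(** Otherwise the cofactor of gcd (P, Q) in P has a root a, although the full power of X - a in P
    divides that gcd. *)
Lemma dvdp_roots P Q : P != 0 ->
  (forall a k p, P = p * rho a ^+ k -> ~~ root p a -> rho a ^+ k %| Q) -> P %| Q.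
Proof.
move=> P0 H; have /dvdpP[h Ph] := dvdp_gcdl P Q.
have h0 : h != 0 by apply: contraNneq P0 => h0; rewrite Ph h0 mul0r.
have [sh|sh] := eqVneq (size h) 1%N.
  have [c c0 hc] := size_poly1P _ (introT eqP sh).
  rewrite Ph hc mul_polyC dvdpZl //; exact: dvdp_gcdr.
have /closed_rootP[a ha] := sh.
have [k [p p0 Pp]] := multiplicity_XsubC P a.
rewrite P0 /= in p0.
have kQ := H a k p Pp p0.
have : rho a ^+ k %| gcdp P Q by rewrite dvdp_gcd kQ Pp dvdp_mull.
case/dvdpP => d dE; have /factor_theorem[h' hE] := ha.
have ra0 : rho a ^+ k != 0 by rewrite expf_neq0 // polyXsubC_eq0.
have E : p = h' * rho a * d.
  by apply: (mulIf ra0); rewrite -Pp Ph dE hE mulrA.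
by move: p0; rewrite E !rootM root_XsubC eqxx !orbT.
Qed.

(** The extra factor X - a avoids the exponent k - 1 and so covers k = 0. *)
Lemma rho_deriv p a k :
  rho a * (p * rho a ^+ k)^`() = rho a ^+ k * (p *+ k + rho a * p^`()).
Proof.
rewrite derivM deriv_exp derivXsubC mul1r; case: k => [|k].
  by rewrite expr0 mulr0n !mulr0 mulr0n add0r addr0 mulr1 mul1r.
rewrite exprS /= mulrnAr -!mulrnAl; ring.
Qed.

Lemma rho_dvd_root p a : rho a %| p = root p a.
Proof. by rewrite dvdp_XsubCl. Qed.

(** If X had order j < k - 1 at a, with X = x (X - a)^j, the Wronskian would have order exactly j +
    k - 1 there, with leading coefficient (k - j) x(a) p(a); but its order is at least 2 (k - 1). *)
Lemma multiplicity_wronskian P X p a k : P = p * rho a ^+ k -> ~~ root p a ->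
  rho a ^+ k.-1 * rho a ^+ k.-1 %| X * P^`() - X^`() * P -> rho a ^+ k.-1 %| X.
Proof.
move=> PE pa dv; have [->|X0] := eqVneq X 0; first exact: dvdp0.
have [j [x x0 XE]] := multiplicity_XsubC X a.
rewrite X0 /= in x0.
have [kj|jk] := leqP k.-1 j.
  by rewrite XE dvdp_mull // dvdp_exp2l.
have ra0 : rho a != 0 by rewrite polyXsubC_eq0.
pose B := x * (p *+ k + rho a * p^`()) - (x *+ j + rho a * x^`()) * p.
have E : rho a * (X * P^`() - X^`() * P) = rho a ^+ (j + k) * B.
  have E1 := rho_deriv p a k; have E2 := rho_deriv x a j.
  rewrite -PE in E1; rewrite -XE in E2.
  rewrite mulrBr mulrCA E1 (mulrA _ X^`()) E2 {1}XE {1}PE /B exprD; ring.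
have : rho a ^+ (j + k).+1 %| rho a ^+ (j + k) * B.
  rewrite -E exprS dvdp_mul2l //; apply: dvdp_trans dv.
  by rewrite -exprD dvdp_exp2l //; lia.
rewrite exprSr dvdp_mul2l ?expf_neq0 // rho_dvd_root /root /B.
rewrite !(hornerE, hornerMn) subrr !mul0r !addr0.
have -> : x.[a] * (p.[a] *+ k) - x.[a] *+ j * p.[a] = x.[a] * p.[a] * (k - j)%:R.
  rewrite natrB; last lia.
  by rewrite -[p.[a] *+ k]mulr_natr -[x.[a] *+ j]mulr_natr; ring.
rewrite !mulf_eq0 pnatr_eq0 subn_eq0 => /orP[/orP[]|].
- by rewrite -/(root x a) (negbTE x0).
- by rewrite -/(root p a) (negbTE pa).
- by move=> kj; exfalso; lia.
Qed.

(** Writing Q = q (X - a)^(k - 1), the lowest order terms of the relation give (m (k - 1) - (m - 1)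
    k) p(a) q(a) = 0. The bracket is k - m, and E contributes only to higher order. *)
Lemma multiplicity_quotient (P Q E p : {poly C}) a (m k : nat) :
  P = p * rho a ^+ k -> ~~ root p a -> (k != m) ->
  rho a ^+ k.-1 %| Q -> rho a ^+ k.-1 %| E ->
  m%:R * (P * (Q^`() - 2%:R * E)) = (m%:R - 1) * (P^`() * Q) ->
  rho a ^+ k %| Q.
Proof.
case: k => [|k] PE pa km; first by rewrite expr0 dvd1p.
move=> /dvdpP[q QE] /dvdpP[e EE] H.
have ra0 : rho a != 0 by rewrite polyXsubC_eq0.
suff qa : root q a.
  by rewrite QE exprS dvdp_mul // rho_dvd_root.
have E1 := rho_deriv p a k.+1; have E2 := rho_deriv q a k.
rewrite -PE in E1; rewrite -QE in E2.
have K : m%:R * (p * (q *+ k + rho a * q^`() - 2%:R * rho a * e)) =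
    (m%:R - 1) * ((p *+ k.+1 + rho a * p^`()) * q).
  have r0 : rho a ^+ k.+1 * rho a ^+ k != 0 by rewrite mulf_neq0 ?expf_neq0.
  apply: (mulfI r0).
  transitivity (rho a * (m%:R * (P * (Q^`() - 2%:R * E)))).
    transitivity (m%:R * (P * (rho a * Q^`() - 2%:R * (rho a * E)))); last by ring.
    rewrite E2 {1}PE EE; ring.
  rewrite H.
  transitivity ((m%:R - 1) * ((rho a * P^`()) * Q)); first by ring.
  rewrite E1 {1}QE; ring.
have := congr1 (fun r => r.[a]) K.
rewrite !(hornerE, hornerMn) subrr !(mul0r, mulr0, addr0, subr0) => K'.
have : p.[a] * q.[a] * (k.+1%:R - m%:R) = 0.
  move: K'; rewrite -[q.[a] *+ k]mulr_natr -[p.[a] *+ k.+1]mulr_natr -natr1 => K'.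
  move/eqP: K'; rewrite -subr_eq0 => /eqP K'.
  by rewrite -K' /=; ring.
move/eqP; rewrite !mulf_eq0 subr_eq0 eqr_nat (negbTE km) orbF.
by rewrite -/(root p a) (negbTE pa).
Qed.

End Multiplicities.

Section RealDivisibility.
Variable R : rcfType.
Implicit Types (P Q E X : {poly R}).

Local Notation f := (real_complex R : {rmorphism R -> R[i]}).
Local Notation "p ^f" := (map_poly f p).

(** Checked at the complex roots: where P has multiplicity k > 0, gcd (P, P') has multiplicity k -
    1, and [multiplicity_wronskian] applies. *)
Lemma dvdp_gcd_wronskian P X : P != 0 ->
  gcdp P P^`() * gcdp P P^`() %| X * P^`() - X^`() * P -> gcdp P P^`() %| X.
Proof.
move=> P0 dv; rewrite -(dvdp_map f); set D := gcdp P P^`() in dv *.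
have D0 : D != 0 by rewrite gcdp_eq0 negb_and P0.
have PC0 : P^f != 0 by rewrite map_poly_eq0.
apply: dvdp_roots; first by rewrite map_poly_eq0.
move=> a j d DE da.
have [k [p p0 PE]] := multiplicity_XsubC P^f a; rewrite PC0 /= in p0.
have ra0 : ('X - a%:P) != 0 :> {poly R[i]} by rewrite polyXsubC_eq0.
have DP : D^f %| P^f by rewrite dvdp_map dvdp_gcdl.
have DP' : D^f %| (P^f)^`() by rewrite deriv_map dvdp_map dvdp_gcdr.
have jk : (j <= k.-1)%N.
  rewrite leqNgt; apply/negP => kj; move: PE p0 kj; case: k => [|k] PE p0 kj.
    move/negP: p0; apply; rewrite -rho_dvd_root.
    rewrite expr0 mulr1 in PE; rewrite -PE; apply: dvdp_trans DP.
    by rewrite DE dvdp_mull // -[X in X %| _]expr1 dvdp_exp2l.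
  have : ('X - a%:P) ^+ k.+2 %| ('X - a%:P) * (P^f)^`().
    rewrite exprS dvdp_mul2l //; apply: dvdp_trans DP'.
    by rewrite DE dvdp_mull // dvdp_exp2l.
  rewrite PE rho_deriv exprSr dvdp_mul2l ?expf_neq0 // rho_dvd_root /root.
  rewrite !(hornerE, hornerMn) subrr mul0r addr0 mulrn_eq0 /= => pa.
  by move: p0; rewrite /root pa.
apply: (@dvdp_trans _ (('X - a%:P) ^+ k.-1)); first by rewrite dvdp_exp2l.
apply: (multiplicity_wronskian PE p0).
rewrite !deriv_map -!rmorphM -rmorphB /=; apply: dvdp_trans (_ : (D * D)^f %| _).
  rewrite rmorphM /=.
  suff H : ('X - a%:P) ^+ k.-1 %| D^f by exact: dvdp_mul.
  rewrite gcdp_map dvdp_gcd -deriv_map; apply/andP; split.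
    by rewrite PE dvdp_mull // dvdp_exp2l // leq_pred.
  case: k PE {p0 jk} => [|k] PE; first by rewrite expr0 dvd1p.
  rewrite -(dvdp_mul2l _ _ ra0) PE rho_deriv /= -exprS.
  by rewrite dvdp_mulr.
by rewrite dvdp_map.
Qed.

(** Comparing coefficients in m P = (X - a) P' expresses a by the two leading coefficients of P,
    which are real. *)
Lemma pure_power_root P (a : R[i]) (p : {poly R[i]}) m : size P = m.+1 -> (0 < m)%N ->
  P^f = p * ('X - a%:P) ^+ m -> exists r, root P r.
Proof.
move=> sP m0 PE.
have P0 : P != 0 by rewrite -size_poly_eq0 sP.
have PC0 : P^f != 0 by rewrite map_poly_eq0.
have p0 : p != 0 by apply: contraNneq PC0 => p0; rewrite PE p0 mul0r.
have sp : size p = 1%N.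
  have := congr1 (fun q : {poly R[i]} => size q) PE.
  rewrite size_map_poly sP size_mul ?expf_neq0 ?polyXsubC_eq0 //.
  by rewrite size_exp_XsubC addnS /= -[m.+1]add1n => /addIn.
have [c c0 pc] := size_poly1P _ (introT eqP sp).
have E : m%:R * P^f = ('X - a%:P) * (P^f)^`().
  by rewrite PE rho_deriv pc derivC mulr0 addr0 -mulr_natl; ring.
case: m m0 sP PE E => // m _ sP PE E.
have := congr1 (fun q : {poly R[i]} => q`_m) E.
rewrite mulr_natl coefMn mulrBl coefB coefXM coefCM deriv_map !coef_map /= !coef_deriv.
have -> : (if m == 0%N then 0 else f (P`_m.-1.+1 *+ m.-1.+1)) = f (P`_m) *+ m.
  by case: (m) => [|k] /=; rewrite ?mulr0n // rmorphMn.
rewrite rmorphMn /= => /eqP; rewrite mulrS -subr_eq0 opprB.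
set e := f P`_m.+1; have e0 : e != 0.
  by rewrite fmorph_eq0 -[m.+1]/(m.+2.-1) -sP -/(lead_coef P) lead_coef_eq0.
rewrite addrACA subrr addr0 addrC -[e *+ _]mulr_natr => /eqP aE.
pose r := - (P`_m / (P`_m.+1 * m.+1%:R)).
have ar : a = f r.
  rewrite /r rmorphN rmorphM fmorphV rmorphM rmorph_nat.
  have cm0 : e * m.+1%:R != 0 by rewrite mulf_neq0 // pnatr_eq0.
  apply: (mulIf cm0); rewrite mulNr divfK //.
  by apply/eqP; rewrite -addr_eq0 aE.
exists r; have : root P^f a by rewrite PE exprS !rootM root_XsubC eqxx orbT.
by rewrite ar /root horner_map fmorph_eq0.
Qed.

(** No complex root has multiplicity m, since [pure_power_root] would give P a real root. At a root
    of multiplicity k < m the gcd provides the order k - 1 of Q and E, and [multiplicity_quotient]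
    provides the missing one. *)
Lemma dvdp_of_euler_lagrange P Q E m : size P = m.+1 -> (0 < m)%N ->
  (forall s, P.[s] != 0) -> gcdp P P^`() %| Q -> gcdp P P^`() %| E ->
  m%:R * (P * (Q^`() - 2%:R * E)) = (m%:R - 1) * (P^`() * Q) -> P %| Q.
Proof.
move=> sP m0 Pr DQ DE H.
have P0 : P != 0 by rewrite -size_poly_eq0 sP.
have PC0 : P^f != 0 by rewrite map_poly_eq0.
rewrite -(dvdp_map f); apply: dvdp_roots => // a k p PE pa.
have ra0 : ('X - a%:P) != 0 :> {poly R[i]} by rewrite polyXsubC_eq0.
have km : k != m.
  apply/eqP => km; rewrite km in PE; have [r] := pure_power_root sP m0 PE.
  by rewrite /root (negbTE (Pr r)).
have rD : ('X - a%:P) ^+ k.-1 %| (gcdp P P^`())^f.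
  rewrite gcdp_map dvdp_gcd -deriv_map; apply/andP; split.
    by rewrite PE dvdp_mull // dvdp_exp2l // leq_pred.
  case: k PE {km} => [|k] PE; first by rewrite expr0 dvd1p.
  by rewrite -(dvdp_mul2l _ _ ra0) PE rho_deriv /= -exprS dvdp_mulr.
apply: (@multiplicity_quotient _ P^f Q^f E^f p a m k) => //.
- by apply: dvdp_trans rD _; rewrite dvdp_map.
- by apply: dvdp_trans rD _; rewrite dvdp_map.
- have := congr1 (fun q => q^f) H.
  by rewrite !(rmorphM, rmorphB, rmorph_nat, rmorph1) /= -!deriv_map.
Qed.

End RealDivisibility.

Lemma ultra_fmap (T U : Type) (f : T -> U) (F : set_system T) :
  UltraFilter F -> UltraFilter (f @ F).
Proof.
move=> FU; have FP : ProperFilter F := ultra_proper.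
split; first exact: fmap_proper_filter.
move=> G GF sFG; rewrite predeqE => A; split; last exact: sFG.
move=> GA; have [//|FnA] := in_ultra_setVsetC (f @^-1` A) FU.
have GnA : G (~` A) by apply: sFG; rewrite /fmap /= preimage_setC.
have := @filter_ex _ G _ _ (filterI GA GnA).
by case=> x [].
Qed.

(** * Limits of polynomials and persistence of common factors *)

Section PolynomialLimits.
Variable R : realType.
Implicit Types (p q D : {poly R}).

Lemma real_cvg_unique (T : Type) (F : set_system T) {FF : ProperFilter F}
    (f : T -> R) (a b : R) : f @ F --> a -> f @ F --> b -> a = b.
Proof.
by move=> /(cvg_lim (@Rhausdorff R)) <- /(cvg_lim (@Rhausdorff R)) <-.
Qed.

Definition pcvg (T : Type) (F : set_system T) (f : T -> {poly R}) p : Prop :=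
  forall j, (f t)`_j @[t --> F] --> p`_j.

Lemma pcvgM (T : Type) (F : set_system T) {FF : Filter F} f g p q :
  pcvg F f p -> pcvg F g q -> pcvg F (fun t => f t * g t) (p * q).
Proof.
move=> Hf Hg j; rewrite coefM.
rewrite (_ : (fun _ => _) = fun t => \sum_(i < j.+1) (f t)`_i * (g t)`_(j - i)).
  have K (i : 'I_j.+1) : true ->
      (f t)`_i * (g t)`_(j - i) @[t --> F] --> p`_i * q`_(j - i).
    by move=> _; apply: cvgM; [exact: Hf|exact: Hg].
  by have := @cvg_sumr _ _ _ _ _ (index_enum 'I_j.+1) xpredT _ _ K; apply.
by apply/funext => t; rewrite coefM.
Qed.

Lemma pcvgB (T : Type) (F : set_system T) {FF : Filter F} f g p q :
  pcvg F f p -> pcvg F g q -> pcvg F (fun t => f t - g t) (p - q).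
Proof.
move=> Hf Hg j; rewrite coefB.
rewrite (_ : (fun _ => _) = fun t => (f t)`_j - (g t)`_j).
  by apply: cvgB; [exact: Hf|exact: Hg].
by apply/funext => t; rewrite coefB.
Qed.

Lemma pcvg_deriv (T : Type) (F : set_system T) {FF : Filter F} f p :
  pcvg F f p -> pcvg F (fun t => (f t)^`()) p^`().
Proof.
move=> Hf j; rewrite coef_deriv.
rewrite (_ : (fun _ => _) = fun t => (f t)`_j.+1 * j.+1%:R).
  by rewrite -[p`_j.+1 *+ _]mulr_natr; apply: cvgM; [exact: Hf|exact: cvg_cst].
by apply/funext => t; rewrite coef_deriv mulr_natr.
Qed.

Lemma pcvg_unique (T : Type) (F : set_system T) {FF : ProperFilter F} f p q :
  pcvg F f p -> pcvg F f q -> p = q.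
Proof.
move=> Hp Hq; apply/polyP => j; exact: (real_cvg_unique (Hp j) (Hq j)).
Qed.

Lemma coef_modp p D N j : (size p <= N)%N ->
  (p %% D)`_j = \sum_(i < N) p`_i * ('X^i %% D)`_j.
Proof.
move=> sp; have {1}-> : p = \poly_(i < N) p`_i.
  apply/polyP => i; rewrite coef_poly; case: ltnP => // Ni.
  by have /leq_sizeP := sp; exact.
rewrite poly_def.
rewrite (big_morph (fun q => q %% D) (modpD D) (mod0p D)) coef_sum.
by apply: eq_bigr => i _; rewrite modpZl coefZ.
Qed.

(* The remainder modulo [D] is a linear, hence continuous, function of the
   coefficients of a polynomial of bounded degree. *)
Lemma dvdp_pcvg (T : Type) (F : set_system T) {FF : ProperFilter F}
    (f : T -> {poly R}) p D N :
  (forall t, size (f t) <= N)%N -> pcvg F f p ->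
  (\forall t \near F, D %| f t) -> D %| p.
Proof.
move=> sf fp Df.
have sp : (size p <= N)%N.
  apply/leq_sizeP => j Nj.
  have H : (f t)`_j @[t --> F] --> (0 : R).
    rewrite (_ : (fun _ => _) = fun=> 0); first exact: cvg_cst.
    by apply/funext => t; have /leq_sizeP := sf t; exact.
  exact: (real_cvg_unique (fp j) H).
have H : pcvg F (fun t => f t %% D) (p %% D).
  move=> j; rewrite (coef_modp _ _ sp).
  rewrite (_ : (fun _ => _) = fun t => \sum_(i < N) (f t)`_i * ('X^i %% D)`_j).
    have K (i : 'I_N) : true ->
        (f t)`_i * ('X^i %% D)`_j @[t --> F] --> p`_i * ('X^i %% D)`_j.
      by move=> _; apply: cvgM; [exact: fp|exact: cvg_cst].
    by have := @cvg_sumr _ _ _ _ _ (index_enum 'I_N) xpredT _ _ K; apply.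
  by apply/funext => t; rewrite (coef_modp _ _ (sf t)).
apply/eqP; apply: (pcvg_unique H) => j.
rewrite coef0; apply: cvg_near_cst.
by apply: filterS Df => t /eqP ->; rewrite coef0.
Qed.

Lemma pcvg_rVpoly (T : Type) (F : set_system T) {FF : Filter F} r
    (z : T -> 'rV[R]_r) (l : 'rV[R]_r) :
  z @ F --> l -> pcvg F (fun t => rVpoly (z t)) (rVpoly l).
Proof.
move=> /cvg_mx zl j; rewrite coef_rVpoly.
rewrite (_ : (fun _ => _) = fun t =>
  if insub j is Some i then z t ord0 i else 0); last first.
  by apply/funext => t; rewrite coef_rVpoly.
by case: insubP => [i _ _|_]; [exact: zl|exact: cvg_cst].
Qed.

Lemma size_deriv_le p : (size p^`() <= size p)%N.
Proof. by apply: leq_trans (size_poly _ _) (leq_pred _). Qed.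

(** The pair of cofactors P / D and P' / D, for D = gcd (P, P'), encoded as one vector. It is scaled
    to norm 1 so that a limit of such pairs cannot vanish. *)
Lemma normalized_kernel (P : {poly R}) m r : size P = m.+1 ->
  (m.+2 <= r + size (gcdp P P^`()))%N ->
  exists z : 'rV[R]_(r + r), `|z| = 1 /\
    P * rVpoly (rsubmx z) = P^`() * rVpoly (lsubmx z).
Proof.
move=> sP hr; set D := gcdp P P^`() in hr *.
have P0 : P != 0 by rewrite -size_poly_eq0 sP.
have /dvdpP[A PA] := dvdp_gcdl P P^`(); have /dvdpP[B PB] := dvdp_gcdr P P^`().
rewrite -/D in PA PB.
have D0 : D != 0 by rewrite gcdp_eq0 negb_and P0.
have A0 : A != 0 by apply: contraNneq P0 => A0; rewrite PA A0 mul0r.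
have D1 : (0 < size D)%N by rewrite size_poly_gt0.
have sA : (size A <= r)%N.
  have := congr1 (fun q : {poly R} => size q) PA; rewrite size_mul // sP.
  by move: (size A) (size D : nat) D1 hr => sa sd; lia.
have sB : (size B <= r)%N.
  have [->|B0] := eqVneq B 0; first by rewrite size_poly0.
  apply: leq_trans sA; have := size_deriv_le P.
  rewrite PB PA !size_mul //.
  by move: (size A) (size B) (size D : nat) D1 => sa sb sd; lia.
pose z : 'rV[R]_(r + r) := row_mx (poly_rV A) (poly_rV B).
have z0 : z != 0.
  apply: contraNneq A0 => z0; apply/eqP.
  have E : poly_rV A = 0 :> 'rV[R]_r.
    have := congr1 lsubmx z0; rewrite linear0 => <-.
    by rewrite /z row_mxKl.
  by rewrite -(poly_rV_K sA) E linear0.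
exists (`|z|^-1 *: z); split.
  by rewrite normrZ normfV normr_id mulVf // normr_eq0.
rewrite !linearZ /= row_mxKl row_mxKr !poly_rV_K // {1}PA PB -!scalerAr.
by congr (_ *: _); rewrite mulrAC mulrC [B * D]mulrC -!mulrA [A * B]mulrC.
Qed.

(** When the gcd does not shrink near t = 0, the cofactors A_t, B_t with P_t B_t = P_t' A_t keep
    bounded degree. In the limit, D divides X B - X' A with (A, B) proportional to (P_0 / D, P_0' /
    D), and multiplying by D gives the claim. *)
Lemma wronskian_limit (P : R -> {poly R}) X m :
  pder 0 P X -> (forall t, size (P t) <= m.+1)%N ->
  (\forall t \near (0 : R), size (P t) = m.+1) ->
  (\forall t \near (0 : R),
    (size (gcdp (P 0%R) (P 0%R)^`()) <= size (gcdp (P t) (P t)^`()))%N) ->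
  gcdp (P 0) (P 0)^`() * gcdp (P 0) (P 0)^`() %| X * (P 0)^`() - X^`() * P 0.
Proof.
move=> dP sPle sP sD; set P0 := P 0; set D := gcdp P0 P0^`().
have sP0 : size P0 = m.+1 by exact: nbhs_singleton sP.
have P0n : P0 != 0 by rewrite -size_poly_eq0 sP0.
have D0 : D != 0 by rewrite gcdp_eq0 negb_and P0n.
pose r := (m.+2 - size D)%N.
have sDm : (size D <= m.+1)%N by rewrite -sP0; apply: dvdp_leq => //; exact: dvdp_gcdl.
have rD : (r + size D = m.+2)%N by rewrite /r subnK // ltnW.
have ex t : exists z : 'rV[R]_(r + r), size (P t) = m.+1 ->
    (size D <= size (gcdp (P t) (P t)^`()))%N -> `|z| = 1 /\
    P t * rVpoly (rsubmx z) = (P t)^`() * rVpoly (lsubmx z).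
  have [s1|s1] := eqVneq (size (P t)) m.+1; last first.
    by exists 0 => s1'; rewrite s1' eqxx in s1.
  have [s2|s2] := leqP (size D) (size (gcdp (P t) (P t)^`())); last first.
    by exists 0 => _ ?; exfalso; lia.
  have [|z zP] := @normalized_kernel (P t) m r s1; last by exists z.
  by rewrite -rD leq_add2l.
have /choice[z zP] := ex.
have zn : \forall t \near (0 : R), `|z t| = 1 /\
    P t * rVpoly (rsubmx (z t)) = (P t)^`() * rVpoly (lsubmx (z t)).
  by apply: filterS2 sP sD => t; exact: zP.
(* Along an ultrafilter finer than the punctured neighbourhoods of 0, the normalized cofactors
   converge, since they lie on a compact sphere. *)
have [G [GU sG]] := @ultraFilterLemma R (0 : R)^' _.
have GP : ProperFilter G by exact: ultra_proper.
have zG : UltraFilter (z @ G) := ultra_fmap z GU.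
have nG (B : set R) : nbhs (0 : R) B -> G B.
  by move=> nB; apply: sG; apply: filterS nB => x Bx _.
pose K := [set y : 'rV[R]_(r + r) | `|y| = 1].
have cK : compact K.
  apply: bounded_closed_compact.
    exists 1; split; first exact: real1.
    by move=> M M1 y /= ->; exact: ltW.
  have -> : K = (fun y : 'rV[R]_(r + r) => `|y|) @^-1` [set 1] by [].
  apply: closed_comp; first by move=> y _; exact: norm_continuous.
  exact: closed_eq.
have [y [Ky zy]] : K `&` [set p | z @ G --> p] !=set0.
  move: cK; rewrite compact_ultra; apply => //.
  by apply: nG; apply: filterS zn => t [].
rewrite /= in Ky zy.
have cP : pcvg G P P0.
  move=> j; have [d _] := dP j.
  have c0 : {for (0 : R), continuous (fun t => (P t)`_j)} := is_derive_continuous (dP j).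
  by move=> B nB; apply: nG; exact: c0.
have cl : pcvg G (fun t => rVpoly (lsubmx (z t))) (rVpoly (lsubmx y)).
  apply: pcvg_rVpoly; apply/cvg_mx => i j; rewrite mxE.
  rewrite (_ : (fun _ => _) = fun t => z t i (lshift r j)).
    by have /cvg_mx := zy; apply.
  by apply/funext => t; rewrite mxE.
have cr : pcvg G (fun t => rVpoly (rsubmx (z t))) (rVpoly (rsubmx y)).
  apply: pcvg_rVpoly; apply/cvg_mx => i j; rewrite mxE.
  rewrite (_ : (fun _ => _) = fun t => z t i (rshift r j)).
    by have /cvg_mx := zy; apply.
  by apply/funext => t; rewrite mxE.
set A := rVpoly (lsubmx y) in cl; set B := rVpoly (rsubmx y) in cr.
have AB : P0 * B = P0^`() * A.
  have GF : Filter G by exact: filter_filter.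
  have E3 : pcvg G (fun t => P t * rVpoly (rsubmx (z t))
      - (P t)^`() * rVpoly (lsubmx (z t))) (P0 * B - P0^`() * A).
    by apply: pcvgB; apply: pcvgM => //; exact: pcvg_deriv.
  apply: subr0_eq; apply: (@pcvg_unique _ _ GP _ _ _ E3).
  move=> j; rewrite coef0; apply: cvg_near_cst.
  by apply: nG; apply: filterS zn => t [_ ->]; rewrite subrr coef0.
(* By the relation at t, the expression L t built from difference quotients is a combination of P0
   and P0', hence divisible by D; divisibility passes to the limit. *)
have DX : D %| X * B - X^`() * A.
  pose L t := t^-1 *: (P t - P0) * rVpoly (rsubmx (z t))
     - (t^-1 *: (P t - P0))^`() * rVpoly (lsubmx (z t)).
  have cX : pcvg G (fun t => t^-1 *: (P t - P0)) X.
    move=> j; have [d e] := dP j.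
    have H : h^-1 *: (((fun t => (P t)`_j) \o shift 0) (h *: (1 : R)) - (P 0)`_j)
       @[h --> 0^'] --> X`_j by rewrite -e; exact: d.
    have H2 : (h^-1 *: (P h - P0))`_j @[h --> (0 : R)^'] --> X`_j.
      apply: cvg_trans H; apply: near_eq_cvg; apply: filterE => h /=.
      by rewrite coefZ coefB addr0 [h *: 1]mulr1.
    by move=> C nC; apply: sG; exact: H2.
  apply: (@dvdp_pcvg _ G _ L _ D (m.+1 + r)).
  - move=> t; have s1 : (size (t^-1 *: (P t - P0)) <= m.+1)%N.
      apply: leq_trans (size_scale_leq _ _) _; apply: leq_trans (size_polyD _ _) _.
      by rewrite size_polyN geq_max sPle sP0 leqnn.
    have s2 (w : 'rV[R]_r) : (size (rVpoly w) <= r)%N by exact: size_poly.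
    apply: leq_trans (size_polyD _ _) _; rewrite size_polyN geq_max.
    apply/andP; split; apply: leq_trans (size_polyMleq _ _) _;
      apply: leq_trans (leq_pred _) _; apply: leq_add => //.
    exact: leq_trans (size_deriv_le _) s1.
  - by apply: pcvgB; apply: pcvgM => //; exact: pcvg_deriv.
  - apply: nG; apply: filterS zn => t [_ E].
    have -> : L t = t^-1 *: (P0^`() * rVpoly (lsubmx (z t)) - P0 * rVpoly (rsubmx (z t))).
      rewrite /L derivZ derivB -!scalerAl -scalerBr; congr (_ *: _).
      by rewrite !mulrBl E; ring.
    rewrite -mul_polyC dvdp_mull //; apply: dvdp_sub; apply: dvdp_mulr.
      exact: dvdp_gcdr.
    exact: dvdp_gcdl.
have /dvdpP[A0 PA] := dvdp_gcdl P0 P0^`(); have /dvdpP[B0 PB] := dvdp_gcdr P0 P0^`().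
rewrite -/D in PA PB.
have A00 : A0 != 0 by apply: contraNneq P0n => A00; rewrite PA A00 mul0r.
have AB' : A0 * B = B0 * A.
  by apply: (mulIf D0); rewrite mulrAC -PA AB PB mulrAC.
have cop : coprimep A0 B0.
  have := @coprimep_div_gcd _ P0 P0^`(); rewrite P0n /= => /(_ isT).
  by rewrite -/D {1}PA {1}PB !mulpK.
have /dvdpP[T AT] : A0 %| A.
  by rewrite -(Gauss_dvdpr _ cop) -AB' dvdp_mulr.
have BT : B = T * B0.
  by apply: (mulfI A00); rewrite AB' AT; ring.
have T0 : T != 0.
  apply/eqP => T0; have y0 : y = 0.
    rewrite -[y]hsubmxK -[lsubmx y]rVpolyK -[rsubmx y]rVpolyK -/A -/B.
    by rewrite AT BT T0 !mul0r linear0 row_mx0.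
  by move: Ky; rewrite /K /= y0 normr0 => /esym/eqP; rewrite oner_eq0.
(* The number r is the size of A0 = P0 / D, and A, a nonzero multiple T A0, has at most r
   coefficients; hence T is constant. *)
have sT : size T = 1%N.
  have sA : (size A <= r)%N by exact: size_poly.
  have t1 : (0 < size T)%N by rewrite size_poly_gt0.
  have t2 : (0 < size A0)%N by rewrite size_poly_gt0.
  have t3 : (0 < size D)%N by rewrite size_poly_gt0.
  have sA0 := congr1 (fun q : {poly R} => size q) PA.
  rewrite size_mul // sP0 in sA0.
  rewrite AT size_mul // in sA.
  have key (a b c d : nat) : (0 < a)%N -> (0 < b)%N -> (0 < c)%N ->
    m.+1 = (b + c).-1 -> ((a + b).-1 <= d)%N -> (d + c)%N = m.+2 -> a = 1%N by lia.
  exact: key t1 t2 t3 sA0 sA rD.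
have [c c0 Tc] := size_poly1P _ (introT eqP sT).
have {}DX : D %| X * B0 - X^`() * A0.
  move: DX; rewrite AT BT Tc.
  have -> : X * (c%:P * B0) - X^`() * (c%:P * A0) = c%:P * (X * B0 - X^`() * A0) by ring.
  by rewrite mul_polyC dvdpZr.
have -> : X * P0^`() - X^`() * P0 = (X * B0 - X^`() * A0) * D.
  by rewrite {1}PB {1}PA; ring.
by rewrite dvdp_mul2r.
Qed.

End PolynomialLimits.

(** * Rapcsak's equation *)

Section CkForms.
Variable R : realType.

Lemma Ck_pform (V : normedModType R) n (W : set V) k d
    (c : V -> seq 'I_n -> R) (y : V -> 'I_n -> R) : open W ->
  (forall I, size I = k -> Ck W d (c ^~ I)) -> (forall i, Ck W d (y ^~ i)) ->
  Ck W d (fun z => pform k (c z) (y z)).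
Proof.
move=> oW + Cy; elim: k c => [|k IH] c Cc /=; first exact: Cc.
apply: Ck_sum => // i _; apply: Ck_mul => //.
by apply: (IH (fun z I => c z (i :: I))) => I sI; apply: Cc; rewrite /= sI.
Qed.

Lemma Ck_coord n (U : set 'rV[R]_n) d (i : 'I_n) : open U ->
  Ck U d (fun y : 'rV[R]_n => y ord0 i).
Proof.
move=> oU; apply: Ck_linear => //; last exact: continuous_coord.
by move=> c x y; rewrite !mxE.
Qed.

Lemma Ck_fst n p (W : set ('rV[R]_n * 'rV[R]_p)) d : open W ->
  Ck W d (fun z => z.1).
Proof.
move=> oW; apply/Ck_mx => // i j; apply: Ck_linear => //.
  by move=> c x y; rewrite !mxE.
move=> z; apply: (@continuous_comp _ _ _ fst (fun x : 'rV[R]_n => x i j)).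
  exact: cvg_fst.
exact: continuous_coord.
Qed.

Lemma Ck_snd n p (W : set ('rV[R]_n * 'rV[R]_p)) d : open W ->
  Ck W d (fun z => z.2).
Proof.
move=> oW; apply/Ck_mx => // i j; apply: Ck_linear => //.
  by move=> c x y; rewrite !mxE.
move=> z; apply: (@continuous_comp _ _ _ snd (fun x : 'rV[R]_p => x i j)).
  exact: cvg_snd.
exact: continuous_coord.
Qed.

Lemma open_fst n p (U : set 'rV[R]_n) : open U ->
  open [set z : 'rV[R]_n * 'rV[R]_p | U z.1].
Proof.
move=> oU; apply: (@open_comp _ _ (@fst 'rV[R]_n 'rV[R]_p)) => // z _.
exact: cvg_fst.
Qed.

Lemma Ck_comp_fst n p (U : set 'rV[R]_n) (W : set ('rV[R]_n * 'rV[R]_p)) d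
    (f : 'rV[R]_n -> R) : open U -> open W -> (forall z, W z -> U z.1) ->
  Ck U d f -> Ck W d (fun z => f z.1).
Proof. by move=> oU oW WU Cf; exact: (Ck_comp oW oU WU Cf (Ck_fst d oW)). Qed.

End CkForms.

Section RestrictionToLines.
Variables (R : realType) (n : nat).
Implicit Types (u v : 'rV[R]_n) (c : seq 'I_n -> R) (k : nat).

Definition crd v : 'I_n -> R := fun i => v ord0 i.

Definition linepoly u v (i : 'I_n) : {poly R} := (u ord0 i)%:P + (v ord0 i) *: 'X.

Definition lineform k c u v : {poly R} :=
  pform k (fun I => (c I)%:P) (linepoly u v).

Lemma linepolyE u v i s : (linepoly u v i).[s] = crd (u + s *: v) i.
Proof. by rewrite /linepoly /crd !hornerE !mxE; ring. Qed.

Lemma deriv_linepoly u v i : (linepoly u v i)^`() = (v ord0 i)%:P.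
Proof. by rewrite /linepoly derivD derivC derivZ derivX add0r alg_polyC. Qed.

Lemma lineformE k c u v s : (lineform k c u v).[s] = pform k c (crd (u + s *: v)).
Proof.
rewrite /lineform -horner_evalE pform_rmorph; apply: eq_pform.
  by move=> I _; rewrite /= horner_evalE hornerC.
by move=> i; rewrite /= horner_evalE linepolyE.
Qed.

Lemma size_lineform k c u v : (size (lineform k c u v) <= k.+1)%N.
Proof.
rewrite /lineform; elim: k c => [|k IH] c; first exact: size_polyC_leq1.
rewrite /=; apply: leq_trans (size_sum _ _ _) _; apply/bigmax_leqP => i _.
apply: leq_trans (size_polyMleq _ _) _.
have : (size (linepoly u v i) <= 2)%N.
  apply: leq_trans (size_polyD _ _) _; rewrite geq_max.
  rewrite (leq_trans (size_polyC_leq1 _)) //=.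
  by apply: leq_trans (size_scale_leq _ _) _; rewrite size_polyX.
move: (IH (fun I => c (i :: I))).
by move: (size _) (size _) => p q; lia.
Qed.

Lemma coef_lineform k c u v : (lineform k c u v)`_k = pform k c (crd v).
Proof.
elim: k c => [|k IH] c; first by rewrite /lineform /= coefC.
rewrite /lineform /= coef_sum; apply: eq_bigr => i _.
rewrite /linepoly mulrDl coefD coefCM -scalerAl coefZ coefXM /=.
rewrite -/(lineform k (fun I => c (i :: I)) u v) IH.
have /leq_sizeP -> // := size_lineform k (fun I => c (i :: I)) u v.
by rewrite mulr0 add0r.
Qed.

Lemma deriv_lineform k c u v : symk k c -> (lineform k c u v)^`() =
  k%:R * \sum_(i < n) (v ord0 i)%:P * lineform k.-1 (fun I => c (i :: I)) u v.
Proof.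
move=> sc; rewrite /lineform pform_deriv.
  have -> : pform k (fun I => (c I)%:P^`()) (linepoly u v) = 0.
    rewrite -[RHS](mul0r (pform k (fun I => (c I)%:P) (linepoly u v))) -pformZ.
    by apply: eq_pform => // I _; rewrite derivC mul0r.
  rewrite add0r; congr (_ * _); apply: eq_bigr => i _.
  by rewrite deriv_linepoly.
by move=> I J sI IJ; rewrite (sc I J).
Qed.

Lemma poly_ext (p q : {poly R}) : (forall s, p.[s] = q.[s]) -> p = q.
Proof.
move=> pq; apply/eqP; rewrite -subr_eq0; apply/negPn/negP => d0.
pose rs : seq R := [seq k%:R | k <- iota 0 (size (p - q))].
have := @max_poly_roots _ (p - q) rs d0; rewrite size_map size_iota ltnn.
have -> : all (root (p - q)) rs.
  by apply/allP => s _; rewrite /root !hornerE pq subrr.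
have -> : uniq rs by rewrite map_inj_uniq ?iota_uniq // => i j /eqP; rewrite eqr_nat => /eqP.
by move=> /(_ isT isT).
Qed.

End RestrictionToLines.

Lemma exists_argmin (T : Type) (N : set T) (f : T -> nat) : N !=set0 ->
  exists2 w, N w & forall w', N w' -> (f w <= f w')%N.
Proof.
move=> [w0 Nw0]; apply: contrapT => H.
suff K k w : (f w <= k)%N -> ~ N w by exact: (K (f w0) w0).
elim: k w => [|k IH] w fw Nw; apply: H; exists w => // w' Nw'.
  by move: fw; rewrite leqn0 => /eqP ->.
by rewrite leqNgt; apply/negP => fw'; apply: (IH w') => //; rewrite -ltnS (leq_trans fw').
Qed.

Lemma deriv_sum (S : nzRingType) (I : Type) (r : seq I) (p : I -> {poly S}) :
  (\sum_(i <- r) p i)^`() = \sum_(i <- r) (p i)^`().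
Proof. exact: (big_morph _ (@derivD S) (derivC 0)). Qed.

Lemma horner_lhs (R : comNzRingType) (p a b c : {poly R}) (k : nat) s :
  (k%:R * (p * (a - b - k%:R * c))).[s]
  = k%:R * (p.[s] * (a.[s] - b.[s] - k%:R * c.[s])).
Proof. by rewrite -polyC_natr !(hornerM, hornerD, hornerN, hornerC). Qed.

Lemma horner_rhs (R : comNzRingType) (p q : {poly R}) (k : nat) s :
  ((k%:R - 1) * (p * q)).[s] = (k%:R - 1) * (p.[s] * q.[s]).
Proof. by rewrite -polyC_natr !(hornerM, hornerD, hornerN, hornerC). Qed.

Section ProjectivelyFlat.
Variables (R : realType) (n m : nat) (U : set 'rV[R]_n).
Variable a : 'rV[R]_n -> seq 'I_n -> R.
Variable Gam : 'rV[R]_n -> 'I_n -> 'I_n -> 'I_n -> R.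
Implicit Types (x y u v : 'rV[R]_n).

Definition Aform x y : R := pform m (a x) (crd y).
(** With symmetric coefficients, m [Aform1] and m (m - 1) [Aform2] are the first and second fibre
    derivatives of A; [dAform] is its derivative in x^k and m [dAform1] the mixed derivative. *)
Definition Aform1 x i y : R := pform m.-1 (fun I => a x (i :: I)) (crd y).
Definition Aform2 x i j y : R :=
  pform m.-2 (fun I => a x [:: i, j & I]) (crd y).
Definition dAform x k y : R := pform m (fun I => da a x I k) (crd y).
Definition dAform1 x i k y : R :=
  pform m.-1 (fun I => da a x (i :: I) k) (crd y).
Definition spray x y j : R :=
  \sum_(k < n) \sum_(l < n) Gam x j k l * y ord0 k * y ord0 l.
Definition Bform x y : R := \sum_(k < n) y ord0 k * dAform x k y
  - m%:R * \sum_(j < n) spray x y j * Aform1 x j y.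

(* Rapcsak's equation for [A ^ (1/m)] and the geodesics of [Gam], multiplied
   by [m / A ^ (1/m - 2)]. *)
Definition rapcsak x y i : Prop :=
  Aform x y * (m%:R * \sum_(k < n) y ord0 k * dAform1 x i k y
    - m%:R * (m%:R - 1) * (\sum_(j < n) spray x y j * Aform2 x i j y)
    - dAform x i y)
  = (m%:R - 1) * (Aform1 x i y * Bform x y).

Hypothesis oU : open U.
Hypothesis m2 : (2 <= m)%N.
Hypothesis smooth_a : forall I, size I = m -> smooth U (a ^~ I).
Hypothesis smooth_Gam : forall i j k, smooth U (fun x => Gam x i j k).
Hypothesis sym_a : forall x, U x -> symk m (a x).
Hypothesis sym_Gam : forall x j k l, Gam x j k l = Gam x j l k.
Hypothesis A_gt0 : forall x y, U x -> y != 0 -> 0 < Aform x y.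
Hypothesis rap : forall x y i, U x -> rapcsak x y i.

Lemma sym_da x k : U x -> symk m (fun I => da a x I k).
Proof.
move=> Ux I J sI IJ; rewrite /da /partial.
apply: near_eq_derive; have : nbhs x U by exact: open_nbhs_nbhs.
by apply: filterS => z Uz; exact: sym_a.
Qed.

Lemma smooth_da I k : size I = m -> smooth U (fun x => da a x I k).
Proof. by move=> sI d; exact: Ck_D (smooth_a sI d.+1). Qed.

(** Restrictions to y = u + s v, as polynomials in s: P of A, X of its derivatives in x, Y of its
    fibre derivatives divided by m, Gp of the spray. Q is the covariant derivative of A along y, and
    E the one along the fixed vector v, both evaluated at y. *)
Let P x u v := lineform m (a x) u v.
Let X x k u v := lineform m (fun I => da a x I k) u v.
Let Y x j u v := lineform m.-1 (fun I => a x (j :: I)) u v.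
Let Gp x j u v : {poly R} := \sum_(k < n) \sum_(l < n)
  (Gam x j k l)%:P * linepoly u v k * linepoly u v l.
Let Q x u v := \sum_(k < n) linepoly u v k * X x k u v
  - m%:R * \sum_(j < n) Gp x j u v * Y x j u v.
Let E x u v := \sum_(k < n) (v ord0 k)%:P * X x k u v
  - m%:R * \sum_(j < n) (\sum_(k < n) \sum_(l < n)
     (Gam x j k l)%:P * (v ord0 k)%:P * linepoly u v l) * Y x j u v.

Lemma PE x u v s : (P x u v).[s] = Aform x (u + s *: v).
Proof. exact: lineformE. Qed.

Lemma GpE x j u v s : (Gp x j u v).[s] = spray x (u + s *: v) j.
Proof.
rewrite /Gp horner_sum; apply: eq_bigr => k _; rewrite horner_sum.
by apply: eq_bigr => l _; rewrite !hornerM hornerC !linepolyE.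
Qed.

Lemma QE x u v s : (Q x u v).[s] = Bform x (u + s *: v).
Proof.
rewrite /Q /Bform hornerD hornerN hornerM !horner_sum -polyC_natr hornerC.
congr (_ - _ * _); apply: eq_bigr => k _; rewrite hornerM.
  by rewrite linepolyE lineformE.
by rewrite GpE lineformE.
Qed.

Lemma size_P x u v : U x -> v != 0 -> size (P x u v) = m.+1.
Proof.
move=> Ux v0; apply/eqP; rewrite eqn_leq size_lineform /=.
rewrite ltnNge; apply/negP => /leq_sizeP /(_ m (leqnn m)).
by rewrite coef_lineform => H; have := A_gt0 Ux v0; rewrite /Aform H ltxx.
Qed.

Lemma size_Q x u v : (size (Q x u v) <= m.+2)%N.
Proof.
have sL i : (size (linepoly u v i) <= 2)%N.
  apply: leq_trans (size_polyD _ _) _; rewrite geq_max.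
  rewrite (leq_trans (size_polyC_leq1 _)) //=.
  by apply: leq_trans (size_scale_leq _ _) _; rewrite size_polyX.
rewrite /Q; apply: leq_trans (size_polyD _ _) _; rewrite size_polyN geq_max.
apply/andP; split.
  apply: leq_trans (size_sum _ _ _) _; apply/bigmax_leqP => k _.
  apply: leq_trans (size_polyMleq _ _) _.
  have := sL k; have := size_lineform m (fun I => da a x I k) u v.
  by rewrite -/(X x k u v); move: (size _) (size _) => p q; lia.
rewrite -polyC_natr mul_polyC; apply: leq_trans (size_scale_leq _ _) _.
apply: leq_trans (size_sum _ _ _) _; apply/bigmax_leqP => j _.
apply: leq_trans (size_polyMleq _ _) _.
have sG : (size (Gp x j u v) <= 3)%N.
  apply: leq_trans (size_sum _ _ _) _; apply/bigmax_leqP => k _.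
  apply: leq_trans (size_sum _ _ _) _; apply/bigmax_leqP => l _.
  rewrite -mulrA mul_polyC; apply: leq_trans (size_scale_leq _ _) _.
  apply: leq_trans (size_polyMleq _ _) _; move: (sL k) (sL l).
  by move: (size _) (size _) => p q; lia.
have := size_lineform m.-1 (fun I => a x (j :: I)) u v; move: sG.
by rewrite -/(Y x j u v); move: (size _) (size _) => p q; lia.
Qed.

(** Rapcsak's equation contracted with v and multiplied by m: fibre derivatives along v become
    derivatives in s. The symmetry of Gam makes the derivative of the spray twice one contraction
    with v, hence the coefficient 2 of E. *)
Lemma line_equation x u v : U x ->
  m%:R * (P x u v * ((Q x u v)^`() - 2%:R * E x u v))
  = (m%:R - 1) * ((P x u v)^`() * Q x u v).
Proof.
move=> Ux; have m1 : m = m.-1.+1 by lia.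
have sa := sym_a Ux; have sa1 j : symk m.-1 (fun I => a x (j :: I)).
  by apply: symk_cons; rewrite -m1.
have sd k : symk m (fun I => da a x I k) by exact: sym_da.
have dG j : (Gp x j u v)^`() = 2%:R * \sum_(k < n) \sum_(l < n)
     (Gam x j k l)%:P * (v ord0 k)%:P * linepoly u v l.
  rewrite /Gp deriv_sum mulr_natl mulr2n.
  rewrite [in X in _ = _ + X]exchange_big -big_split; apply: eq_bigr => k _.
  rewrite deriv_sum -big_split; apply: eq_bigr => l _ /=.
  rewrite !derivM derivC !deriv_linepoly (sym_Gam x j l k); ring.
have dQE : (Q x u v)^`() - 2%:R * E x u v =
   \sum_(k < n) linepoly u v k * (X x k u v)^`()
   - \sum_(k < n) (v ord0 k)%:P * X x k u v
   - m%:R * \sum_(j < n) Gp x j u v * (Y x j u v)^`().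
  rewrite /Q /E derivB derivM -!polyC_natr derivC mul0r add0r polyC_natr.
  rewrite !deriv_sum.
  under eq_bigr do rewrite derivM deriv_linepoly.
  rewrite big_split /=.
  under [X in _ - m%:R * X - _]eq_bigr do rewrite derivM dG.
  rewrite big_split /= -/(X x) -/(Y x).
  under [X in _ - m%:R * (X + _) - _]eq_bigr do rewrite -mulrA.
  rewrite -mulr_sumr !polyC_natr; ring.
apply: poly_ext => s; rewrite dQE.
set y := u + s *: v.
have dP : (P x u v)^`().[s] = m%:R * \sum_(i < n) v ord0 i * Aform1 x i y.
  rewrite deriv_lineform // -polyC_natr hornerM hornerC horner_sum.
  by congr (_ * _); apply: eq_bigr => i _; rewrite hornerM hornerC lineformE.
rewrite horner_lhs horner_rhs dP PE QE -/y !horner_sum.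
have e1 : \sum_(k < n) (linepoly u v k * (X x k u v)^`()).[s] =
   \sum_(i < n) v ord0 i * (m%:R * \sum_(k < n) y ord0 k * dAform1 x i k y).
  rewrite [RHS](_ : _ = \sum_(i < n) \sum_(k < n)
     v ord0 i * (m%:R * (y ord0 k * dAform1 x i k y))); last first.
    by apply: eq_bigr => i _; rewrite !mulr_sumr.
  rewrite exchange_big; apply: eq_bigr => k _.
  rewrite hornerM linepolyE deriv_lineform // -polyC_natr hornerM hornerC horner_sum.
  rewrite mulrA mulr_sumr; apply: eq_bigr => i _.
  by rewrite hornerM hornerC lineformE -/y /crd /dAform1; ring.
have e2 : \sum_(k < n) ((v ord0 k)%:P * X x k u v).[s] =
   \sum_(i < n) v ord0 i * dAform x i y.
  by apply: eq_bigr => i _; rewrite hornerM hornerC lineformE.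
have e3 : \sum_(j < n) (Gp x j u v * (Y x j u v)^`()).[s] =
   \sum_(i < n) v ord0 i * ((m%:R - 1) * \sum_(j < n) spray x y j * Aform2 x i j y).
  rewrite [RHS](_ : _ = \sum_(i < n) \sum_(j < n)
     v ord0 i * ((m%:R - 1) * (spray x y j * Aform2 x i j y))); last first.
    by apply: eq_bigr => i _; rewrite !mulr_sumr.
  rewrite exchange_big; apply: eq_bigr => j _.
  rewrite hornerM GpE deriv_lineform // -polyC_natr hornerM hornerC horner_sum.
  rewrite mulrA mulr_sumr; apply: eq_bigr => i _.
  rewrite hornerM hornerC lineformE -/y (_ : m.-1%:R = m%:R - 1 :> R); last first.
    by rewrite [in RHS]m1 -natr1 addrK.
  rewrite (_ : pform _ _ _ = Aform2 x i j y) ?/Aform2; last first.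
    by apply: pform_swap; have -> : m.-2.+2 = m by lia.
  by ring.
rewrite e1 e2 e3.
have r (i : 'I_n) := @rap x y i Ux.
have K : \sum_(i < n) v ord0 i * (Aform x y * (m%:R * \sum_(k < n) y ord0 k * dAform1 x i k y
    - m%:R * (m%:R - 1) * (\sum_(j < n) spray x y j * Aform2 x i j y)
    - dAform x i y)) = \sum_(i < n) v ord0 i * ((m%:R - 1) * (Aform1 x i y * Bform x y)).
  by apply: eq_bigr => i _; rewrite r.
transitivity (m%:R * (\sum_(i < n) v ord0 i * (Aform x y * (m%:R * \sum_(k < n) y ord0 k * dAform1 x i k y
    - m%:R * (m%:R - 1) * (\sum_(j < n) spray x y j * Aform2 x i j y)
    - dAform x i y)))).
  congr (_ * _); rewrite -sumrB.
  rewrite [m%:R * (\sum_(i < n) v ord0 i * ((m%:R - 1) * _))]mulr_sumr -sumrB.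
  by rewrite mulr_sumr; apply: eq_bigr => i _; ring.
rewrite K !mulr_sumr mulr_suml mulr_sumr; apply: eq_bigr => i _; ring.
Qed.

Lemma continuous_pair (T V W : topologicalType) (f : T -> V) (g : T -> W) t :
  {for t, continuous f} -> {for t, continuous g} ->
  {for t, continuous (fun s => (f s, g s))}.
Proof. by move=> cf cg; exact: (cvg_pair cf cg). Qed.

Lemma pder_const (p : {poly R}) (t : R) : pder t (fun _ => p) 0.
Proof. by move=> j; rewrite coef0; exact: isd_cst. Qed.

Lemma pder_polyC (f : R -> R) (t d : R) :
  is_derive t 1 f d -> pder t (fun s => (f s)%:P) d%:P.
Proof.
move=> df j; rewrite coefC.
rewrite (_ : (fun _ => _) = fun s => if j == 0%N then f s else 0).
  by case: (j == 0%N) => //; exact: isd_cst.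
by apply/funext => s; rewrite coefC.
Qed.

Lemma pder_base x k u v : U x ->
  pder 0 (fun t => P (x + t *: basis_vec R k) u v) (X x k u v).
Proof.
move=> Ux; have x0 : x + (0 : R) *: basis_vec R k = x by rewrite scale0r addr0.
have := @pform_pder R n 0 m
  (fun t I => (a (x + t *: basis_vec R k) I)%:P) (fun I => (da a x I k)%:P)
  (fun _ => linepoly u v) (fun _ => 0).
rewrite x0 big1 ?mulr0 ?addr0; last by move=> i _; rewrite mul0r.
apply.
- move=> I sI; apply: pder_polyC.
  apply: (isd_line0 (a ^~ I) x (basis_vec R k) _).1.
  exact: (Ck_derive _ (smooth_a sI 1) Ux).
- by move=> i; exact: pder_const.
- by move=> I J sI IJ; rewrite (sym_a Ux sI IJ).
Qed.

Lemma pder_fiber x j u v : U x ->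
  pder 0 (fun t => P x (u + t *: basis_vec R j) v) (m%:R * Y x j u v).
Proof.
move=> Ux; have u0 : u + (0 : R) *: basis_vec R j = u by rewrite scale0r addr0.
have := @pform_pder R n 0 m
  (fun _ I => (a x I)%:P) (fun I => 0)
  (fun t => linepoly (u + t *: basis_vec R j) v) (fun i => ((i == j)%:R)%:P).
rewrite u0 (bigD1 j) //= eqxx mul1r big1 ?addr0; last first.
  by move=> i /negbTE ->; rewrite mul0r.
have -> : pform m (fun=> 0) (linepoly u v) = 0 :> {poly R}.
  rewrite -[RHS](mul0r (pform m (fun=> 0) (linepoly u v))) -pformZ.
  by apply: eq_pform => // I _; rewrite mul0r.
rewrite add0r; apply.
- by move=> I _; exact: pder_const.
- move=> i; rewrite /linepoly.
  have H : is_derive (0 : R) 1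
      (fun t => (u + t *: basis_vec R j) ord0 i) (i == j)%:R.
    rewrite (_ : (fun _ => _) = fun t => u ord0 i + t * (i == j)%:R); last first.
      by apply/funext => t; rewrite !mxE eqxx.
    have K := isd_mulr (i == j)%:R (is_derive_id (0 : R) (1 : R)).
    apply: is_derive_eq (isd_add (isd_cst (u ord0 i) (0 : R) (1 : R)) K) _.
    by rewrite add0r mul1r.
  move=> d; have Hd := pder_polyC H d.
  rewrite (_ : (fun _ => _) = fun t =>
     ((u + t *: basis_vec R j) ord0 i)%:P`_d + (v ord0 i *: 'X)`_d).
    by apply: is_derive_eq (isd_add Hd (isd_cst _ (0 : R) (1 : R))) _; rewrite addr0.
  by apply/funext => t; rewrite coefD.
- by move=> I J sI IJ; rewrite (sym_a Ux sI IJ).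
Qed.

Let D x u v := gcdp (P x u v) (P x u v)^`().

(** At a minimum of the degree of the gcd over an open set, [wronskian_limit] applies to every
    displacement of x or u along a basis vector; the derivatives of P in these directions are X k
    and m Y j. *)
Lemma minimal_gcd_dvd (N : set ('rV[R]_n * 'rV[R]_n)) x u v : open N ->
  (forall z, N z -> U z.1) -> v != 0 -> N (x, u) ->
  (forall z, N z -> size (D x u v) <= size (D z.1 z.2 v))%N ->
  (forall k, D x u v %| X x k u v) /\ (forall j, D x u v %| Y x j u v).
Proof.
move=> oN NU v0 Nxu Dmin.
have Ux : U x := NU _ Nxu.
have P0 : P x u v != 0 by rewrite -size_poly_eq0 size_P.
have nN (g : R -> 'rV[R]_n * 'rV[R]_n) : {for 0, continuous g} -> g 0 = (x, u) ->
    \forall t \near (0 : R), N (g t).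
  by move=> cg g0; apply: cg; rewrite g0; exact: open_nbhs_nbhs.
have cline (w e : 'rV[R]_n) : {for 0, continuous (fun t : R => w + t *: e)}.
  apply: cvgD; first exact: cvg_cst.
  by apply: cvgZr_tmp; exact: cvg_id.
have wl (Pt : R -> {poly R}) Z : Pt 0 = P x u v -> pder 0 Pt Z ->
    (forall t, size (Pt t) <= m.+1)%N ->
    (\forall t \near (0 : R), exists2 z, N z & Pt t = P z.1 z.2 v) ->
    D x u v %| Z.
  move=> Pt0 dPt sPt nPt; apply: dvdp_gcd_wronskian => //.
  have := wronskian_limit dPt sPt; rewrite Pt0; apply.
    by apply: filterS nPt => t [z Nz ->]; rewrite size_P //; exact: NU.
  by apply: filterS nPt => t [z Nz ->]; exact: Dmin.
split=> [k|j].
  apply: (wl (fun t => P (x + t *: basis_vec R k) u v)).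
  - by rewrite scale0r addr0.
  - exact: pder_base.
  - by move=> t; exact: size_lineform.
  - have : \forall t \near (0 : R), N (x + t *: basis_vec R k, u).
      apply: nN; last by rewrite scale0r addr0.
      by apply: continuous_pair; [exact: cline|exact: cvg_cst].
    by apply: filterS => t Nt; exists (x + t *: basis_vec R k, u).
have : D x u v %| m%:R * Y x j u v.
  apply: (wl (fun t => P x (u + t *: basis_vec R j) v)).
  - by rewrite scale0r addr0.
  - exact: pder_fiber.
  - by move=> t; exact: size_lineform.
  - have : \forall t \near (0 : R), N (x, u + t *: basis_vec R j).
      apply: nN; last by rewrite scale0r addr0.
      by apply: continuous_pair; [exact: cvg_cst|exact: cline].
    by apply: filterS => t Nt; exists (x, u + t *: basis_vec R j).
rewrite -polyC_natr mul_polyC dvdpZr // pnatr_eq0; lia.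
Qed.

Lemma dvdp_sumr (I : Type) (r : seq I) (d : {poly R}) (p : I -> {poly R}) :
  (forall i, d %| p i) -> d %| \sum_(i <- r) p i.
Proof.
by move=> H; elim/big_ind: _ => // p1 p2; exact: dvdp_add.
Qed.

Lemma line_dvd x u v : U x -> v != 0 -> (forall s, u + s *: v != 0) ->
  (forall k, D x u v %| X x k u v) -> (forall j, D x u v %| Y x j u v) ->
  P x u v %| Q x u v.
Proof.
move=> Ux v0 uv DX DY.
apply: (@dvdp_of_euler_lagrange R _ _ (E x u v) m).
- exact: size_P.
- by lia.
- by move=> s; rewrite PE gt_eqF // A_gt0.
- apply: dvdp_sub; first by apply: dvdp_sumr => k; apply: dvdp_mull; exact: DX.
  by apply: dvdp_mull; apply: dvdp_sumr => j; apply: dvdp_mull; exact: DY.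
- apply: dvdp_sub; first by apply: dvdp_sumr => k; apply: dvdp_mull; exact: DX.
  by apply: dvdp_mull; apply: dvdp_sumr => j; apply: dvdp_mull; exact: DY.
- exact: line_equation.
Qed.

Lemma Aform_scale x y s : Aform x (s *: y) = s ^+ m * Aform x y.
Proof.
rewrite /Aform -pform_homog; apply: eq_pform => // i.
by rewrite /crd mxE.
Qed.

Lemma Bform_scale x y s : Bform x (s *: y) = s ^+ m.+1 * Bform x y.
Proof.
have m1 : m = m.-1.+1 by lia.
rewrite /Bform mulrBr; congr (_ - _).
  rewrite mulr_sumr; apply: eq_bigr => k _.
  have -> : dAform x k (s *: y) = s ^+ m * dAform x k y.
    rewrite /dAform -pform_homog; apply: eq_pform => // i.
    by rewrite /crd mxE.
  by rewrite mxE exprS; ring.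
rewrite [RHS]mulrCA; congr (_ * _); rewrite mulr_sumr; apply: eq_bigr => j _.
have -> : Aform1 x j (s *: y) = s ^+ m.-1 * Aform1 x j y.
  rewrite /Aform1 -pform_homog; apply: eq_pform => // i.
  by rewrite /crd mxE.
have -> : spray x (s *: y) j = s ^+ 2 * spray x y j.
  rewrite /spray mulr_sumr; apply: eq_bigr => k _.
  rewrite mulr_sumr; apply: eq_bigr => l _; rewrite !mxE; ring.
have -> : s ^+ m.+1 = s ^+ 2 * s ^+ m.-1 by rewrite -exprD; congr (_ ^+ _); lia.
by ring.
Qed.

(** The midpoint equation ph (u + v) + ph (u - v) = 2 ph u for ph = B / A, with the denominators
    cleared so that it makes sense and is continuous at zeros of A as well. *)
Let Mid x u v := Bform x (u + v) * Aform x (u - v) * Aform x u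
  + Bform x (u - v) * Aform x (u + v) * Aform x u
  - 2%:R * Bform x u * Aform x (u + v) * Aform x (u - v).

(** The quotient B / A is homogeneous of degree one. This disposes of the lines through the origin,
    on which A has a zero. *)
Lemma Mid_dep x (v : 'rV[R]_n) s : Mid x (s *: v) v = 0.
Proof.
have -> : Mid (x) (s *: v) v = Bform x ((s + 1) *: v) * Aform x ((s - 1) *: v) * Aform x (s *: v)
  + Bform x ((s - 1) *: v) * Aform x ((s + 1) *: v) * Aform x (s *: v)
  - 2%:R * Bform x (s *: v) * Aform x ((s + 1) *: v) * Aform x ((s - 1) *: v).
  by rewrite scalerDl scalerBl scale1r.
rewrite !Aform_scale !Bform_scale !exprS; ring.
Qed.

Lemma Mid_dep0 x u : Mid x u 0 = 0.
Proof. by rewrite /Mid subr0 addr0; ring. Qed.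

Lemma Mid_continuous v x u : U x ->
  {for (x, u), continuous (fun z : 'rV[R]_n * 'rV[R]_n => Mid z.1 z.2 v)}.
Proof.
move=> Ux; pose W := [set z : 'rV[R]_n * 'rV[R]_n | U z.1].
have oW : open W by exact: open_fst.
apply: (@Ck_cont _ _ _ W 0) => //.
have Cc (w : 'rV[R]_n) i : Ck W 0 (fun z => (z.2 + w) ord0 i).
  rewrite (_ : (fun _ => _) = fun z : 'rV[R]_n * 'rV[R]_n => z.2 ord0 i + w ord0 i).
    apply: Ck_add => //; last exact: Ck_cst.
    exact: ((Ck_mx _ _ oW).1 (Ck_snd 0 oW)).
  by apply/funext => z; rewrite mxE.
have CG i j k : Ck W 0 (fun z => Gam z.1 i j k).
  exact: (Ck_comp_fst oU oW _ (smooth_Gam i j k 0)).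
have Ca k I : size (k ++ I) = m -> Ck W 0 (fun z => a z.1 (k ++ I)).
  by move=> sI; exact: (Ck_comp_fst oU oW _ (smooth_a sI 0)).
have Cda I k : size I = m -> Ck W 0 (fun z => da a z.1 I k).
  by move=> sI; exact: (Ck_comp_fst oU oW _ (smooth_da k sI 0)).
have CA w : Ck W 0 (fun z => Aform z.1 (z.2 + w)).
  by apply: (Ck_pform oW) => [I sI|]; [exact: (Ca [::])|exact: Cc].
have CB w : Ck W 0 (fun z => Bform z.1 (z.2 + w)).
  apply: (Ck_sub_fun oW).
    apply: (Ck_sum _ oW) => k _; apply: (Ck_mul oW (Cc w k)).
    by apply: (Ck_pform oW) => [I sI|]; [exact: Cda|exact: Cc].
  apply: (Ck_mull _ oW); apply: (Ck_sum _ oW) => j _; apply: (Ck_mul oW).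
    apply: (Ck_sum _ oW) => k _; apply: (Ck_sum _ oW) => l _.
    exact: (Ck_mul oW (Ck_mul oW (CG _ _ _) (Cc w k)) (Cc w l)).
  apply: (Ck_pform oW) => [I sI|]; last exact: Cc.
  by apply: (Ca [:: j]); rewrite /= sI; lia.
have CA0 : Ck W 0 (fun z => Aform z.1 z.2).
  by apply: (Ck_eq oW _ (CA 0)) => z _; rewrite addr0.
have CB0 : Ck W 0 (fun z => Bform z.1 z.2).
  by apply: (Ck_eq oW _ (CB 0)) => z _; rewrite addr0.
apply: (Ck_sub_fun oW); first apply: (Ck_add oW).
- exact: (Ck_mul oW (Ck_mul oW (CB v) (CA (- v))) CA0).
- exact: (Ck_mul oW (Ck_mul oW (CB (- v)) (CA v)) CA0).
- exact: (Ck_mul oW (Ck_mul oW (Ck_mull _ oW CB0) (CA v)) (CA (- v))).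
Qed.

(** Inside the open set where the equation fails for the given v, a point with gcd of least degree
    is chosen. There P divides Q, so B / A is affine along the line, and the equation holds after
    all. *)
Lemma Mid0 x u v : U x -> Mid x u v = 0.
Proof.
move=> Ux; apply/eqP/negPn/negP => M0.
pose N := [set z : 'rV[R]_n * 'rV[R]_n | U z.1 /\ Mid z.1 z.2 v != 0].
have oN : open N.
  rewrite openE => -[x' u'] [/= Ux' M0'].
  rewrite /interior; near=> z; split.
    near: z; have oW : open [set z : 'rV[R]_n * 'rV[R]_n | U z.1] by exact: open_fst.
    exact: open_nbhs_nbhs.
  near: z; have c := @Mid_continuous v x' u' Ux'.
  apply: (c [set r : R | r != 0]).
  by apply: open_nbhs_nbhs; split => //; exact: open_neq.
have N0 : N !=set0 by exists (x, u).
have [[x1 u1] [/= Ux1 M1] min1] :=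
  exists_argmin (fun z : 'rV[R]_n * 'rV[R]_n => size (D z.1 z.2 v)) N0.
have v0 : v != 0.
  by apply: contraNneq M1 => ->; rewrite Mid_dep0.
have uv s : u1 + s *: v != 0.
  apply: contraNneq M1 => /eqP; rewrite addr_eq0 -scaleNr => /eqP ->.
  by rewrite Mid_dep.
have NU z : N z -> U z.1 by case.
have [DX DY] := @minimal_gcd_dvd N x1 u1 v oN NU v0 (conj Ux1 M1) min1.
have /dvdpP[T QT] := line_dvd Ux1 v0 uv DX DY.
(* Q has degree at most m + 1 and P degree m, so the quotient is affine in s. *)
have sT : (size T <= 2)%N.
  have [->|T0] := eqVneq T 0; first by rewrite size_poly0.
  have P0 : P x1 u1 v != 0 by rewrite -size_poly_eq0 size_P.
  have := size_Q x1 u1 v; rewrite QT size_mul // size_P // addnS /=.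
  by move: (size T) => t; lia.
pose al := T`_0; pose be := T`_1.
have TE : T = al%:P + be *: 'X.
  apply/polyP => -[|[|i]]; rewrite coefD coefC coefZ coefX /= ?mulr0 ?mulr1 ?addr0 ?add0r //.
  by have /leq_sizeP := sT; apply.
have K s : Bform x1 (u1 + s *: v) = (al + be * s) * Aform x1 (u1 + s *: v).
  have := congr1 (fun q : {poly R} => q.[s]) QT.
  rewrite QE hornerM PE TE.
  by rewrite hornerD hornerC hornerZ hornerX.
have K0 := K 0; have K1 := K 1; have K2 := K (-1).
rewrite !(scale0r, addr0, scale1r, scaleN1r) in K0 K1 K2.
move/eqP: M1; apply; rewrite /Mid K0 K1 K2; ring.
Unshelve. all: by end_near. Qed.

Definition theta x i : R := Bform x (basis_vec R i) / Aform x (basis_vec R i).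

(** The midpoint equation at (u + v)/2 and (u - v)/2, with homogeneity of degree one, makes B / A
    additive. The vectors at which A vanishes are treated apart. *)
Lemma Bform_factor x y : U x ->
  Bform x y = (\sum_(i < n) theta x i * y ord0 i) * Aform x y.
Proof.
move=> Ux; pose ph y := Bform x y / Aform x y.
have A0 : Aform x 0 = 0.
  rewrite -(scale0r (0 : 'rV[R]_n)) Aform_scale expr0n; have -> : (m == 0)%N = false by lia.
  by rewrite mul0r.
have B0 : Bform x 0 = 0.
  by rewrite -(scale0r (0 : 'rV[R]_n)) Bform_scale expr0n mul0r.
have An0 z : z != 0 -> Aform x z != 0 by move=> z0; rewrite gt_eqF // A_gt0.
have BE z : Bform x z = ph z * Aform x z.
  rewrite /ph; have [->|z0] := eqVneq z 0; first by rewrite B0 A0 mulr0.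
  by rewrite divfK // An0.
have ph0 : ph 0 = 0 by rewrite /ph B0 mul0r.
have phZ s z : ph (s *: z) = s * ph z.
  have [->|z0] := eqVneq z 0; first by rewrite scaler0 ph0 mulr0.
  have [->|s0] := eqVneq s 0; first by rewrite scale0r ph0 mul0r.
  rewrite /ph Aform_scale Bform_scale exprS.
  by field; rewrite An0 //= expf_neq0.
have ph_mid u v : u != 0 -> u + v != 0 -> u - v != 0 ->
    ph (u + v) + ph (u - v) = 2%:R * ph u.
  move=> u0 uv0 uv1; have := @Mid0 x u v Ux; rewrite /Mid !BE => H.
  have K : (ph (u + v) + ph (u - v) - 2%:R * ph u)
     * (Aform x (u + v) * Aform x (u - v) * Aform x u) = 0.
    by rewrite -H; ring.
  apply/eqP; rewrite -subr_eq0; move/eqP: K.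
  by rewrite !mulf_eq0 !(negbTE (An0 _ _)) // !orbF.
have phD u v : ph (u + v) = ph u + ph v.
  have [->|u0] := eqVneq u 0; first by rewrite add0r ph0 add0r.
  have [->|v0] := eqVneq v 0; first by rewrite addr0 ph0 addr0.
  have [uv|uv] := eqVneq (u + v) 0.
    have -> : v = -1 *: u by rewrite scaleN1r; apply/eqP; rewrite -addr_eq0 addrC uv.
    by rewrite phZ scaleN1r subrr ph0 mulN1r subrr.
  have dbl (w : 'rV[R]_n) : 2^-1 *: (w + w) = w.
    rewrite -{1 2}[w]scale1r -scalerDl scalerA.
    have -> : 2^-1 * (1 + 1) = 1 :> R by field.
    exact: scale1r.
  have e1 : 2^-1 *: (u + v) + 2^-1 *: (u - v) = u.
    by rewrite -scalerDr addrACA subrr addr0 dbl.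
  have e2 : 2^-1 *: (u + v) - 2^-1 *: (u - v) = v.
    by rewrite -scalerBr opprB [v - u]addrC addrACA subrr add0r dbl.
  have := @ph_mid (2^-1 *: (u + v)) (2^-1 *: (u - v)).
  rewrite e1 e2 phZ => -> //; first by field.
  by rewrite scaler_eq0 negb_or uv andbT invr_eq0 pnatr_eq0.
have ph_sum (w : 'I_n -> 'rV[R]_n) : ph (\sum_(i < n) w i) = \sum_(i < n) ph (w i).
  by apply: (big_morph ph) => //; exact: phD.
rewrite BE; congr (_ * _); rewrite {1}(row_basis y) ph_sum.
by apply: eq_bigr => i _; rewrite phZ mulrC.
Qed.

End ProjectivelyFlat.

(** * Parallel forms and the projective correction of the connection *)

Section RootMetric.
Variables (R : realType) (n m : nat) (U : set 'rV[R]_n).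
Variable a : 'rV[R]_n -> seq 'I_n -> R.
Implicit Types (x y u v z : 'rV[R]_n) (Gam : 'rV[R]_n -> 'I_n -> 'I_n -> 'I_n -> R).

Hypothesis oU : open U.
Hypothesis m2 : (2 <= m)%N.
Hypothesis smooth_a : forall I, size I = m -> smooth U (a ^~ I).
Hypothesis sym_a : forall x, U x -> symk m (a x).
Hypothesis A_gt0 : forall x y, U x -> y != 0 -> 0 < Aform m a x y.

Local Notation A := (Aform m a).
Local Notation A1 := (Aform1 m a).
Local Notation A2 := (Aform2 m a).
Local Notation dA := (dAform m a).
Local Notation dA1 := (dAform1 m a).

Lemma prednKm : m.-1.+1 = m. Proof. lia. Qed.
Lemma prednKm2 : m.-2.+2 = m. Proof. lia. Qed.

(** The vanishing of the covariant derivative of the tensor a in each coordinate direction k,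
    written as an identity of forms in y. *)
Definition parallel Gam x : Prop := forall k y,
  dA x k y = m%:R * \sum_(j < n) (\sum_(l < n) Gam x j k l * y ord0 l) * A1 x j y.

Lemma pform0 k (w : 'I_n -> R) : pform k (fun=> 0) w = 0.
Proof.
rewrite -[RHS](mul0r (pform k (fun=> 0) w)) -pformZ.
by apply: eq_pform => // I _; rewrite mul0r.
Qed.

Lemma pform_curve (V : normedModType R) k (c : seq 'I_n -> R) (y : V -> 'rV[R]_n)
    (s v : V) dy : symk k c -> is_derive s v y dy ->
  is_derive s v (fun t => pform k c (crd (y t)))
   (k%:R * \sum_(j < n) dy ord0 j * pform k.-1 (fun I => c (j :: I)) (crd (y s))).
Proof.
move=> sc /isd_mx dys; rewrite -[X in is_derive _ _ _ X]add0r -{1}(pform0 k (crd (y s))).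
apply: (@pform_isd _ _ _ _ _ _ (fun _ => c) (fun=> 0) (fun t => crd (y t)) (fun j => dy ord0 j)) => //.
by move=> I _; exact: isd_cst.
Qed.

Lemma pform_partial k c y i : symk k c ->
  is_derive y (basis_vec R i) (fun z => pform k c (crd z))
    (k%:R * pform k.-1 (fun I => c (i :: I)) (crd y)).
Proof.
move=> sc; have := @pform_curve _ k c id y (basis_vec R i) (basis_vec R i) sc
  (is_derive_id y (basis_vec R i)).
rewrite (bigD1 i) //= mxE !eqxx mul1r big1 ?addr0 // => j ji.
by rewrite mxE (negbTE ji) /= mul0r.
Qed.

Lemma sym_a1 x i : U x -> symk m.-1 (fun I => a x (i :: I)).
Proof.
move=> Ux; apply: (symk_cons (c := a x)).
by rewrite prednKm; exact: sym_a.
Qed.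

Lemma sym_da' x k : U x -> symk m (fun I => da a x I k).
Proof. by move=> Ux; exact: (sym_da oU sym_a k Ux). Qed.

Lemma A_partial x y i : U x ->
  is_derive y (basis_vec R i) (A x) (m%:R * A1 x i y).
Proof. by move=> Ux; exact: pform_partial (sym_a Ux). Qed.

Lemma A2C x y i j : U x -> A2 x i j y = A2 x j i y.
Proof.
move=> Ux; apply: pform_swap; rewrite prednKm2.
exact: sym_a.
Qed.

Lemma A1_partial x y i j : U x ->
  is_derive y (basis_vec R i) (A1 x j) (m.-1%:R * A2 x i j y).
Proof. by move=> Ux; rewrite A2C //; exact: pform_partial (sym_a1 j Ux). Qed.

Lemma dA_partial x y i k : U x ->
  is_derive y (basis_vec R i) (dA x k) (m%:R * dA1 x i k y).
Proof. by move=> Ux; exact: pform_partial (sym_da' k Ux). Qed.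

Lemma crd_partial y i j :
  is_derive y (basis_vec R i) (fun z : 'rV[R]_n => z ord0 j) (j == i)%:R.
Proof.
have /isd_mx /(_ ord0 j) := is_derive_id y (basis_vec R i).
by rewrite mxE eqxx.
Qed.

Lemma Euler_A x y : \sum_(j < n) y ord0 j * A1 x j y = A x y.
Proof. by rewrite /Aform -{2}prednKm. Qed.

Lemma Euler_A1 x i y : \sum_(j < n) y ord0 j * A2 x i j y = A1 x i y.
Proof. by rewrite /Aform1 -{2}prednKm2. Qed.

Lemma spray_partial Gam x y i j : (forall j k l, Gam x j k l = Gam x j l k) ->
  is_derive y (basis_vec R i) (fun z => spray Gam x z j)
    (2%:R * \sum_(l < n) Gam x j i l * y ord0 l).
Proof.
move=> sG; rewrite /spray.
have H : is_derive y (basis_vec R i) (fun z : 'rV[R]_n =>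
    \sum_(k < n) \sum_(l < n) Gam x j k l * z ord0 k * z ord0 l)
    (\sum_(k < n) \sum_(l < n) (Gam x j k l * (k == i)%:R * y ord0 l
      + Gam x j k l * y ord0 k * (l == i)%:R)).
  apply: isd_sum => k _; apply: isd_sum => l _; apply: isd_mul.
    by apply: isd_mull; exact: crd_partial.
  exact: crd_partial.
apply: is_derive_eq H _.
under eq_bigr do rewrite big_split /=.
rewrite big_split /= mulr_natl mulr2n; congr (_ + _).
  rewrite (bigD1 i) //= [X in _ + X]big1 ?addr0 => [|k /negbTE ki].
    by apply: eq_bigr => l _; rewrite eqxx mulr1.
  by apply: big1 => l _; rewrite ki mulr0 mul0r.
apply: eq_bigr => k _; rewrite (bigD1 i) //= [X in _ + X]big1 ?addr0 => [|l /negbTE li].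
  by rewrite eqxx mulr1 sG.
by rewrite li mulr0.
Qed.

Lemma m1E : m.-1%:R = m%:R - 1 :> R.
Proof. by rewrite -{2}prednKm -natr1 addrK. Qed.

Lemma m_neq0 : m%:R != 0 :> R.
Proof. by rewrite pnatr_eq0; lia. Qed.

(** Weyl's projective change of a connection. The spray changes by theta(y) y / m, so that B changes
    by - theta(y) A, which is what cancels B = theta A. *)
Definition correct_connection Gam (th : 'rV[R]_n -> 'I_n -> R) x j k l : R :=
  Gam x j k l + (2%:R * m%:R)^-1 * ((j == k)%:R * th x l + (j == l)%:R * th x k).

(* Differentiating [B = theta A] in the fibre and comparing with Rapcsak's
   equation determines [nabla_i A]. *)
Lemma parallel_correction Gam th x : U x ->
  (forall j k l, Gam x j k l = Gam x j l k) ->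
  (forall y i, rapcsak m a Gam x y i) ->
  (forall y, Bform m a Gam x y = (\sum_(i < n) th x i * y ord0 i) * A x y) ->
  parallel (correct_connection Gam th) x.
Proof.
move=> Ux sG rap BE i y.
pose T := \sum_(i < n) th x i * y ord0 i.
have corr : m%:R * \sum_(j < n) (\sum_(l < n) correct_connection Gam th x j i l
    * y ord0 l) * A1 x j y =
    m%:R * \sum_(j < n) (\sum_(l < n) Gam x j i l * y ord0 l) * A1 x j y
    + 2^-1 * (T * A1 x i y + th x i * A x y).
  have e j : (\sum_(l < n) correct_connection Gam th x j i l * y ord0 l) * A1 x j y =
      (\sum_(l < n) Gam x j i l * y ord0 l) * A1 x j y +
      (2%:R * m%:R)^-1 * ((j == i)%:R * T * A1 x j y + th x i * (y ord0 j * A1 x j y)).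
    have -> : \sum_(l < n) correct_connection Gam th x j i l * y ord0 l =
        \sum_(l < n) Gam x j i l * y ord0 l +
        (2%:R * m%:R)^-1 * ((j == i)%:R * T + th x i * y ord0 j).
      have -> : y ord0 j = \sum_(l < n) (j == l)%:R * y ord0 l.
        rewrite (bigD1 j) //= eqxx mul1r big1 ?addr0 // => l.
        by rewrite eq_sym => /negbTE ->; rewrite mul0r.
      rewrite /T !mulr_sumr -big_split mulr_sumr -big_split /=.
      by apply: eq_bigr => l _; rewrite /correct_connection; ring.
    ring.
  under eq_bigr do rewrite e.
  rewrite big_split /= -mulr_sumr big_split /= -mulr_sumr Euler_A //.
  have -> : \sum_(j < n) (j == i)%:R * T * A1 x j y = T * A1 x i y.
    rewrite (bigD1 i) //= eqxx mul1r big1 ?addr0 // => j /negbTE ->.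
    by rewrite !mul0r.
  by field; exact: m_neq0.
have [->|y0] := eqVneq y 0.
  have z k c : symk k.+1 c -> pform k.+1 c (crd (0 : 'rV[R]_n)) = 0.
    by move=> _ /=; apply: big1 => j _; rewrite /crd mxE mul0r.
  rewrite /dAform; have m1 : m = m.-1.+1 by lia.
  rewrite {1}m1 z; last by rewrite -m1; exact: sym_da'.
  rewrite big1 ?mulr0 // => j _; rewrite big1 ?mul0r // => l _.
  by rewrite mxE mulr0.
have An0 : A x y != 0 by rewrite gt_eqF // A_gt0.
have dB : is_derive y (basis_vec R i) (Bform m a Gam x)
    (dA x i y + m%:R * \sum_(k < n) y ord0 k * dA1 x i k y
     - m%:R * (2%:R * \sum_(j < n) (\sum_(l < n) Gam x j i l * y ord0 l) * A1 x j y
        + (m%:R - 1) * \sum_(j < n) spray Gam x y j * A2 x i j y)).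
  have H : is_derive y (basis_vec R i) (Bform m a Gam x)
     (\sum_(k < n) ((k == i)%:R * dA x k y + y ord0 k * (m%:R * dA1 x i k y))
      - m%:R * \sum_(j < n) ((2%:R * \sum_(l < n) Gam x j i l * y ord0 l) * A1 x j y
         + spray Gam x y j * (m.-1%:R * A2 x i j y))).
    apply: isd_sub.
      by apply: isd_sum => k _; apply: isd_mul; [exact: crd_partial|exact: dA_partial].
    apply: isd_mull; apply: isd_sum => j _; apply: isd_mul.
      exact: spray_partial.
    exact: A1_partial.
  apply: is_derive_eq H _; rewrite m1E.
  have q1 : \sum_(k < n) ((k == i)%:R * dA x k y + y ord0 k * (m%:R * dA1 x i k y))
      = dA x i y + m%:R * \sum_(k < n) y ord0 k * dA1 x i k y.
    rewrite big_split /=; congr (_ + _).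
      rewrite (bigD1 i) //= eqxx mul1r big1 ?addr0 // => k /negbTE ->.
      by rewrite mul0r.
    by rewrite mulr_sumr; apply: eq_bigr => k _; ring.
  rewrite q1; congr (_ - _ * _); rewrite big_split /=; congr (_ + _);
    by rewrite mulr_sumr; apply: eq_bigr => j _; ring.
have dT : is_derive y (basis_vec R i) (Bform m a Gam x)
    (th x i * A x y + T * (m%:R * A1 x i y)).
  have -> : Bform m a Gam x = fun y => (\sum_(i < n) th x i * y ord0 i) * A x y.
    by apply/funext => z; exact: BE.
  apply: isd_mul; last exact: A_partial.
  have H : is_derive y (basis_vec R i) (fun z : 'rV[R]_n => \sum_(j < n) th x j * z ord0 j)
     (\sum_(j < n) th x j * (j == i)%:R).
    by apply: isd_sum => j _; apply: isd_mull; exact: crd_partial.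
  apply: is_derive_eq H _; rewrite (bigD1 i) //= eqxx mulr1 big1 ?addr0 //.
  by move=> j /negbTE ->; rewrite mulr0.
have E := isd_unique dB dT.
have /(mulfI An0) r : A x y * (m%:R * \sum_(k < n) y ord0 k * dA1 x i k y
    - m%:R * (m%:R - 1) * (\sum_(j < n) spray Gam x y j * A2 x i j y) - dA x i y)
    = A x y * ((m%:R - 1) * (A1 x i y * T)).
  by rewrite (rap y i) BE -/T; ring.
rewrite corr; move: E r.
set s1 := \sum_(k < n) _; set s2 := \sum_(j < n) _; set s3 := \sum_(j < n) _.
move=> E r; apply: (@mulfI _ 2%:R); first by rewrite pnatr_eq0.
have -> : 2%:R * (m%:R * s2 + 2^-1 * (T * A1 x i y + th x i * A x y)) =
   2%:R * m%:R * s2 + T * A1 x i y + th x i * A x y by field.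
have e1 : th x i * A x y = dA x i y + m%:R * s1
     - m%:R * (2%:R * s2 + (m%:R - 1) * s3) - T * (m%:R * A1 x i y).
  by rewrite E; ring.
have e2 : m%:R * s1 = (m%:R - 1) * (A1 x i y * T) + m%:R * (m%:R - 1) * s3 + dA x i y.
  by rewrite -r; ring.
rewrite e1 e2; ring.
Qed.

(** Contracting the parallelism with y^k gives B = 0; differentiating it in the fibre and then
    contracting shows that the bracket of Rapcsak's equation vanishes too. *)
Lemma rapcsak_of_parallel Gam x y i : U x ->
  (forall j k l, Gam x j k l = Gam x j l k) -> parallel Gam x ->
  rapcsak m a Gam x y i.
Proof.
move=> Ux sG par.
have B0 : Bform m a Gam x y = 0.
  rewrite /Bform; under eq_bigr do rewrite par.
  apply/eqP; rewrite subr_eq0; apply/eqP.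
  rewrite mulr_sumr (eq_bigr (fun k => \sum_(j < n) m%:R * (\sum_(l < n)
    Gam x j k l * y ord0 k * y ord0 l * A1 x j y))).
    rewrite exchange_big; apply: eq_bigr => j _; rewrite -mulr_sumr /spray mulr_suml.
    by congr (_ * _); apply: eq_bigr => k _; rewrite mulr_suml.
  move=> k _; rewrite mulr_sumr mulr_sumr; apply: eq_bigr => j _.
  rewrite mulrCA; congr (_ * _); rewrite mulr_suml mulr_sumr.
  by apply: eq_bigr => l _; ring.
have dpar k : m%:R * dA1 x i k y = m%:R * (\sum_(j < n) Gam x j k i * A1 x j y
    + (m%:R - 1) * \sum_(j < n) (\sum_(l < n) Gam x j k l * y ord0 l) * A2 x i j y).
  have E : dA x k = fun y => m%:R * \sum_(j < n) (\sum_(l < n) Gam x j k l * y ord0 l) * A1 x j y.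
    by apply/funext => z; exact: par.
  have H1 := dA_partial y i k Ux; rewrite E in H1.
  have H2 : is_derive y (basis_vec R i)
     (fun y => m%:R * \sum_(j < n) (\sum_(l < n) Gam x j k l * y ord0 l) * A1 x j y)
     (m%:R * \sum_(j < n) ((\sum_(l < n) Gam x j k l * (l == i)%:R) * A1 x j y
       + (\sum_(l < n) Gam x j k l * y ord0 l) * (m.-1%:R * A2 x i j y))).
    apply: isd_mull; apply: isd_sum => j _; apply: isd_mul; last exact: A1_partial.
    by apply: isd_sum => l _; apply: isd_mull; exact: crd_partial.
  rewrite (isd_unique H1 H2) m1E big_split /=; congr (_ * (_ + _)).
    apply: eq_bigr => j _; congr (_ * _); rewrite (bigD1 i) //= eqxx mulr1 big1 ?addr0 //.
    by move=> l /negbTE ->; rewrite mulr0.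
  by rewrite mulr_sumr; apply: eq_bigr => j _; ring.
rewrite /rapcsak B0 !mulr0; apply/eqP; rewrite mulf_eq0; apply/orP; right; apply/eqP.
have -> : m%:R * \sum_(k < n) y ord0 k * dA1 x i k y =
    m%:R * \sum_(j < n) (\sum_(l < n) Gam x j i l * y ord0 l) * A1 x j y
    + m%:R * (m%:R - 1) * \sum_(j < n) spray Gam x y j * A2 x i j y.
  transitivity (\sum_(k < n) y ord0 k * (m%:R * dA1 x i k y)).
    by rewrite mulr_sumr; apply: eq_bigr => k _; ring.
  under eq_bigr do rewrite dpar.
  transitivity (m%:R * (\sum_(k < n) \sum_(j < n) y ord0 k * (Gam x j k i * A1 x j y))
     + m%:R * (m%:R - 1) * \sum_(k < n) \sum_(j < n)
         y ord0 k * ((\sum_(l < n) Gam x j k l * y ord0 l) * A2 x i j y)).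
    rewrite !mulr_sumr -big_split; apply: eq_bigr => k _ /=.
    by rewrite -!mulr_sumr; ring.
  congr (_ * _ + _ * _); rewrite exchange_big; apply: eq_bigr => j _ /=.
    rewrite mulr_suml; apply: eq_bigr => k _; rewrite (sG j k i); ring.
  rewrite /spray mulr_suml; apply: eq_bigr => k _.
  rewrite !mulr_suml mulr_sumr; apply: eq_bigr => l _; ring.
by rewrite par; ring.
Qed.

End RootMetric.

Lemma powR_step (R : realType) (b e : R) : 0 < b -> b `^ e = b * b `^ (e - 1).
Proof.
move=> b0; have {2}<- : b `^ 1 = b by rewrite powRr1 // ltW.
rewrite -powRD; first by congr (_ `^ _); ring.
by apply/implyP => _; rewrite gt_eqF.
Qed.

Lemma open_nonzero (R : realType) (V : normedModType R) :
  open [set z : V | z != 0].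
Proof.
have -> : [set z : V | z != 0] = (fun z : V => `|z|) @^-1` [set r : R | r != 0].
  by apply/seteqP; split=> z /=; rewrite normr_eq0.
apply: (@open_comp _ _ (fun z : V => `|z|)); last exact: open_neq.
by move=> z _; exact: norm_continuous.
Qed.

(** * Euler-Lagrange equations and geodesics of a connection *)

Section EulerLagrange.
Variables (R : realType) (n m : nat) (U : set 'rV[R]_n).
Variable a : 'rV[R]_n -> seq 'I_n -> R.
Implicit Types (x y u v z : 'rV[R]_n) (Gam : 'rV[R]_n -> 'I_n -> 'I_n -> 'I_n -> R).

Hypothesis oU : open U.
Hypothesis m2 : (2 <= m)%N.
Hypothesis smooth_a : forall I, size I = m -> smooth U (a ^~ I).
Hypothesis sym_a : forall x, U x -> symk m (a x).
Hypothesis A_gt0 : forall x y, U x -> y != 0 -> 0 < Aform m a x y.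

Local Notation A := (Aform m a).
Local Notation A1 := (Aform1 m a).
Local Notation A2 := (Aform2 m a).
Local Notation dA := (dAform m a).
Local Notation dA1 := (dAform1 m a).

(* The Euler-Lagrange expression of [A ^ (1/m)] on a curve with velocity [y]
   and acceleration [z], multiplied by [m / A ^ (1/m - 2)]. *)
Definition euler_lagrange x y z i : R :=
  A x y * (m%:R * \sum_(k < n) y ord0 k * dA1 x i k y
    + m%:R * (m%:R - 1) * (\sum_(j < n) z ord0 j * A2 x i j y) - dA x i y)
  - (m%:R - 1) * (A1 x i y * (\sum_(k < n) y ord0 k * dA x k y
    + m%:R * \sum_(j < n) z ord0 j * A1 x j y)).

Lemma form_along_curve k (c : 'rV[R]_n -> seq 'I_n -> R) (x y : R -> 'rV[R]_n) t x' y' :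
  (forall I, size I = k -> Ck U 1 (c ^~ I)) -> (forall w, U w -> symk k (c w)) ->
  U (x t) -> is_derive t 1 x x' -> is_derive t 1 y y' ->
  is_derive t 1 (fun s => pform k (c (x s)) (crd (y s)))
    (\sum_(l < n) x' ord0 l * pform k (fun I => da c (x t) I l) (crd (y t))
     + k%:R * \sum_(j < n) y' ord0 j
        * pform k.-1 (fun I => c (x t) (j :: I)) (crd (y t))).
Proof.
move=> Cc sc Ut dx /isd_mx dy; rewrite -pform_sum.
apply: (@pform_isd _ _ _ _ _ _ (fun s => c (x s)) _ (fun s => crd (y s)) (fun j => y' ord0 j)) => //.
- move=> I sI; have H := isd_comp oU (Cc I sI) Ut dx.
  by apply: is_derive_eq H _; apply: eq_bigr => l _; rewrite mulrC.
- exact: sc.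
Qed.

Lemma smooth1_a I : size I = m -> Ck U 1 (a ^~ I).
Proof. by move=> sI; exact: (smooth_a sI 1). Qed.

Lemma root_partial (F : 'rV[R]_n -> R) x y i : U x -> y != 0 ->
  (forall y, F y = A x y `^ (m%:R)^-1) ->
  partial i F y = A x y `^ ((m%:R)^-1 - 1) * A1 x i y.
Proof.
move=> Ux y0 FE; have -> : F = fun y => A x y `^ (m%:R)^-1 by apply/funext.
have H := isd_powR (m%:R)^-1 (A_gt0 Ux y0) (A_partial sym_a y i Ux).
rewrite /partial; have [_ ->] := H.
by field; exact: m_neq0.
Qed.

Lemma euler_lagrangeP (F : 'rV[R]_n -> 'rV[R]_n -> R) (T : set R)
    (x y : R -> 'rV[R]_n) t y' i :
  (forall x y, U x -> F x y = A x y `^ (m%:R)^-1) -> open T -> T t ->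
  (forall s, T s -> U (x s)) -> (forall s, T s -> is_derive s 1 x (y s)) ->
  (forall s, T s -> y s != 0) -> is_derive t 1 y y' ->
  (derive1 (fun s => partial i (F (x s)) (derive1 x s)) t
    = partial i (fun w => F w (derive1 x t)) (x t)) <->
  euler_lagrange (x t) (y t) y' i = 0.
Proof.
move=> FE oT Tt TU dx y0 dy; have Ut := TU t Tt.
have dxE s : T s -> derive1 x s = y s.
  by move=> Ts; rewrite derive1E; have [_ ->] := dx s Ts.
set r := (m%:R : R)^-1; set At := A (x t) (y t).
have At0 : 0 < At by apply: A_gt0 => //; exact: y0.
pose DA := \sum_(k < n) y t ord0 k * dA (x t) k (y t)
  + m%:R * \sum_(j < n) y' ord0 j * A1 (x t) j (y t).
pose DA1 := \sum_(k < n) y t ord0 k * dA1 (x t) i k (y t)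
  + (m%:R - 1) * \sum_(j < n) y' ord0 j * A2 (x t) i j (y t).
have dAt : is_derive t 1 (fun s => A (x s) (y s)) DA.
  exact: (form_along_curve smooth1_a sym_a Ut (dx t Tt) dy).
have dA1t : is_derive t 1 (fun s => A1 (x s) i (y s)) DA1.
  rewrite /DA1 -(m1E R m2).
  apply: (@form_along_curve m.-1 (fun w I => a w (i :: I)) x y t (y t) y') => //.
  - by move=> I sI; apply: smooth1_a; rewrite /= sI prednKm.
  - by move=> w Uw; exact: (sym_a1 m2 sym_a).
  - exact: dx.
have L : is_derive t 1 (fun s => partial i (F (x s)) (derive1 x s))
    ((r - 1) * At `^ (r - 1 - 1) * DA * A1 (x t) i (y t) + At `^ (r - 1) * DA1).
  apply: (@isd_near _ _ _ T (fun s => A (x s) (y s) `^ (r - 1) * A1 (x s) i (y s))) => //.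
    move=> s Ts; rewrite dxE //; apply/esym/root_partial; [exact: TU|exact: y0|].
    by move=> w; apply: FE; exact: TU.
  by apply: isd_mul => //; exact: isd_powR.
have K : is_derive (x t) (basis_vec R i) (fun w => F w (derive1 x t))
    (r * At `^ (r - 1) * dA (x t) i (y t)).
  rewrite dxE //.
  apply: (@isd_near _ _ _ U (fun w => A w (y t) `^ r)) => //.
    by move=> w Uw; apply/esym/FE.
  apply: isd_powR => //.
  have := @pform_isd R _ n (x t) (basis_vec R i) m a (fun I => da a (x t) I i)
    (fun _ => crd (y t)) (fun _ => 0).
  rewrite big1 ?mulr0 ?addr0; last by move=> j _; rewrite mul0r.
  apply; last exact: sym_a.
  by move=> I sI; exact: (Ck_derive _ (smooth1_a sI) Ut).
rewrite derive1E; have [_ ->] := L; rewrite /partial; have [_ ->] := K.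
have q0 : At `^ (r - 1 - 1) != 0 by rewrite gt_eqF // powR_gt0.
have qE := powR_step (r - 1) At0.
have mn := m_neq0 R m2.
have E : (r - 1) * At `^ (r - 1 - 1) * DA * A1 (x t) i (y t) + At `^ (r - 1) * DA1
    - r * At `^ (r - 1) * dA (x t) i (y t)
    = r * At `^ (r - 1 - 1) * euler_lagrange (x t) (y t) y' i.
  rewrite qE /euler_lagrange -/At -/DA /DA1 /r; field; exact: mn.
split=> H.
  move/eqP: H; rewrite -subr_eq0 E !mulf_eq0 invr_eq0 (negbTE mn) (negbTE q0) /=.
  by move/eqP.
by apply/eqP; rewrite -subr_eq0 E H mulr0.
Qed.

(** In affine parameter, the geodesics of Gam have minus the spray as acceleration. *)
Lemma rapcsak_euler_lagrange Gam x y i :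
  rapcsak m a Gam x y i <->
  euler_lagrange x y (- \row_j spray Gam x y j) i = 0.
Proof.
rewrite /rapcsak /euler_lagrange /Bform.
have -> : \sum_(j < n) (- \row_j0 spray Gam x y j0) ord0 j * A2 x i j y
   = - \sum_(j < n) spray Gam x y j * A2 x i j y.
  by rewrite -sumrN; apply: eq_bigr => j _; rewrite !mxE mulNr.
have -> : \sum_(j < n) (- \row_j0 spray Gam x y j0) ord0 j * A1 x j y
   = - \sum_(j < n) spray Gam x y j * A1 x j y.
  by rewrite -sumrN; apply: eq_bigr => j _; rewrite !mxE mulNr.
rewrite !mulrN; split=> [->|/eqP]; first by rewrite subrr.
by rewrite subr_eq0 => /eqP.
Qed.

Lemma euler_lagrange_shift x y z w i :
  euler_lagrange x y (z + w) i = euler_lagrange x y z i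
  + m%:R * (m%:R - 1) *
    \sum_(j < n) (A x y * A2 x i j y - A1 x i y * A1 x j y) * w ord0 j.
Proof.
rewrite /euler_lagrange.
have -> : \sum_(j < n) (z + w) ord0 j * A2 x i j y =
   \sum_(j < n) z ord0 j * A2 x i j y + \sum_(j < n) w ord0 j * A2 x i j y.
  by rewrite -big_split; apply: eq_bigr => j _; rewrite mxE mulrDl.
have -> : \sum_(j < n) (z + w) ord0 j * A1 x j y =
   \sum_(j < n) z ord0 j * A1 x j y + \sum_(j < n) w ord0 j * A1 x j y.
  by rewrite -big_split; apply: eq_bigr => j _; rewrite mxE mulrDl.
have -> : \sum_(j < n) (A x y * A2 x i j y - A1 x i y * A1 x j y) * w ord0 j =
   A x y * (\sum_(j < n) w ord0 j * A2 x i j y)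
   - A1 x i y * (\sum_(j < n) w ord0 j * A1 x j y).
  rewrite !mulr_sumr -sumrB; apply: eq_bigr => j _; ring.
ring.
Qed.

(** The matrix A A_ij - A_i A_j is, up to a positive factor, the fibre Hessian of A^(1/m), which is
    always degenerate along y; regularity asks for no further kernel. *)
Definition regular_at x : Prop := forall y v, y != 0 ->
  (forall i, \sum_(j < n) (A x y * A2 x i j y - A1 x i y * A1 x j y) * v ord0 j = 0) ->
  exists c, v = c *: y.

Lemma radial_kernel x y i :
  \sum_(j < n) (A x y * A2 x i j y - A1 x i y * A1 x j y) * y ord0 j = 0.
Proof.
transitivity (A x y * (\sum_(j < n) y ord0 j * A2 x i j y)
   - A1 x i y * (\sum_(j < n) y ord0 j * A1 x j y)).
  rewrite !mulr_sumr -sumrB; apply: eq_bigr => j _; ring.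
by rewrite Euler_A // Euler_A1 //; ring.
Qed.

(** The Euler-Lagrange expression is affine in the acceleration, vanishes at minus the spray, and
    has the radial line as kernel: the extremals are the geodesics of Gam in arbitrary
    parametrization. *)
Lemma euler_lagrange_geodesic Gam x y z : U x -> y != 0 ->
  regular_at x -> (forall i, rapcsak m a Gam x y i) ->
  (forall i, euler_lagrange x y z i = 0) <->
  exists c, z = c *: y - \row_j spray Gam x y j.
Proof.
move=> Ux y0 reg rap; set S := \row_j spray Gam x y j.
have mm : m%:R * (m%:R - 1) != 0 :> R.
  rewrite mulf_neq0 ?(m_neq0 R m2) // subr_eq0 -[1]/(1%:R) eqr_nat; lia.
have E i : euler_lagrange x y z i = m%:R * (m%:R - 1) *
    \sum_(j < n) (A x y * A2 x i j y - A1 x i y * A1 x j y) * (z + S) ord0 j.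
  have {1}-> : z = - S + (z + S) by rewrite addrC addrK.
  by rewrite euler_lagrange_shift (rapcsak_euler_lagrange Gam x y i).1 ?add0r.
split=> [H|[c zE] i].
  have [|c cE] := reg y (z + S) y0.
    by move=> i; move/eqP: (H i); rewrite E mulf_eq0 (negbTE mm) => /eqP.
  by exists c; rewrite -cE addrK.
rewrite E zE subrK; apply/eqP; rewrite mulf_eq0; apply/orP; right; apply/eqP.
transitivity (c * \sum_(j < n) (A x y * A2 x i j y - A1 x i y * A1 x j y) * y ord0 j).
  by rewrite mulr_sumr; apply: eq_bigr => j _; rewrite mxE; ring.
by rewrite radial_kernel // mulr0.
Qed.

Lemma root_hessian (F : 'rV[R]_n -> R) x y i j : U x -> y != 0 ->
  (forall y, F y = A x y `^ (m%:R)^-1) ->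
  2^-1 * partial i (partial j (fun z => F z ^+ 2)) y =
  A x y `^ (2 / m%:R - 2) * ((m%:R - 1) * (A x y * A2 x i j y - A1 x i y * A1 x j y)
    + A1 x i y * A1 x j y).
Proof.
move=> Ux y0 FE; have mn := m_neq0 R m2.
have -> : (fun z => F z ^+ 2) = fun z => A x z `^ (2 / m%:R).
  by apply/funext => z; rewrite FE -powR_mulrn ?powR_ge0 // -powRrM mulrC.
set r := 2 / m%:R.
have H1 z : z != 0 -> partial j (fun z => A x z `^ r) z = 2 * (A x z `^ (r - 1) * A1 x j z).
  move=> z0; have H := isd_powR r (A_gt0 Ux z0) (A_partial sym_a z j Ux).
  by rewrite /partial; have [_ ->] := H; rewrite /r; field.
have H2 : is_derive y (basis_vec R i) (partial j (fun z => A x z `^ r))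
   (2 * ((r - 1) * A x y `^ (r - 1 - 1) * (m%:R * A1 x i y) * A1 x j y
     + A x y `^ (r - 1) * (m.-1%:R * A2 x i j y))).
  apply: (@isd_near _ _ _ [set z : 'rV[R]_n | z != 0]
    (fun z => 2 * (A x z `^ (r - 1) * A1 x j z))) => //.
  - exact: open_nonzero.
  - by move=> z /= z0; rewrite H1.
  - apply: isd_mull; apply: isd_mul.
      by apply: isd_powR; [exact: A_gt0|exact: (A_partial sym_a _ _ Ux)].
    exact: (A1_partial m2 sym_a _ _ _ Ux).
rewrite {1}/partial; have [_ ->] := H2; rewrite m1E //.
have A0 := A_gt0 Ux y0.
rewrite (powR_step (r - 1) A0).
have -> : r - 1 - 1 = r - 2 by ring.
by rewrite /r; field.
Qed.

(** Subtracting c y from v, with c chosen to annihilate A_j v^j, leaves a vector on which both terms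
    of the fundamental tensor in [root_hessian] vanish, so it is 0 by positivity. *)
Lemma regular_of_posdef (F : 'rV[R]_n -> R) x : U x ->
  (forall y, F y = A x y `^ (m%:R)^-1) ->
  (forall y v, y != 0 -> v != 0 -> 0 < \sum_(i < n) \sum_(j < n)
     2^-1 * partial i (partial j (fun z => F z ^+ 2)) y * v ord0 i * v ord0 j) ->
  regular_at x.
Proof.
move=> Ux FE pd y v y0 Mv.
have A0 := A_gt0 Ux y0; have An0 : A x y != 0 by rewrite gt_eqF.
pose c := (\sum_(j < n) A1 x j y * v ord0 j) / A x y.
exists c; apply/eqP; rewrite -subr_eq0; apply/negPn/negP => w0.
have := pd y (v - c *: y) y0 w0; set w := v - c *: y.
have Mw i : \sum_(j < n) (A x y * A2 x i j y - A1 x i y * A1 x j y) * w ord0 j = 0.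
  transitivity (\sum_(j < n) (A x y * A2 x i j y - A1 x i y * A1 x j y) * v ord0 j
    - c * \sum_(j < n) (A x y * A2 x i j y - A1 x i y * A1 x j y) * y ord0 j).
    rewrite mulr_sumr -sumrB; apply: eq_bigr => j _; rewrite !mxE; ring.
  by rewrite Mv radial_kernel // mulr0 subr0.
have A1w : \sum_(j < n) A1 x j y * w ord0 j = 0.
  transitivity (\sum_(j < n) A1 x j y * v ord0 j - c * \sum_(j < n) y ord0 j * A1 x j y).
    rewrite mulr_sumr -sumrB; apply: eq_bigr => j _; rewrite !mxE; ring.
  by rewrite Euler_A // /c divfK // subrr.
rewrite big1 ?ltxx // => i _.
transitivity (A x y `^ (2 / m%:R - 2) * w ord0 i * ((m%:R - 1) *
  (\sum_(j < n) (A x y * A2 x i j y - A1 x i y * A1 x j y) * w ord0 j)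
   + A1 x i y * (\sum_(j < n) A1 x j y * w ord0 j))).
  rewrite mulrDr !mulr_sumr -big_split; apply: eq_bigr => j _ /=.
  by rewrite (root_hessian i j Ux y0 FE); ring.
by rewrite Mw A1w !mulr0 addr0 mulr0.
Qed.

End EulerLagrange.

(** * Loewner ellipsoids *)

Section SimultaneousDiagonalization.
Variables (C : numClosedFieldType) (n : nat).
Implicit Types (h W : 'M[C]_n).

Local Notation "M ^*t" := (map_mx (@Num.conj C) M^T) (at level 2).

(** The complex setting is that of the spectral theorem for normal matrices; real forms enter it
    through [posdef_complex]. *)
Definition posdef_herm h : Prop := h ^*t = h /\
  forall z : 'rV[C]_n, z != 0 -> 0 < (z *m h *m z ^*t) ord0 ord0.

Lemma ctr_mul p q r (A : 'M[C]_(p, q)) (B : 'M[C]_(q, r)) :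
  (A *m B) ^*t = B ^*t *m A ^*t.
Proof. by rewrite trmx_mul map_mxM. Qed.

Lemma ctrK p q (A : 'M[C]_(p, q)) : (A ^*t) ^*t = A.
Proof. by apply/matrixP => i j; rewrite !mxE conjCK. Qed.

Lemma herm_diag h : h ^*t = h ->
  exists W (d : 'rV[C]_n), [/\ W \in unitmx, W *m W ^*t = 1%:M &
    W *m h *m W ^*t = diag_mx d].
Proof.
move=> hh; have hn : h \is normalmx by apply/normalmxP; rewrite hh.
have /orthomx_spectralP hE := hn.
have /unitarymxP PP := spectral_unitarymx h.
exists (spectralmx h), (spectral_diag h); split => //; first exact: spectral_unit.
rewrite {2}hE (invmx_unitary (spectral_unitarymx h)).
by rewrite !mulmxA PP mul1mx -mulmxA PP mulmx1.
Qed.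

Lemma posdef_herm_congr h W : W \in unitmx -> posdef_herm h ->
  posdef_herm (W *m h *m W ^*t).
Proof.
move=> uW [hh hp]; split.
  by rewrite !ctr_mul ctrK hh mulmxA.
move=> z z0; have zW0 : z *m W != 0.
  apply: contraNneq z0 => zW; by rewrite -[z](mulmxK uW) zW mul0mx.
have := hp _ zW0; by rewrite ctr_mul !mulmxA.
Qed.

Lemma posdef_diag (d : 'rV[C]_n) i : posdef_herm (diag_mx d) -> 0 < d ord0 i.
Proof.
move=> [_ hp]; have := hp (delta_mx ord0 i).
have e0 : delta_mx ord0 i != 0 :> 'rV[C]_n.
  by apply/eqP => /rowP /(_ i); rewrite !mxE !eqxx; apply/eqP; rewrite oner_eq0.
move=> /(_ e0); rewrite mul_mx_diag mxE (bigD1 i) //= !mxE !eqxx /=.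
rewrite conjC1 mul1r mulr1 big1 ?addr0 // => j ji.
by rewrite !mxE (negbTE ji) andbF mul0r mul0r.
Qed.

Lemma posdef_herm_normalize h : posdef_herm h ->
  exists2 W, W \in unitmx & W *m h *m W ^*t = 1%:M.
Proof.
move=> ph; have [U [d [uU _ UE]]] := herm_diag ph.1.
have d0 i : 0 < d ord0 i.
  by apply: posdef_diag; rewrite -UE; exact: posdef_herm_congr.
pose s : 'rV[C]_n := \row_i (sqrtC (d ord0 i))^-1.
have s0 i : 0 < s ord0 i by rewrite mxE invr_gt0 sqrtC_gt0.
exists (diag_mx s *m U).
  rewrite unitmx_mul uU andbT unitmxE det_diag unitfE.
  by apply/prodf_neq0 => i _; rewrite gt_eqF.
have sc : (diag_mx s) ^*t = diag_mx s.
  rewrite tr_diag_mx map_diag_mx; congr diag_mx; apply/rowP => i; rewrite mxE.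
  by apply: CrealP; exact: gtr0_real.
rewrite ctr_mul sc -!mulmxA (mulmxA h) (mulmxA U) (mulmxA U) UE.
rewrite mul_diag_mx; apply/matrixP => i j; rewrite mxE mul_mx_diag !mxE.
have [->|ij] := eqVneq i j; last by rewrite mulr0n mul0r mulr0.
have q0 : sqrtC (d ord0 j) != 0 by rewrite gt_eqF // sqrtC_gt0.
rewrite !mulr1n; have {2}-> : d ord0 j = sqrtC (d ord0 j) ^+ 2 by rewrite sqrtCK.
by field.
Qed.

Lemma simultaneous_diag h0 h1 : posdef_herm h0 -> posdef_herm h1 ->
  exists W (d : 'rV[C]_n), [/\ W \in unitmx, W *m h0 *m W ^*t = 1%:M,
    W *m h1 *m W ^*t = diag_mx d & forall i, 0 < d ord0 i].
Proof.
move=> p0 p1; have [W0 u0 E0] := posdef_herm_normalize p0.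
have q1 := posdef_herm_congr u0 p1.
have [U [d [uU UU UE]]] := herm_diag q1.1.
exists (U *m W0), d; split.
- by rewrite unitmx_mul uU.
- by rewrite ctr_mul !mulmxA -(mulmxA U) -(mulmxA U) E0 mulmx1 UU.
- by rewrite ctr_mul -UE !mulmxA.
- by move=> i; apply: posdef_diag; rewrite -UE; exact: posdef_herm_congr.
Qed.

(* By simultaneous diagonalization this is the inequality between the
   arithmetic and the geometric mean, with its equality case. *)
Lemma det_sum_posdef h0 h1 : posdef_herm h0 -> posdef_herm h1 ->
  \det h0 = \det h1 -> \det (h0 + h1) <= 2 ^+ n * \det h0 -> h0 = h1.
Proof.
move=> p0 p1 dE dle; have [W [d [uW E0 E1 d0]]] := simultaneous_diag p0 p1.
pose w := \det W * \det (W ^*t).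
have dW h : \det (W *m h *m W ^*t) = w * \det h.
  by rewrite !det_mulmx /w mulrAC.
have w1 : w * \det h0 = 1 by rewrite -dW E0 det1.
have w0 : 0 < w.
  have -> : w = `|\det W| ^+ 2.
    by rewrite normCK /w; congr (_ * _); rewrite det_map_mx det_tr.
  by rewrite exprn_gt0 // normr_gt0 -unitfE -unitmxE.
have pd : \prod_(i < n) d ord0 i = 1.
  by rewrite -det_diag -E1 dW -dE.
have ps : \prod_(i < n) (1 + d ord0 i) <= 2 ^+ n.
  have -> : \prod_(i < n) (1 + d ord0 i) = \det (W *m (h0 + h1) *m W ^*t).
    rewrite mulmxDr mulmxDl E0 E1 -(@diag_const_mx _ n 1) -raddfD det_diag.
    by apply: eq_bigr => i _; rewrite !mxE.
  have -> : 2 ^+ n = w * (2 ^+ n * \det h0) by rewrite mulrCA w1 mulr1.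
  by rewrite dW ler_pM2l.
(* The squared ratio of arithmetic to geometric mean of 1 and d_i. Each factor is at least 1 and the
   product at most 1, so all are equal to 1. *)
pose f i := (1 + d ord0 i) ^+ 2 / (4 * d ord0 i).
have f1 i : 1 <= f i.
  rewrite /f ler_pdivlMr ?mulr_gt0 // mul1r -subr_ge0.
  have -> : (1 + d ord0 i) ^+ 2 - 4 * d ord0 i = (1 - d ord0 i) ^+ 2 by ring.
  apply: real_exprn_even_ge0 => //.
  by rewrite realB ?real1 // gtr0_real.
have pf : \prod_(i < n) f i <= 1.
  have -> : \prod_(i < n) f i = (\prod_(i < n) (1 + d ord0 i)) ^+ 2 / 4 ^+ n.
    have -> : 4 ^+ n = \prod_(i < n) (4 * d ord0 i) :> C.
      by rewrite big_split /= pd mulr1 prodr_const card_ord.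
    by rewrite prodf_div prodrXl.
  rewrite ler_pdivrMr ?exprn_gt0 // mul1r.
  have -> : 4 ^+ n = (2 ^+ n) ^+ 2 :> C.
    by rewrite -exprM mulnC exprM; congr (_ ^+ _); rewrite expr2 -natrM.
  rewrite lerXn2r ?nnegrE ?exprn_ge0 //.
  by apply: prodr_ge0 => i _; rewrite addr_ge0 // ltW.
have fi i : f i = 1.
  apply/eqP; rewrite eq_le f1 andbT; apply: le_trans pf.
  rewrite (bigD1 i) //= ler_peMr //; first exact: le_trans ler01 (f1 i).
  by elim/big_ind: _ => // x y x1 y1; exact: mulr_ege1.
have di i : d ord0 i = 1.
  have d4 : 4 * d ord0 i != 0 by rewrite mulf_neq0 // gt_eqF.
  have /eqP := fi i; rewrite /f (can2_eq (divfK d4) (mulfK d4)) mul1r -subr_eq0.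
  have -> : (1 + d ord0 i) ^+ 2 - 4 * d ord0 i = (1 - d ord0 i) ^+ 2 by ring.
  by rewrite sqrf_eq0 subr_eq0 => /eqP.
have E01 : W *m h0 *m W ^*t = W *m h1 *m W ^*t.
  by rewrite E0 E1; apply/matrixP => i j; rewrite !mxE di.
have uW' : W ^*t \in unitmx by rewrite unitmxE det_map_mx det_tr rmorph_unit // -unitmxE.
have := congr1 (mulmxr (invmx (W ^*t))) E01; rewrite /= !mulmxK //.
by move/(congr1 (mulmx (invmx W))); rewrite !mulKmx.
Qed.

End SimultaneousDiagonalization.

Section CkDeterminant.
Variable R : realType.

Lemma Ck_det (V : normedModType R) n (W : set V) k (M : V -> 'M[R]_n) : open W ->
  (forall i j, Ck W k (fun x => M x i j)) -> Ck W k (fun x => \det (M x)).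
Proof.
move=> oW CM; rewrite /determinant; apply: Ck_sum => // s _.
by apply: Ck_mull => //; apply: Ck_prod.
Qed.

Lemma Ck_adj (V : normedModType R) n (W : set V) k (M : V -> 'M[R]_n) i j : open W ->
  (forall i j, Ck W k (fun x => M x i j)) -> Ck W k (fun x => (\adj (M x)) i j).
Proof.
move=> oW CM.
apply: (@Ck_eq _ _ _ _ _ (fun x => (-1) ^+ (j + i) * \det (row' j (col' i (M x))))) => //.
  by move=> x _; rewrite mxE.
apply: Ck_mull => //; apply: Ck_det => // a b.
by apply: (Ck_eq oW _ (CM (lift j a) (lift i b))) => x _; rewrite !mxE.
Qed.

Lemma Ck_inv_mx (V : normedModType R) n (W : set V) k (M : V -> 'M[R]_n) i j : open W ->
  (forall x, W x -> M x \in unitmx) ->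
  (forall i j, Ck W k (fun x => M x i j)) -> Ck W k (fun x => (invmx (M x)) i j).
Proof.
move=> oW uM CM.
apply: (@Ck_eq _ _ _ _ _ (fun x => (\det (M x))^-1 * (\adj (M x)) i j)) => //.
  by move=> x Wx; rewrite /invmx uM // [RHS]mxE.
apply: Ck_mul => //; last exact: Ck_adj.
apply: (Ck_inv oW); last exact: Ck_det.
by move=> x Wx; rewrite -unitfE -unitmxE uM.
Qed.

End CkDeterminant.

Section QuadraticForms.
Variables (R : realType) (n : nat).
Implicit Types (H J : 'M[R]_n) (y z : 'rV[R]_n) (f : 'rV[R]_n -> R).

Definition qf H y : R := \sum_(i < n) \sum_(j < n) H i j * y ord0 i * y ord0 j.

Lemma qfE H y : qf H y = (y *m H *m y^T) ord0 ord0.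
Proof.
rewrite mxE /qf exchange_big; apply: eq_bigr => j _.
by rewrite !mxE mulr_suml; apply: eq_bigr => i _; rewrite (mulrC (H i j)).
Qed.

Lemma qf_congr H J y : qf (J *m H *m J^T) y = qf H (y *m J).
Proof. by rewrite !qfE trmx_mul !mulmxA. Qed.

Lemma qf_scale H y c : qf H (c *: y) = c ^+ 2 * qf H y.
Proof.
rewrite /qf mulr_sumr; apply: eq_bigr => i _; rewrite mulr_sumr.
by apply: eq_bigr => j _; rewrite !mxE; ring.
Qed.

Lemma qf0 H : qf H 0 = 0.
Proof.
by apply: big1 => i _; apply: big1 => j _; rewrite !mxE mulr0.
Qed.

Lemma qfDl H H' y : qf (H + H') y = qf H y + qf H' y.
Proof.
rewrite /qf -big_split; apply: eq_bigr => i _; rewrite -big_split.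
by apply: eq_bigr => j _ /=; rewrite mxE; ring.
Qed.

Lemma qfZl H y c : qf (c *: H) y = c * qf H y.
Proof.
rewrite /qf mulr_sumr; apply: eq_bigr => i _; rewrite mulr_sumr.
by apply: eq_bigr => j _; rewrite mxE; ring.
Qed.

Definition bf H y z : R := (y *m H *m z^T) ord0 ord0.

Lemma bf_sym H y z : H^T = H -> bf H z y = bf H y z.
Proof.
move=> sH; rewrite /bf; transitivity ((z *m H *m y^T)^T ord0 ord0).
  by rewrite [RHS]mxE.
by rewrite !trmx_mul trmxK sH mulmxA.
Qed.

Lemma qfD H y z : H^T = H -> qf H (y + z) = qf H y + 2 * bf H y z + qf H z.
Proof.
move=> sH; rewrite !qfE -!/(bf H _ _).
have -> : bf H (y + z) (y + z) = bf H y y + bf H y z + (bf H z y + bf H z z).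
  by rewrite /bf raddfD /= !mulmxDl !mulmxDr !mxE; ring.
by rewrite (bf_sym z y sH); ring.
Qed.

Lemma bfZr H y z c : bf H y (c *: z) = c * bf H y z.
Proof. by rewrite /bf linearZ -scalemxAr mxE. Qed.

Lemma psd_kernel H y : H^T = H -> (forall z, 0 <= qf H z) -> qf H y = 0 ->
  y *m H = 0.
Proof.
move=> sH psd y0.
have bz z : bf H y z = 0.
  (* This t gives the form the value -1 at z + t y. *)
  apply/eqP/negPn/negP => b0; pose t := - ((qf H z + 1) / (2 * bf H y z)).
  have := psd (z + t *: y); rewrite qfD // bfZr qf_scale y0 mulr0 addr0 bf_sym //.
  have -> : 2 * (t * bf H y z) = - (qf H z + 1) by rewrite /t; field.
  by lra.
apply/rowP => i; have := bz (delta_mx ord0 i).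
by rewrite /bf trmx_delta -colE !mxE.
Qed.

Lemma psd_det_pd H : H^T = H -> (forall z, 0 <= qf H z) -> \det H != 0 ->
  forall y, y != 0 -> 0 < qf H y.
Proof.
move=> sH psd d0 y y0; rewrite lt_neqAle psd andbT eq_sym.
apply: contraNneq y0 => /(psd_kernel sH psd) yH.
have uH : H \in unitmx by rewrite unitmxE unitfE.
by rewrite -[y](mulmxK uH) yH mul0mx.
Qed.

Lemma pd_unitmx H : (forall y, y != 0 -> 0 < qf H y) -> H \in unitmx.
Proof.
move=> pd; rewrite -row_free_unit -kermx_eq0; apply/negPn/negP => k0.
have /rowV0Pn[v /sub_kermxP vH v0] := k0.
by have := pd v v0; rewrite qfE vH mul0mx mxE ltxx.
Qed.

(** For z = x + i y the Hermitian form is the sum of the real forms at x and y, the cross terms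
    cancelling by symmetry. *)
Lemma posdef_complex H : H^T = H -> (forall y, y != 0 -> 0 < qf H y) ->
  posdef_herm (map_mx (real_complex R) H).
Proof.
move=> sH pd; set h := map_mx _ H.
have conjf (x : R) : (real_complex R x)^* = real_complex R x.
  by apply: conj_Creal; apply/complex_realP; exists x.
have conji : ('i%C : R[i])^* = - 'i%C.
  by apply/eqP; rewrite eq_complex /= oppr0 !eqxx.
split; first by apply/matrixP => i j; rewrite !mxE conjf -[in RHS]sH mxE.
move=> z z0; pose x : 'rV[R]_n := map_mx (@complex.Re R) z.
pose y : 'rV[R]_n := map_mx (@complex.Im R) z.
pose f := real_complex R.
have zE i : z ord0 i = f (x ord0 i) + 'i%C * f (y ord0 i).
  by rewrite !mxE; exact: complexE.
have zC j : (z ord0 j)^* = f (x ord0 j) - 'i%C * f (y ord0 j).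
  by rewrite zE; apply/eqP; rewrite eq_complex /= /f /=; simpc.
have E : (z *m h *m (map_mx (@Num.conj _) z^T)) ord0 ord0 = f (qf H x + qf H y).
  have e1 : (z *m h *m (map_mx (@Num.conj _) z^T)) ord0 ord0 =
      \sum_(i < n) \sum_(j < n) f (H i j) * z ord0 i * (z ord0 j)^*.
    rewrite mxE exchange_big; apply: eq_bigr => j _.
    rewrite !mxE mulr_suml; apply: eq_bigr => i _; rewrite !mxE.
    by rewrite (mulrC (z ord0 i)).
  rewrite e1.
  have e2 : \sum_(i < n) \sum_(j < n) f (H i j) * z ord0 i * (z ord0 j)^* =
    \sum_(i < n) \sum_(j < n) (f (H i j * x ord0 i * x ord0 j)
       + f (H i j * y ord0 i * y ord0 j))
    + 'i%C * (\sum_(i < n) \sum_(j < n) f (H i j * y ord0 i * x ord0 j)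
       - \sum_(i < n) \sum_(j < n) f (H i j * x ord0 i * y ord0 j)).
    rewrite -sumrB mulr_sumr -big_split; apply: eq_bigr => i _ /=.
    rewrite -sumrB mulr_sumr -big_split; apply: eq_bigr => j _ /=.
    rewrite zC zE /f !rmorphM /= -/f.
    set hij := f _; set a := f _; set b := f _; set c := f _; set d := f _.
    have i2 : 'i%C * 'i%C = -1 :> R[i] by rewrite -expr2 sqr_i.
    transitivity (hij * a * c - ('i%C * 'i%C) * (hij * b * d) +
      'i%C * (hij * b * c - hij * a * d)); first by ring.
    by rewrite i2; ring.
  rewrite e2 [X in _ - X]exchange_big /=.
  have -> : \sum_(i < n) \sum_(j < n) f (H i j * y ord0 i * x ord0 j) =
     \sum_(j < n) \sum_(i < n) f (H i j * x ord0 i * y ord0 j).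
    apply: eq_bigr => i _; apply: eq_bigr => j _.
    by rewrite -[in LHS]sH mxE; congr f; ring.
  rewrite subrr mulr0 addr0 /f rmorphD /= !rmorph_sum -big_split /=.
  apply: eq_bigr => i _; rewrite !rmorph_sum -big_split /=.
  by apply: eq_bigr.
rewrite E ltcR.
have psd w : 0 <= qf H w.
  have [->|w0] := eqVneq w 0; first by rewrite qf0.
  exact: ltW (pd w w0).
have [x0|x0] := eqVneq x 0; last by rewrite ltr_pwDl // pd.
rewrite ltr_wpDl //; apply: pd; apply: contraNneq z0 => y0.
apply/eqP/rowP => i; rewrite zE x0 y0 !mxE /f !rmorph0 mulr0 addr0 //.
Qed.

End QuadraticForms.

Section Loewner.
Variables (R : realType) (n : nat).
Implicit Types (H J : 'M[R]_n) (y z : 'rV[R]_n) (f : 'rV[R]_n -> R).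

Definition dominated f H : Prop :=
  [/\ H^T = H, forall y, 0 <= qf H y & forall y, qf H y <= f y].

(* The unit ball of a Loewner form of [f] is the ellipsoid of least volume
   containing the unit ball of [f]. *)
Definition loewner f H : Prop :=
  dominated f H /\ forall H', dominated f H' -> \det H' <= \det H.

(** The mean of two maximizers is again dominated, so its determinant is no larger than theirs; this
    is the equality case of [det_sum_posdef]. *)
Lemma loewner_unique f H H' : 0 < \det H -> loewner f H -> loewner f H' -> H = H'.
Proof.
move=> d0 [[sH pH fH] mH] [[sH' pH' fH'] mH'].
have dE : \det H' = \det H.
  by apply/eqP; rewrite eq_le mH' ?mH //; split.
have dH : \det H != 0 by rewrite gt_eqF.
have dH' : \det H' != 0 by rewrite dE.
have pdH := posdef_complex sH (psd_det_pd sH pH dH).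
have pdH' := posdef_complex sH' (psd_det_pd sH' pH' dH').
have mid : dominated f (2^-1 *: (H + H')).
  split; first by rewrite linearZ linearD /= sH sH'.
    by move=> y; rewrite qfZl qfDl mulr_ge0 // addr_ge0.
  move=> y; rewrite qfZl qfDl; have := fH y; have := fH' y; lra.
have := mH _ mid; rewrite detZ => dle.
have : map_mx (real_complex R) H = map_mx (real_complex R) H'.
  apply: det_sum_posdef => //; first by rewrite !det_map_mx dE.
  rewrite -map_mxD !det_map_mx.
  have -> : (2 : R[i]) = real_complex R 2 by rewrite rmorph_nat.
  rewrite -rmorphXn -rmorphM lecR.
  by rewrite -(@ler_pM2l _ (2^-1 ^+ n)) ?exprn_gt0 // mulrA -exprMn mulVf // expr1n mul1r.
by move=> /matrixP E; apply/matrixP => i j; have := E i j; rewrite !mxE => -[].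
Qed.

Lemma dominated_congr f H J : J \in unitmx ->
  dominated f H <-> dominated (fun y => f (y *m J)) (J *m H *m J^T).
Proof.
move=> uJ; split=> -[sH pH fH]; split.
- by rewrite !trmx_mul trmxK sH mulmxA.
- by move=> y; rewrite qf_congr.
- by move=> y; rewrite qf_congr.
- have uJ' : J^T \in unitmx by rewrite unitmx_tr.
  have := sH; rewrite !trmx_mul trmxK mulmxA.
  move=> /(congr1 (mulmxr (invmx J^T))); rewrite /= !mulmxK //.
  by move=> /(congr1 (mulmx (invmx J))); rewrite !mulKmx.
- by move=> y; rewrite -[y](mulmxKV uJ) -qf_congr; exact: pH.
- by move=> y; rewrite -[y](mulmxKV uJ) -qf_congr; exact: fH.
Qed.

(** A linear change of variables multiplies all the determinants by the same factor (det J)^2, so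
    maximizers correspond. *)
Lemma loewner_congr f H J : J \in unitmx -> loewner f H ->
  loewner (fun y => f (y *m J)) (J *m H *m J^T).
Proof.
move=> uJ [dH mH]; split; first exact: (dominated_congr f H uJ).1.
move=> H' dH'.
have uJi : invmx J \in unitmx by rewrite unitmx_inv.
have [H0 H'E] : exists H0, H' = J *m H0 *m J^T.
  exists (invmx J *m H' *m (invmx J)^T).
  by rewrite !mulmxA mulmxV // mul1mx -mulmxA -trmx_mul mulmxV // trmx1 mulmx1.
have dH0 : dominated f H0.
  by apply: (dominated_congr f H0 uJ).2; rewrite -H'E.
have dE A : \det (J *m A *m J^T) = \det J ^+ 2 * \det A.
  by rewrite !det_mulmx det_tr; ring.
by rewrite H'E !dE ler_wpM2l ?sqr_ge0 // mH.
Qed.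

Lemma loewner_pd f H : 0 < \det H -> loewner f H ->
  forall y, y != 0 -> 0 < qf H y.
Proof.
by move=> d0 [[sH pH _] _]; apply: psd_det_pd => //; rewrite gt_eqF.
Qed.

(** Positivity at e_i + e_j and e_i - e_j bounds 2 |H_ij| by H_ii + H_jj. The bound serves twice:
    for the compactness of the set of dominated forms and for the continuity of the Loewner form in
    x. *)
Lemma dominated_entry f H i j : dominated f H ->
  `|H i j| <= \sum_(k < n) f (basis_vec R k).
Proof.
move=> [sH pH fH].
have bE k l : bf H (basis_vec R k) (basis_vec R l) = H k l.
  by rewrite /bf /basis_vec trmx_delta -rowE -colE !mxE.
have qE k : qf H (basis_vec R k) = H k k by rewrite qfE -/(bf H _ _) bE.
have f0 k : 0 <= f (basis_vec R k) := le_trans (pH _) (fH _).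
have fS k : H k k <= \sum_(l < n) f (basis_vec R l).
  rewrite -qE (bigD1 k) //=; apply: le_trans (fH _) _.
  by rewrite lerDl sumr_ge0.
have h1 := pH (basis_vec R i + basis_vec R j).
have h2 := pH (basis_vec R i + -1 *: basis_vec R j).
rewrite qfD // bE !qE in h1.
rewrite qfD // bfZr bE qf_scale !qE in h2.
have := fS i; have := fS j; rewrite ler_norml.
move: h2; rewrite sqrrN expr1n mul1r mulN1r => h2 fi fj.
by apply/andP; split; lra.
Qed.

(** The determinant attains a maximum on the compact set of dominated forms; the maximum is positive
    because a small multiple of the identity is dominated. *)
Lemma loewner_exists f : continuous f -> (forall y, y != 0 -> 0 < f y) ->
  (forall c y, f (c *: y) = c ^+ 2 * f y) ->
  exists2 H, loewner f H & 0 < \det H.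
Proof.
move=> cf f0 fZ.
have f00 : f 0 = 0 by rewrite -(scale0r (0 : 'rV[R]_n)) fZ expr0n mul0r.
have [e e0 eP] : exists2 e : R, 0 < e & forall y, e * (\sum_(i < n) y ord0 i ^+ 2) <= f y.
  (* For n = 0 there is no unit sphere to minimize on, and e = 1 will do. *)
  have [[v v0]|nv] := pselect (exists v : 'rV[R]_n, v != 0); last first.
    exists 1 => // y; have [->|y0] := eqVneq y 0; last by exfalso; apply: nv; exists y.
    by rewrite f00 big1 ?mulr0 // => i _; rewrite mxE expr0n.
  pose K := [set y : 'rV[R]_n | `|y| = 1].
  have nrm (y : 'rV[R]_n) : y != 0 -> K (`|y|^-1 *: y).
    by move=> y0; rewrite /K /= normrZ normfV normr_id mulVf // normr_eq0.
  have cK : compact K.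
    apply: bounded_closed_compact.
      exists 1; split; first exact: real1.
      by move=> M M1 y /= ->; exact: ltW.
    have -> : K = (fun y : 'rV[R]_n => `|y|) @^-1` [set 1] by [].
    apply: closed_comp; first by move=> y _; exact: norm_continuous.
    exact: closed_eq.
  have [c Kc cmin] := EVT_min_rV (ex_intro _ _ (nrm v v0)) cK (continuous_subspaceT cf).
  have c0 : 0 < f c.
    apply: f0; apply/eqP => c0; move: Kc; rewrite inE /K /= c0 normr0 => /esym/eqP.
    by rewrite oner_eq0.
  (* Here f c is the minimum of f on the unit sphere of the maximum norm, whose square times n
     bounds the sum of squares; n + 1 is used to have a visibly positive denominator. *)
  exists (f c / (n%:R + 1)); first by rewrite divr_gt0 // ltr_wpDl.
  move=> y; have [->|y0] := eqVneq y 0.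
    by rewrite f00 big1 ?mulr0 // => i _; rewrite mxE expr0n.
  have yn0 : `|y| != 0 by rewrite normr_eq0.
  have -> : f y = `|y| ^+ 2 * f (`|y|^-1 *: y).
    by rewrite fZ mulrA -exprMn mulfV // expr1n mul1r.
  have le1 : \sum_(i < n) y ord0 i ^+ 2 <= (n%:R + 1) * `|y| ^+ 2.
    apply: (@le_trans _ _ (\sum_(i < n) `|y| ^+ 2)).
      apply: ler_sum => i _; rewrite -real_normK ?num_real // lerXn2r ?nnegrE //.
      exact: mx_coord_le.
    rewrite sumr_const card_ord -[X in X <= _]mulr_natl.
    by apply: ler_wpM2r; [exact: sqr_ge0|rewrite lerDl].
  have n1 : 0 < n%:R + 1 :> R by rewrite ltr_wpDl.
  apply: (@le_trans _ _ (f c * `|y| ^+ 2)).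
    have -> : f c * `|y| ^+ 2 = f c / (n%:R + 1) * ((n%:R + 1) * `|y| ^+ 2).
      by field; rewrite gt_eqF.
    by rewrite ler_wpM2l // ltW // divr_gt0.
  rewrite mulrC ler_wpM2l ?sqr_ge0 //; apply: cmin; rewrite inE; exact: nrm.
(* Matrices are flattened to row vectors, where closed bounded sets are compact. *)
pose S := [set w : 'rV[R]_(n * n) | dominated f (vec_mx w)].
have cvec i j : continuous (fun w : 'rV[R]_(n * n) => (vec_mx w : 'M[R]_n) i j).
  have -> : (fun w : 'rV[R]_(n * n) => (vec_mx w : 'M[R]_n) i j)
    = fun w => w ord0 (mxvec_index i j) by apply/funext => w; rewrite mxE.
  exact: continuous_coord.
have cqf y : continuous (fun w : 'rV[R]_(n * n) => qf (vec_mx w) y).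
  move=> w; apply: (@Ck_cont _ _ _ setT 0) => //.
  have oT : open [set: 'rV[R]_(n * n)] by exact: openT.
  apply: (Ck_sum _ oT) => i _; apply: (Ck_sum _ oT) => j _.
  apply: (Ck_mul oT _ (Ck_cst 0 (y ord0 j) oT)).
  apply: (Ck_mul oT _ (Ck_cst 0 (y ord0 i) oT)).
  by split=> // z _; exact: cvec.
have cS : closed S.
  have -> : S = (\bigcap_(ij in [set: 'I_n * 'I_n])
       [set w | (vec_mx w : 'M[R]_n) ij.1 ij.2 - (vec_mx w : 'M[R]_n) ij.2 ij.1 = 0])
     `&` ((\bigcap_(y in [set: 'rV[R]_n]) [set w | 0 <= qf (vec_mx w) y])
     `&` (\bigcap_(y in [set: 'rV[R]_n]) [set w | qf (vec_mx w) y <= f y])).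
    apply/seteqP; split=> w /=.
      move=> [s p q]; split; last by split=> y _ /=; [exact: p|exact: q].
      by move=> [i j] _ /=; rewrite -[in X in X - _]s mxE subrr.
    move=> [s [p q]]; split=> [|y|y]; [|exact: (p y I)|exact: (q y I)].
    by apply/matrixP => i j; rewrite mxE; apply/eqP; rewrite -subr_eq0; apply/eqP; exact: (s (j, i) I).
  apply: closedI; [|apply: closedI]; apply: closed_bigI.
  - move=> [i j] _ /=.
    apply: (@closed_comp _ _ (fun w : 'rV[R]_(n * n) => (vec_mx w : 'M[R]_n) i j - (vec_mx w : 'M[R]_n) j i) [set 0]).
      by move=> w _; exact: (cvgB (cvec i j w) (cvec j i w)).
    exact: closed_eq.
  - move=> y _; apply: (@closed_comp _ _ (fun w : 'rV[R]_(n * n) => qf (vec_mx w) y) [set r | 0 <= r]).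
      by move=> w _; exact: cqf.
    exact: closed_ge.
  - move=> y _; apply: (@closed_comp _ _ (fun w : 'rV[R]_(n * n) => qf (vec_mx w) y) [set r | r <= f y]).
      by move=> w _; exact: cqf.
    exact: closed_le.
have bS : bounded_set S.
  exists (\sum_(k < n) f (basis_vec R k)); split; first exact: num_real.
  move=> M /ltW SM w /= dw; apply: le_trans SM.
  apply: mx_norm_le.
    apply: sumr_ge0 => k _; have [_ p q] := dw; exact: le_trans (p _) (q _).
  move=> i k; rewrite (ord1 i); case/mxvec_indexP: k => a b.
  by have := dominated_entry a b dw; rewrite mxE.
have wS : S (mxvec (e%:M : 'M[R]_n)).
  rewrite /S /= mxvecK.
  have qe y : qf (e%:M : 'M[R]_n) y = e * (\sum_(i < n) y ord0 i ^+ 2).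
    rewrite mulr_sumr; apply: eq_bigr => i _; rewrite (bigD1 i) //= big1 ?addr0.
      by rewrite mxE eqxx mulr1n expr2 mulrA.
    by move=> j; rewrite eq_sym => /negbTE ji; rewrite mxE ji mulr0n !mul0r.
  split; first exact: tr_scalar_mx.
    move=> y; rewrite qe; apply: mulr_ge0; first exact: ltW.
    by apply: sumr_ge0 => i _; exact: sqr_ge0.
  by move=> y; rewrite qe.
have cdet : continuous (fun w : 'rV[R]_(n * n) => \det (vec_mx w : 'M[R]_n)).
  move=> w; apply: (@Ck_cont _ _ _ setT 0) => //.
  apply: (Ck_det (M := fun w : 'rV[R]_(n * n) => vec_mx w)); first exact: openT.
  by move=> i j; split=> // z _; exact: cvec.
have [w Sw wmax] := EVT_max_rV (ex_intro _ _ wS) (bounded_closed_compact bS cS)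
  (continuous_subspaceT cdet).
rewrite inE in Sw; exists (vec_mx w).
  split; first exact: Sw.
  move=> H' dH'; have := wmax (mxvec H'); rewrite inE mxvecK; exact.
have := wmax (mxvec e%:M); rewrite inE => /(_ wS); rewrite mxvecK; apply: lt_le_trans.
by rewrite det_scalar exprn_gt0.
Qed.

End Loewner.

(** * Parallel transport *)

Section LinearODE.
Variable R : realType.

Lemma isd_mulmx (V : normedModType R) p q r (M : V -> 'M[R]_(p, q)) (N : V -> 'M[R]_(q, r))
    x v dM dN : is_derive x v M dM -> is_derive x v N dN ->
  is_derive x v (fun z => M z *m N z) (dM *m N x + M x *m dN).
Proof.
move=> /isd_mx HM /isd_mx HN; apply/isd_mx => i j; rewrite !mxE -big_split /=.
rewrite (_ : (fun z => _) = fun z => \sum_(k < q) M z i k * N z k j); last first.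
  by apply/funext => z; rewrite mxE.
by apply: isd_sum => k _; exact: (isd_mul (HM i k) (HN k j)).
Qed.

Lemma isd_tr (V : normedModType R) p q (M : V -> 'M[R]_(p, q)) x v dM :
  is_derive x v M dM -> is_derive x v (fun z => (M z)^T) dM^T.
Proof.
move=> /isd_mx HM; apply/isd_mx => i j; rewrite mxE.
rewrite (_ : (fun z => _) = fun z => M z j i); last by apply/funext => z; rewrite mxE.
exact: HM.
Qed.

Lemma isd0_cst p q (M : R -> 'M[R]_(p, q)) (e : R) :
  (forall t : R, ball 0 e t -> is_derive t 1 M 0) ->
  forall t : R, ball 0 e t -> M t = M 0.
Proof.
move=> dM t; rewrite -ball_normE /ball_ /= sub0r normrN => te.
have H (s : R) : `|s| <= `|t| -> is_derive s 1 M 0.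
  by move=> st; apply: dM; rewrite -ball_normE /ball_ /= sub0r normrN (le_lt_trans st).
have Z (s : R) : `|s| <= `|t| -> `|0 : 'M[R]_(p, q)| <= 0 by rewrite normr0.
have := @isd_bound_mx _ _ _ M (fun _ => 0) `|t| 0 (lexx 0) H Z t (lexx _).
by rewrite mul0r normr_le0 subr_eq0 => /eqP.
Qed.

(** The equation J' = J N(x) along the line is made autonomous by adding the position, with x' = v,
    to the unknowns; the state is the row vector joining x and the flattened J. *)
Lemma transport_ode n (U : set 'rV[R]_n) (N : 'rV[R]_n -> 'M[R]_n) x0 v :
  open U -> U x0 -> (forall i j, smooth U (fun x => N x i j)) ->
  exists (e : R) (J : R -> 'M[R]_n), [/\ 0 < e, J 0 = 1%:M,
    forall t : R, ball 0 e t -> U (x0 + t *: v) &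
    forall t : R, ball 0 e t -> is_derive t 1 J (J t *m N (x0 + t *: v))].
Proof.
move=> oU Ux0 CN.
pose W : set 'rV[R]_(n + n * n) := [set s | U (lsubmx s)].
have cl : continuous (fun s : 'rV[R]_(n + n * n) => lsubmx s).
  move=> s; apply: (@cvg_mx R _ (nbhs s) _ 1 n (fun s => lsubmx s) (lsubmx s)).2 => i j; rewrite mxE.
  rewrite (_ : (fun x => _) = fun x : 'rV[R]_(n + n * n) => x i (lshift (n * n) j)).
    exact: continuous_coord.
  by apply/funext => z; rewrite mxE.
have oW : open W by apply: open_comp.
pose fld (s : 'rV[R]_(n + n * n)) : 'rV[R]_(n + n * n) :=
  row_mx v (mxvec (vec_mx (rsubmx s) *m N (lsubmx s))).
have Cl k : Ck W k (fun s => lsubmx s).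
  apply/(Ck_mx _ _ oW) => i j.
  apply: (@Ck_eq _ _ _ _ _ (fun s : 'rV[R]_(n + n * n) => s ord0 (lshift (n * n) j)) _ oW); last exact: Ck_coord.
  by move=> s _; rewrite mxE (ord1 i).
have Cf : smooth W fld.
  move=> k; apply/(Ck_mx _ _ oW) => i j; rewrite (ord1 i).
  rewrite /fld; case: (split_ordP j) => l ->.
    apply: (@Ck_eq _ _ _ _ _ (fun=> v ord0 l) _ oW); last exact: Ck_cst.
    by move=> s _; rewrite row_mxEl.
  case/mxvec_indexP: l => p q.
  apply: (@Ck_eq _ _ _ _ _ (fun s : 'rV[R]_(n + n * n) => \sum_(r < n)
      s ord0 (rshift n (mxvec_index p r)) * N (lsubmx s) r q) _ oW).
    move=> s _; rewrite row_mxEr mxvecE mxE; apply: eq_bigr => r _.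
    by rewrite !mxE.
  apply: (Ck_sum _ oW) => r _; apply: (Ck_mul oW); first exact: Ck_coord.
  exact: (Ck_comp oW oU (fun s Ws => Ws) (CN r q k) (Cl k)).
have Ws : W (row_mx x0 (mxvec 1%:M)) by rewrite /W /= row_mxKl.
have [e [s [e0 s0 sW ds _]]] := ODE_solution oW Ws Cf.
have lE (t : R) : ball 0 e t -> lsubmx (s t) = x0 + t *: v.
  move=> te.
  have H (u : R) : ball 0 e u -> is_derive u 1 (fun u => lsubmx (s u) - u *: v) 0.
    move=> /ds /isd_mx du; apply/isd_mx => i j; rewrite mxE.
    rewrite (_ : (fun z => _) = fun z => s z i (lshift (n * n) j) - z * v i j); last first.
      by apply/funext => z; rewrite !mxE.
    have D2 := isd_mulr (v i j) (is_derive_id u (1 : R)).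
    apply: is_derive_eq (isd_sub (du i (lshift (n * n) j)) D2) _.
    by rewrite /fld row_mxEl (ord1 i) mul1r subrr.
  have := isd0_cst H te; rewrite s0 row_mxKl scale0r subr0 => <-.
  by rewrite subrK.
exists e, (fun t => vec_mx (rsubmx (s t))); split=> //.
- by rewrite s0 row_mxKr mxvecK.
- by move=> t te; rewrite -lE //; exact: sW.
- move=> t te; have /isd_mx dt := ds t te; apply/isd_mx => i j.
  rewrite (_ : (fun z => _) = fun z => s z ord0 (rshift n (mxvec_index i j))); last first.
    by apply/funext => z; rewrite !mxE.
  apply: is_derive_eq (dt ord0 _) _.
  by rewrite /fld row_mxEr mxvecE lE.
Qed.

End LinearODE.

Section InvariantForms.
Variables (R : realType) (n m : nat) (U : set 'rV[R]_n).
Variable a : 'rV[R]_n -> seq 'I_n -> R.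
Variable Gam : 'rV[R]_n -> 'I_n -> 'I_n -> 'I_n -> R.
Variables (phi : R -> R) (L : 'rV[R]_n -> 'M[R]_n).
Implicit Types (x y v : 'rV[R]_n).

Let f x y : R := phi (Aform m a x y).

Hypothesis oU : open U.
Hypothesis m2 : (2 <= m)%N.
Hypothesis smooth_a : forall I, size I = m -> smooth U (a ^~ I).
Hypothesis sym_a : forall x, U x -> symk m (a x).
Hypothesis smooth_Gam : forall i j k, smooth U (fun x => Gam x i j k).
Hypothesis par : forall x, U x -> parallel m a Gam x.
Hypothesis cont_f : forall x y, U x -> {for x, continuous (fun x => f x y)}.
Hypothesis det_gt0 : forall x, U x -> 0 < \det (L x).
Hypothesis loewnerL : forall x, U x -> loewner (f x) (L x).

(** A row vector w is parallel along the direction v when w' = w N. *)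
Let N v x : 'M[R]_n := \matrix_(l, j) - \sum_(k < n) v ord0 k * Gam x j k l.

(** The derivative of A along a parallel field is its covariant derivative, which vanishes by
    [par]. *)
Lemma parallel_along (x0 v y : 'rV[R]_n) (J : R -> 'M[R]_n) (e t : R) :
  J 0 = 1%:M -> (forall t : R, ball 0 e t -> U (x0 + t *: v)) ->
  (forall t : R, ball 0 e t -> is_derive t 1 J (J t *m N v (x0 + t *: v))) ->
  ball 0 e t -> f (x0 + t *: v) (y *m J t) = f x0 y.
Proof.
move=> J0 Ut dJ te.
have H (s : R) : ball 0 e s -> is_derive s 1
    (* The scalar is packed as a 1 by 1 matrix for the sake of [isd0_cst]. *)
    (fun s => (Aform m a (x0 + s *: v) (y *m J s))%:M : 'M[R]_1) 0.
  move=> se; apply/isd_mx => p q; rewrite (ord1 p) (ord1 q) mxE.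
  rewrite (_ : (fun z => _) = fun z => Aform m a (x0 + z *: v) (y *m J z)); last first.
    by apply/funext => z; rewrite mxE eqxx.
  have dx : is_derive s (1 : R) (fun s : R => x0 + s *: v) v.
    have H := is_derive_id (x0 + s *: v) v.
    exact: (isd_line _ _ _ _ _).1 H.
  have dy : is_derive s (1 : R) (fun s : R => y *m J s) (y *m J s *m N v (x0 + s *: v)).
    have := isd_mulmx (is_derive_cst y s (1 : R)) (dJ s se).
    by rewrite mul0mx add0r mulmxA.
  have C1 I : size I = m -> Ck U 1 (a ^~ I) by move=> sI; exact: (smooth_a sI 1).
  apply: is_derive_eq (form_along_curve oU C1 sym_a (Ut s se) dx dy) _.
  set w := y *m J s; clearbody w; set x := x0 + s *: v.
  rewrite -!/(Aform _ _ _ _).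
  transitivity (\sum_(k < n) v ord0 k * dAform m a x k w
     + m%:R * \sum_(j < n) (w *m N v x) ord0 j * Aform1 m a x j w); first by [].
  under eq_bigr do rewrite (par (Ut s se)).
  have -> : \sum_(j < n) (w *m N v x) ord0 j * Aform1 m a x j w =
     - \sum_(k < n) v ord0 k * \sum_(j < n) (\sum_(l < n) Gam x j k l * w ord0 l) * Aform1 m a x j w.
    rewrite -sumrN.
    transitivity (\sum_(j < n) \sum_(k < n) - (v ord0 k * ((\sum_(l < n) Gam x j k l * w ord0 l) * Aform1 m a x j w))).
      apply: eq_bigr => j _; rewrite mxE.
      transitivity (- (\sum_(k < n) v ord0 k * \sum_(l < n) Gam x j k l * w ord0 l) * Aform1 m a x j w).
        congr (_ * _).
        transitivity (- \sum_(l < n) \sum_(k < n) v ord0 k * (Gam x j k l * w ord0 l)).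
          rewrite -sumrN; apply: eq_bigr => l _; rewrite mxE mulrN mulr_sumr.
          by congr (- _); apply: eq_bigr => k _; ring.
        rewrite exchange_big; congr (- _); apply: eq_bigr => k _; by rewrite mulr_sumr.
      by rewrite mulNr mulr_suml -sumrN; apply: eq_bigr => k _; rewrite mulrA.
    rewrite exchange_big; apply: eq_bigr => k _; by rewrite mulr_sumr -sumrN.
  rewrite mulrN mulr_sumr -sumrB big1 // => k _; ring.
have := isd0_cst H te => /(congr1 (fun M : 'M[R]_1 => M ord0 ord0)).
by rewrite !mxE !mulr1n scale0r addr0 J0 mulmx1 /f => ->.
Qed.

(** The derivative of L along v that vanishing of its covariant derivative prescribes. *)
Definition nablaL v x i j : R := \sum_(k < n) v ord0 k *
  \sum_(l < n) (Gam x l k i * L x l j + Gam x l k j * L x i l).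

(** Transport J carries f at x to f at x + t v, so by uniqueness it carries one Loewner form to the
    other: L (x + t v) = K L(x) K^T with K inverse to J. The right-hand side can be differentiated
    whatever is known on L. *)
Lemma invariant_derive x v i j : U x -> is_derive x v (fun x => L x i j) (nablaL v x i j).
Proof.
move=> Ux.
have CN v' r s : smooth U (fun x => N v' x r s).
  move=> d; apply: (@Ck_eq _ _ _ _ _ (fun x => - \sum_(k < n) v' ord0 k * Gam x s k r) _ oU).
    by move=> z _; rewrite mxE.
  apply: (Ck_opp oU); apply: (Ck_sum _ oU) => k _; apply: (Ck_mull _ oU); exact: smooth_Gam.
have [e1 [J [e1_0 J0 JU dJ]]] := transport_ode v oU Ux (CN v).
(* The inverse K of J is obtained from its own equation K' = - N K, solved through the transpose; J
   K is then constant. *)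
have CN' r s : smooth U (fun x => (- (N v x)^T) r s).
  move=> d; apply: (@Ck_eq _ _ _ _ _ (fun x => - N v x s r) _ oU).
    by move=> z _; rewrite !mxE.
  by apply: (Ck_opp oU); exact: CN.
have [e2 [K' [e2_0 K0 _ dK']]] := transport_ode v oU Ux CN'.
pose K t := (K' t)^T.
have dK (t : R) : ball 0 e2 t -> is_derive t 1 K (- (N v (x + t *: v) *m K t)).
  move=> /dK' /isd_tr H; apply: is_derive_eq H _.
  by rewrite trmx_mul linearN /= trmxK mulNmx.
pose e := Num.min e1 e2; have e0 : 0 < e by rewrite lt_min e1_0.
have b1 (t : R) : ball 0 e t -> ball 0 e1 t by apply: le_ball; rewrite ge_min lexx.
have b2 (t : R) : ball 0 e t -> ball 0 e2 t by apply: le_ball; rewrite ge_min lexx orbT.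
have JK (t : R) : ball 0 e t -> J t *m K t = 1%:M.
  move=> te.
  have H (s : R) : ball 0 e s -> is_derive s 1 (fun s => J s *m K s) 0.
    move=> se; apply: is_derive_eq (isd_mulmx (dJ s (b1 _ se)) (dK s (b2 _ se))) _.
    by rewrite mulmxN !mulmxA subrr.
  by rewrite (isd0_cst H te) J0 /K K0 trmx1 mulmx1.
have LE (t : R) : ball 0 e t -> L (x + t *: v) = K t *m L x *m (K t)^T.
  move=> te; have uJ : J t \in unitmx by case/mulmx1_unit: (JK t te).
  have KJ : K t *m J t = 1%:M by exact: mulmx1C (JK t te).
  have Ut := JU t (b1 t te).
  have lo := loewner_congr uJ (loewnerL Ut).
  have fE : (fun y => f (x + t *: v) (y *m J t)) = f x.
    by apply/funext => y; exact: (parallel_along y J0 JU dJ (b1 t te)).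
  rewrite fE in lo; have E := loewner_unique (det_gt0 Ux) (loewnerL Ux) lo.
  rewrite E !mulmxA KJ mul1mx -!mulmxA -trmx_mul KJ trmx1 mulmx1 //.
apply: (isd_line0 _ _ _ _).2.
have b00 : ball (0 : R) e 0 by exact: ballxx.
apply: (@isd_near _ _ _ (ball (0 : R) e) (fun t => (K t *m L x *m (K t)^T) i j)) => //.
- exact: ball_open.
- by move=> t te; rewrite LE.
have dK0 := dK 0 (b2 _ b00).
have /isd_mx /(_ i j) H := isd_mulmx (isd_mulmx dK0 (is_derive_cst (L x) (0 : R) (1 : R))) (isd_tr dK0).
apply: is_derive_eq H _.
rewrite /K K0 !trmx1 mulmx0 addr0 !mulmx1 mul1mx scale0r addr0 mulNmx linearN /= mulmxN.
rewrite [LHS]mxE [X in X + _]mxE [X in _ + X]mxE.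
rewrite [X in - X + _]mxE [X in _ - X]mxE -opprD -big_split /=.
rewrite /nablaL.
transitivity (\sum_(l < n) \sum_(k < n) v ord0 k * (Gam x l k i * L x l j + Gam x l k j * L x i l)).
  rewrite -sumrN; apply: eq_bigr => l _; rewrite !mxE mulNr mulrN -opprD opprK.
  by rewrite mulr_suml mulr_sumr -big_split; apply: eq_bigr => k _ /=; ring.
by rewrite exchange_big; apply: eq_bigr => k _; rewrite mulr_sumr.
Qed.

(** Directional derivatives alone do not give continuity. Here they are locally bounded, since
    [dominated_entry] bounds L by values of f, which are continuous in x; hence a Lipschitz estimate
    at x. *)
Lemma invariant_continuous x i j : U x -> {for x, continuous (fun x => L x i j)}.
Proof.
move=> Ux.
pose B z := \sum_(k < n) f z (basis_vec R k).
pose C z := \sum_(k < n) \sum_(l < n) (`|Gam z l k i| * B z + `|Gam z l k j| * B z).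
have cC : {for x, continuous C}.
  apply: (@cvg_sumr R _ (nbhs x) _) => k _; apply: (@cvg_sumr R _ (nbhs x) _) => l _.
  have cB : {for x, continuous B} by apply: (@cvg_sumr R _ (nbhs x) _) => k' _; exact: cont_f.
  have cG p : {for x, continuous (fun z => `|Gam z l k p|)}.
    have cG' : {for x, continuous (fun z => Gam z l k p)}.
      exact: (Ck_cont (smooth_Gam l k p 0) Ux).
    exact: (@cvg_norm _ _ _ (nbhs x) _ (fun z => Gam z l k p) _ cG').
  exact: (cvgD (cvgM (cG i) cB) (cvgM (cG j) cB)).
have nC : \forall z \near x, U z /\ C z < C x + 1.
  apply: filterI; first exact: open_nbhs_nbhs.
  have /cvgrPdist_lt /(_ 1 ltr01) := cC; apply: filterS => z.
  by rewrite distrC => /ltr_normlW; rewrite ltrBlDl.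
have /nbhs_ballP[r /= r0 rP] := nC.
have C0 : 0 <= C x + 1.
  rewrite addr_ge0 //; apply: sumr_ge0 => k _; apply: sumr_ge0 => l _.
  have B0 : 0 <= B x.
    apply: sumr_ge0 => k' _; have [[_ p q] _] := loewnerL Ux; exact: le_trans (p _) (q _).
  by rewrite addr_ge0 // mulr_ge0.
have bound w : `|w| < r -> `|L (x + w) i j - L x i j| <= (C x + 1) * `|w|.
  move=> wr.
  have D (s : R) : `|s| <= 1 -> is_derive s 1 (fun s => L (x + s *: w) i j) (nablaL w (x + s *: w) i j).
    move=> s1; apply: (isd_line (fun x => L x i j) x w s _).1; apply: invariant_derive.
    apply: (rP _ _).1; rewrite -ball_normE /ball_ /= opprD addNKr normrN normrZ.
    by apply: le_lt_trans wr; rewrite ler_piMl.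
  have := @isd_bound _ _ _ 1 ((C x + 1) * `|w|) D _ 1; rewrite normr1 mulr1 scale1r scale0r addr0.
  apply=> // s s1.
  have [Uz Cz] : U (x + s *: w) /\ C (x + s *: w) < C x + 1.
    apply: rP; rewrite -ball_normE /ball_ /= opprD addNKr normrN normrZ.
    by apply: le_lt_trans wr; rewrite ler_piMl.
  apply: (@le_trans _ _ (C (x + s *: w) * `|w|)); last by rewrite ler_wpM2r // ltW.
  set z := x + s *: w in Uz Cz *.
  rewrite /nablaL /C mulr_suml; apply: le_trans (ler_norm_sum _ _ _) _.
  apply: ler_sum => k _; rewrite normrM mulrC; apply: ler_pM => //; last exact: mx_coord_le.
  apply: le_trans (ler_norm_sum _ _ _) _; apply: ler_sum => l _.
  have [dz _] := loewnerL Uz.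
  apply: le_trans (ler_normD _ _) _; rewrite !normrM.
  by apply: lerD; apply: ler_wpM2l => //; exact: dominated_entry.
apply: (@cvgrPdist_le _ _ _ (nbhs x) _ _ _).2 => ep ep0.
have C1 : 0 < C x + 1 + 1 by rewrite ltr_wpDl.
apply/nbhs_ballP; exists (Num.min r (ep / (C x + 1 + 1))) => /=.
  by rewrite lt_min r0 divr_gt0.
move=> z; rewrite -ball_normE /ball_ /= distrC lt_min => /andP[zr /ltW zE].
rewrite distrC; have := bound _ zr; rewrite [x + _]addrC subrK => /le_trans; apply.
apply: (@le_trans _ _ ((C x + 1 + 1) * (ep / (C x + 1 + 1)))).
  by apply: ler_pM => //; rewrite lerDl.
by rewrite mulrC divfK // gt_eqF.
Qed.

(** The derivatives of L are linear in L with smooth coefficients, so each class of regularity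
    yields the next. *)
Lemma invariant_smooth i j : smooth U (fun x => L x i j).
Proof.
move=> k; elim: k i j => [|k IH] i j.
  by split=> // x Ux; exact: invariant_continuous.
apply: (@Ck_step _ _ _ _ _ _ (fun v x => nablaL v x i j) oU).
- by move=> x Ux; exact: invariant_continuous.
- by move=> v x Ux; exact: invariant_derive.
- move=> v; apply: (Ck_sum _ oU) => p _; apply: (Ck_mull _ oU).
  apply: (Ck_sum _ oU) => l _; apply: (Ck_add oU); apply: (Ck_mul oU) => //; exact: smooth_Gam.
Qed.

End InvariantForms.

(** * The equation of the statement as an identity of forms in y *)

Section EquationOfForms.
Variables (R : realType) (n : nat).
Implicit Types (b : 'rV[R]_n -> seq 'I_n -> R) (x y : 'rV[R]_n)
  (Gam : 'rV[R]_n -> 'I_n -> 'I_n -> 'I_n -> R).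

(** This makes the m terms of the cyclic sum in [gam] equal once contracted with y. *)
Lemma pform_rot k (c : seq 'I_n -> R) r (w : 'I_n -> R) :
  pform k (fun I => c (rot r I)) w = pform k c w.
Proof.
rewrite -!pform_tuple.
rewrite [RHS](reindex (fun I : k.-tuple 'I_n => [tuple of rot r I])) /=; last first.
  exists (fun I : k.-tuple 'I_n => [tuple of rotr r I]) => I _; apply/val_inj => /=.
    exact: rotK.
  exact: rotrK.
apply: eq_bigr => I _; congr (_ * _); apply: perm_big.
by rewrite perm_sym perm_rot.
Qed.

Lemma pformS k (c : seq 'I_n -> R) (w : 'I_n -> R) :
  pform k.+1 c w = \sum_(i < n) w i * pform k (fun I => c (i :: I)) w.
Proof. by []. Qed.

Lemma pform_const k (c : seq 'I_n -> R) (u : R) (w : 'I_n -> R) :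
  pform k (fun I => c I * u) w = pform k c w * u.
Proof.
rewrite mulrC -pformZ; apply: eq_pform => // I _; exact: mulrC.
Qed.

Lemma pform_root_lhs m b x i y : (2 <= m)%N ->
  pform m (fun I => pform m (fun J => root_lhs m b x i I J) (crd y)) (crd y)
  = (m%:R * (m%:R - 1))^-1 * (Aform m b x y *
     (m%:R * \sum_(k < n) y ord0 k * dAform1 m b x i k y - dAform m b x i y)
     - (m%:R - 1) * (Aform1 m b x i y * \sum_(k < n) y ord0 k * dAform m b x k y)).
Proof.
case: m => [|[|m]] // _; set M := m.+2.
have gE : pform M (gam M b x i) (crd y) = (M%:R * (M%:R - 1))^-1 *
    (M%:R * \sum_(k < n) y ord0 k * dAform1 M b x i k y - dAform M b x i y).
  rewrite /gam pformZ; congr (_ * _); rewrite pformD pformN; congr (_ - _).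
  have E : pform M (fun I => \sum_(r < M) 1 * da b x (i :: behead (rot r I)) (head i (rot r I))) (crd y)
      = \sum_(r < M) 1 * \sum_(k < n) y ord0 k * dAform1 M b x i k y.
    rewrite (pform_sum M _ (fun=> 1)
      (fun r I => da b x (i :: behead (rot (nat_of_ord r) I)) (head i (rot (nat_of_ord r) I)))).
    apply: eq_bigr => r _; congr (_ * _).
    by rewrite (pform_rot M (fun I => da b x (i :: behead I) (head i I))).
  transitivity (pform M (fun I => \sum_(r < M) 1 * da b x (i :: behead (rot r I)) (head i (rot r I))) (crd y)).
    by apply: eq_pform => // I _; apply: eq_bigr => r _; rewrite mul1r.
  by rewrite E sumr_const card_ord mul1r mulr_natl.
have JE I : pform M (fun J => root_lhs M b x i I J) (crd y) =
    gam M b x i I * Aform M b x y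
    + (- M%:R^-1 * Aform1 M b x i y) * \sum_(k < n) y ord0 k * da b x I k.
  rewrite /root_lhs pformD pform_const mulrC; congr (_ + _).
  rewrite pformN (pformS m.+1) mulr_sumr -sumrN; apply: eq_bigr => k _.
  rewrite -[y ord0 k]/(crd y k).
  rewrite (_ : pform m.+1 _ _ = M%:R^-1 * Aform1 M b x i y * da b x I k); first by ring.
  by rewrite /Aform1 -pformZ -pform_const.
transitivity (pform M (fun I => gam M b x i I * Aform M b x y) (crd y) +
   (- M%:R^-1 * Aform1 M b x i y) * \sum_(k < n) y ord0 k * dAform M b x k y).
  rewrite -(pform_sum M _ (fun k => y ord0 k) (fun k I => da b x I k)) -pformZ -pformD.
  by apply: eq_pform => // I _; rewrite JE.
rewrite pform_const gE.
have M0 : M%:R != 0 :> R by rewrite pnatr_eq0.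
have M1 : M%:R - 1 != 0 :> R by rewrite -[1]/(1%:R) subr_eq0 eqr_nat.
by field; rewrite M0 M1.
Qed.

Lemma pform_root_rhs m b Gam x i y : (2 <= m)%N ->
  pform m (fun I => pform m (fun J => root_rhs b Gam x i I J) (crd y)) (crd y)
  = Aform m b x y * (\sum_(j < n) spray Gam x y j * Aform2 m b x i j y)
    - Aform1 m b x i y * (\sum_(j < n) spray Gam x y j * Aform1 m b x j y).
Proof.
case: m => [|[|m]] // _; set M := m.+2.
have JE I : pform M (fun J => root_rhs b Gam x i I J) (crd y) =
  \sum_(j < n) (\sum_(l < n) y ord0 l * Gam x j (head i I) l) *
    (- (b x (i :: behead I) * Aform1 M b x j y) + b x [:: i, j & drop 2 I] *
       Aform1 M b x (nth i I 1) y).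
  rewrite /M (pformS m.+1).
  transitivity (\sum_(l < n) crd y l * \sum_(j < n) Gam x j (head i I) l *
    (- (b x (i :: behead I) * Aform1 M b x j y) + b x [:: i, j & drop 2 I] *
       Aform1 M b x (nth i I 1) y)).
    apply: eq_bigr => l _; congr (_ * _); rewrite /root_rhs.
    rewrite (pform_sum m.+1 _ (fun j => Gam x j (head i I) l)
      (fun j J => - (b x (i :: behead I) * b x (j :: J)) + b x [:: i, j & drop 2 I] * b x (nth i I 1 :: J))).
    by apply: eq_bigr => j _; congr (_ * _); rewrite pformD pformN !pformZ.
  under eq_bigr do rewrite mulr_sumr.
  rewrite exchange_big; apply: eq_bigr => j _ /=; rewrite mulr_suml.
  by apply: eq_bigr => l _; rewrite mulrA.
transitivity (pform M (fun I => \sum_(j < n) (\sum_(l < n) y ord0 l * Gam x j (head i I) l) *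
    (- (b x (i :: behead I) * Aform1 M b x j y) + b x [:: i, j & drop 2 I] *
       Aform1 M b x (nth i I 1) y)) (crd y)).
  by apply: eq_pform => // I _; exact: JE.
rewrite {1}/M (pformS m.+1).
transitivity (\sum_(k < n) y ord0 k * \sum_(j < n) (\sum_(l < n) y ord0 l * Gam x j k l) *
   (- (Aform1 M b x i y * Aform1 M b x j y) + Aform2 M b x i j y * Aform M b x y)).
  apply: eq_bigr => k _; congr (_ * _).
  transitivity (pform m.+1 (fun I => \sum_(j < n) (\sum_(l < n) y ord0 l * Gam x j k l) *
    (- (b x (i :: I) * Aform1 M b x j y) + b x [:: i, j & drop 1 I] *
       Aform1 M b x (nth i I 0) y)) (crd y)); first by [].
  rewrite (pform_sum m.+1 _ (fun j => \sum_(l < n) y ord0 l * Gam x j k l)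
     (fun j I => - (b x (i :: I) * Aform1 M b x j y) + b x [:: i, j & drop 1 I] *
       Aform1 M b x (nth i I 0) y)).
  apply: eq_bigr => j _; congr (_ * _); rewrite pformD pformN pform_const; congr (_ + _).
  rewrite -(Euler_A (m := M) b isT x y) mulr_sumr (pformS m); apply: eq_bigr => p _.
  rewrite (_ : pform m _ _ = Aform2 M b x i j y * Aform1 M b x p y); last first.
    by rewrite -pform_const; apply: eq_pform => // I _ /=; rewrite drop0.
  by rewrite /crd; ring.
under eq_bigr do rewrite mulr_sumr.
rewrite exchange_big !mulr_sumr -sumrB; apply: eq_bigr => j _ /=.
transitivity (spray Gam x y j * (- (Aform1 M b x i y * Aform1 M b x j y)
    + Aform2 M b x i j y * Aform M b x y)); last by ring.
rewrite /spray [RHS]mulr_suml; apply: eq_bigr => k _; rewrite mulrA; congr (_ * _).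
by rewrite mulr_sumr; apply: eq_bigr => l _; ring.
Qed.

(** By [symmetrize_pform] both sides may be contracted with y; the difference is then that of the
    two sides of Rapcsak's equation divided by m (m - 1). *)
Lemma equation_rapcsak m b Gam x : (2 <= m)%N ->
  (forall (i : 'I_n) (I J : m.-tuple 'I_n), symmetrize (root_lhs m b x i) I J
     = symmetrize (root_rhs b Gam x i) I J) <->
  (forall y i, rapcsak m b Gam x y i).
Proof.
move=> m2.
have mm : (m%:R * (m%:R - 1))^-1 != 0 :> R.
  rewrite invr_eq0 mulf_neq0 ?(m_neq0 R m2) // -[1]/(1%:R) subr_eq0 eqr_nat; lia.
have E y i : rapcsak m b Gam x y i <->
    pform m (fun I => pform m (fun J => root_lhs m b x i I J) (crd y)) (crd y)
    = pform m (fun I => pform m (fun J => root_rhs b Gam x i I J) (crd y)) (crd y).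
  rewrite pform_root_lhs // pform_root_rhs // /rapcsak /Bform.
  set A := Aform _ _ _ _; set s1 := \sum_(k < n) _; set s2 := \sum_(j < n) _.
  set s3 := \sum_(k < n) _; set s4 := \sum_(j < n) _.
  set A1 := Aform1 _ _ _ _ _; set d := dAform _ _ _ _ _.
  have mn := m_neq0 R m2.
  have mn1 : m%:R - 1 != 0 :> R by rewrite -[1]/(1%:R) subr_eq0 eqr_nat; lia.
  have K : (m%:R * (m%:R - 1))^-1 * (A * (m%:R * s1 - d) - (m%:R - 1) * (A1 * s3))
     - (A * s2 - A1 * s4) = (m%:R * (m%:R - 1))^-1 *
     (A * (m%:R * s1 - m%:R * (m%:R - 1) * s2 - d) - (m%:R - 1) * (A1 * (s3 - m%:R * s4))).
    by field; rewrite mn mn1.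
  split=> H.
    by apply/eqP; rewrite -subr_eq0 K H subrr mulr0.
  apply/eqP; rewrite -subr_eq0; move/eqP: H; rewrite -subr_eq0 K mulf_eq0 (negbTE mm).
  by [].
split=> H.
  move=> y i; apply: (E y i).2.
  exact: (symmetrize_pform m (root_lhs m b x i) (root_rhs b Gam x i)).1 (H i) (crd y).
move=> i; apply: (symmetrize_pform m (root_lhs m b x i) (root_rhs b Gam x i)).2 => y.
have := (E (\row_j y j) i).1 (H _ _).
have -> : crd (\row_j y j) = y by apply/funext => j; rewrite /crd mxE.
by [].
Qed.

(** A linear connection may have torsion, while Rapcsak's equation sees only the spray. *)
Definition symmetric_part Gam x j k l : R := 2^-1 * (Gam x j k l + Gam x j l k).

Lemma spray_symmetric_part Gam x y j : spray (symmetric_part Gam) x y j = spray Gam x y j.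
Proof.
rewrite /spray /symmetric_part.
transitivity (2^-1 * (\sum_(k < n) \sum_(l < n) Gam x j k l * y ord0 k * y ord0 l
   + \sum_(k < n) \sum_(l < n) Gam x j l k * y ord0 k * y ord0 l)).
  rewrite -big_split mulr_sumr; apply: eq_bigr => k _ /=.
  by rewrite -big_split mulr_sumr; apply: eq_bigr => l _ /=; ring.
rewrite [X in _ + X]exchange_big /=.
rewrite [X in _ + X](eq_bigr (fun k => \sum_(l < n) Gam x j k l * y ord0 k * y ord0 l)).
  by field.
by move=> k _; apply: eq_bigr => l _; ring.
Qed.

Lemma eq_rapcsak m b Gam Gam' x y i : (forall j, spray Gam x y j = spray Gam' x y j) ->
  rapcsak m b Gam x y i -> rapcsak m b Gam' x y i.
Proof.
move=> E; have /funext {}E := E; by rewrite /rapcsak /Bform E.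
Qed.

End EquationOfForms.

(** * Metrics on manifolds *)

Section Manifold.
Variables (R : realType) (n : nat) (M : smooth_manifold R n).
Implicit Types (phi psi : chart R n M) (F G : TM_function M) (a b : components M).

Lemma cimage_openP phi : open (cimage phi). Proof. exact: cimage_open. Qed.

Lemma cimage_cinv phi x : cimage phi x -> cdom phi (cinv phi x).
Proof. by move=> [p dp <-]; rewrite cmapK. Qed.

Lemma cinvK phi x : cimage phi x -> cmap phi (cinv phi x) = x.
Proof. by move=> [p dp <-]; rewrite cmapK. Qed.

Lemma overlapP phi psi x :
  overlap phi psi x <-> cimage phi x /\ cdom psi (cinv phi x).
Proof.
split; first by move=> [p [dp dp'] <-]; split; [exists p|rewrite cmapK].
move=> [Ux dp]; exists (cinv phi x); last exact: cinvK.
by split=> //; exact: cimage_cinv.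
Qed.

Lemma open_preimage (X Y : topologicalType) (f : X -> Y) (A : set X) (B : set Y) :
  open A -> open B -> (forall x, A x -> {for x, continuous f}) ->
  open [set x | A x /\ B (f x)].
Proof.
move=> oA oB cf; rewrite openE => x [Ax Bfx].
apply: filterI; first exact: open_nbhs_nbhs.
by apply: cf => //; exact: open_nbhs_nbhs.
Qed.

Lemma overlap_open phi psi : open (overlap phi psi).
Proof.
rewrite (_ : overlap phi psi = [set x | cimage phi x /\ cdom psi (cinv phi x)]); last first.
  by apply/seteqP; split=> x /overlapP.
apply: open_preimage; [exact: cimage_open|exact: cdom_open|].
by move=> x Ux; exact: cinv_continuous.
Qed.

Lemma transition_image phi psi x : overlap phi psi x ->
  overlap psi phi (transition phi psi x).
Proof.
move=> [p [dp dp'] <-]; rewrite /transition cmapK //.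
by apply/overlapP; split; [exists p|rewrite cmapK].
Qed.

Lemma transitionK phi psi x : overlap phi psi x ->
  transition psi phi (transition phi psi x) = x.
Proof. by move=> [p [dp dp'] <-]; rewrite /transition !cmapK. Qed.

(** Row convention: a tangent vector y at x is carried to y J. *)
Definition jacobian phi psi x : 'M[R]_n :=
  \matrix_(i, j) partial i (transition_coord phi psi j) x.

Lemma smooth_transition phi psi j : atlas phi -> atlas psi ->
  smooth (overlap phi psi) (transition_coord phi psi j).
Proof.
move=> ph ps k; have [/(_ k) C _] := atlas_compatible ph ps.
have H := (Ck_mx _ _ (@overlap_open phi psi)).1 C ord0 j.
exact: H.
Qed.

Lemma transition_derive phi psi x y : atlas phi -> atlas psi -> overlap phi psi x ->
  is_derive x y (transition phi psi) (y *m jacobian phi psi x).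
Proof.
move=> ph ps Ox; apply/isd_mx => i j; rewrite (ord1 i).
have H := derive_partial y (@overlap_open phi psi) (smooth_transition j ph ps 1) Ox.
apply: is_derive_eq H _; rewrite mxE; apply: eq_bigr => k _.
by rewrite mxE mulrC.
Qed.

Lemma jacobianM phi psi x : atlas phi -> atlas psi -> overlap phi psi x ->
  jacobian phi psi x *m jacobian psi phi (transition phi psi x) = 1%:M.
Proof.
move=> ph ps Ox; have oW := @overlap_open phi psi; apply/row_matrixP => i.
have D1 : is_derive x (basis_vec R i) (fun z => z) (basis_vec R i) by exact: is_derive_id.
have D2 : is_derive x (basis_vec R i) (fun z => transition psi phi (transition phi psi z))
    (basis_vec R i *m jacobian phi psi x *m jacobian psi phi (transition phi psi x)).
  apply/isd_mx => r j; rewrite (ord1 r).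
  have H := isd_comp (@overlap_open psi phi) (smooth_transition j ps ph 1)
    (transition_image Ox) (transition_derive (basis_vec R i) ph ps Ox).
  apply: is_derive_eq H _; rewrite mxE; apply: eq_bigr => k _.
  by rewrite [jacobian psi phi _ _ _]mxE mulrC.
have D3 := isd_near oW Ox (fun z Oz => transitionK Oz) D2.
by rewrite -mulmxA in D3; rewrite rowE [RHS]rowE mulmx1; exact: isd_unique D3 D1.
Qed.

Lemma mform_Aform m (c : 'rV[R]_n -> seq 'I_n -> R) x y : mform m c x y = Aform m c x y.
Proof. by rewrite /mform /Aform -pform_tuple. Qed.

Section RootMetricFacts.
Variables (m : nat) (a : components M) (F : TM_function M).
Hypothesis m2 : (2 <= m)%N.
Hypothesis hF : mth_root_metric m a F.
Variable phi : chart R n M.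
Hypothesis ph : atlas phi.

Lemma root_smooth I : size I = m -> smooth (cimage phi) (fun x => a phi x I).
Proof. by have [_ /(_ phi ph)[H _ _]] := hF; exact: H. Qed.

Lemma root_sym x : cimage phi x -> symk m (a phi x).
Proof. by have [_ /(_ phi ph)[_ H _]] := hF => Ux I J; exact: H. Qed.

Lemma root_E x y : cimage phi x -> F phi x y = Aform m (a phi) x y `^ (m%:R)^-1.
Proof. by have [_ /(_ phi ph)[_ _ H]] := hF => Ux; rewrite -mform_Aform; exact: (H x y Ux).2. Qed.

Lemma root_A_gt0 x y : cimage phi x -> y != 0 -> 0 < Aform m (a phi) x y.
Proof.
move=> Ux y0; have [[_ /(_ phi ph)[_ F0 _ _]] /(_ phi ph)[_ _ H]] := hF.
have [A0 _] := H x y Ux; rewrite mform_Aform in A0.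
rewrite lt_neqAle A0 andbT eq_sym; apply/eqP => AE.
have := F0 x y Ux y0; rewrite root_E // AE powR0 ?ltxx //.
by rewrite invr_eq0 (m_neq0 R m2).
Qed.

Lemma root_regular x : cimage phi x -> regular_at m (a phi) x.
Proof.
move=> Ux; have [[_ /(_ phi ph)[_ _ _ pd]] _] := hF.
apply: (regular_of_posdef m2 root_sym root_A_gt0 Ux (F := F phi x)).
  by move=> y; exact: root_E.
by move=> y v y0 v0; exact: pd.
Qed.

Lemma geodesic_chart (T : set R) (c : R -> M) (t : R) i : open T -> (forall t, T t -> {for t, continuous c}) ->
  let Tphi := [set t | T t /\ cdom phi (c t)] in
  let x := fun t : R => cmap phi (c t) in
  smooth Tphi x -> (forall t, Tphi t -> derive1 x t != 0) -> Tphi t ->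
  (derive1 (fun s => partial i (F phi (x s)) (derive1 x s)) t
   = partial i (fun z => F phi z (derive1 x t)) (x t)) <->
  euler_lagrange m (a phi) (x t) (derive1 x t) (derive1 (derive1 x) t) i = 0.
Proof.
move=> oT cc Tphi x Cx x0 Tt.
have oTp : open Tphi by apply: open_preimage => //; exact: cdom_open.
have dx s : Tphi s -> is_derive s 1 x (derive1 x s).
  by move=> Ts; rewrite derive1E; exact: (Ck_derive _ (Cx 1) Ts).
have dy : is_derive t (1 : R) (derive1 x) (derive1 (derive1 x) t).
  rewrite derive1E; apply: derivableP.
  have -> : derive1 x = 'D_(1 : R) x by apply/funext => s; rewrite derive1E.
  by have [_ /(_ 1)[H _]] := Ck_D (1 : R) (Cx 2); exact: H.
apply: (@euler_lagrangeP R n m (cimage phi) (a phi) (@cimage_openP phi) m2 root_smooth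
  root_sym root_A_gt0 (F phi) Tphi x (derive1 x) t (derive1 (derive1 x) t) i) => //.
- by move=> z y Uz; exact: root_E.
- by move=> s [_ ds]; exists (c s).
Qed.

End RootMetricFacts.

(** For both metrics, being extremal means that the acceleration is minus the spray of Gam up to a
    multiple of the velocity. The condition is the same, so even the parametrized curve may be
    kept. *)
Lemma geodesic_transfer m m' a b F G (Gam : chart R n M -> 'rV[R]_n -> 'I_n -> 'I_n -> 'I_n -> R) :
  (2 <= m)%N -> (2 <= m')%N -> mth_root_metric m a F -> mth_root_metric m' b G ->
  (forall phi, atlas phi -> forall x y i, cimage phi x -> rapcsak m (a phi) (Gam phi) x y i) ->
  (forall phi, atlas phi -> forall x y i, cimage phi x -> rapcsak m' (b phi) (Gam phi) x y i) ->
  forall T c, geodesic F T c -> geodesic G T c.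
Proof.
move=> m2 m2' hF hG rF rG T c [oT iT T0 cc H]; split=> // phi ph.
have [Cx x0 EL] := H phi ph; split=> // t i Tt.
have Ux : cimage phi (cmap phi (c t)) by exists (c t) => //; case: Tt.
apply: (geodesic_chart m2' hG ph i oT cc Cx x0 Tt).2.
have [z zE] := (euler_lagrange_geodesic m2 (derive1 (derive1 (fun t => cmap phi (c t))) t) Ux
  (x0 t Tt) (root_regular m2 hF ph Ux) (fun i => rF phi ph _ _ i Ux)).1
  (fun i => (geodesic_chart m2 hF ph i oT cc Cx x0 Tt).1 (EL t i Tt)).
apply: (euler_lagrange_geodesic m2' _ Ux (x0 t Tt) (root_regular m2' hG ph Ux)
  (fun i => rG phi ph _ _ i Ux)).2.
by exists z.
Qed.

Lemma projective_of_rapcsak m m' a b F G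
    (Gam : chart R n M -> 'rV[R]_n -> 'I_n -> 'I_n -> 'I_n -> R) :
  (2 <= m)%N -> (2 <= m')%N -> mth_root_metric m a F -> mth_root_metric m' b G ->
  (forall phi, atlas phi -> forall x y i, cimage phi x -> rapcsak m (a phi) (Gam phi) x y i) ->
  (forall phi, atlas phi -> forall x y i, cimage phi x -> rapcsak m' (b phi) (Gam phi) x y i) ->
  projective F G.
Proof.
move=> m2 m2' hF hG rF rG; split=> T c gc; exists T, c; split=> //.
  exact: (geodesic_transfer m2 m2' hF hG rF rG).
exact: (geodesic_transfer m2' m2 hG hF rG rF).
Qed.

(** A Riemannian metric is thus treated as a root metric with m = 2, to which the preceding results
    apply. *)
Definition quadratic_components (h : chart R n M -> 'rV[R]_n -> 'I_n -> 'I_n -> R) :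
  components M := fun phi x I => if I is [:: i; j] then h phi x i j else 0.

Lemma quadratic_Aform h phi x y :
  Aform 2 (quadratic_components h phi) x y =
  \sum_(i < n) \sum_(j < n) h phi x i j * y ord0 i * y ord0 j.
Proof.
apply: eq_bigr => i _; rewrite /= mulr_sumr; apply: eq_bigr => j _.
by rewrite /crd; ring.
Qed.

Lemma quadratic_symk h phi x : (forall i j, h phi x i j = h phi x j i) ->
  symk 2 (quadratic_components h phi x).
Proof.
move=> sh [|i [|j [|k I]]] J //= _ IJ; have := perm_size IJ.
case: J IJ => [|p [|q [|r J]]] // IJ _ /=.
have [ip|pi] := eqVneq i p.
  by move: IJ; rewrite ip perm_cons => /perm_mem /(_ q); rewrite !inE eqxx => /eqP ->.
have piE : p = j.
  by have := perm_mem IJ p; rewrite !inE eqxx eq_sym (negbTE pi) /= => /eqP.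
have qi : q = i.
  by have := perm_mem IJ i; rewrite !inE eqxx (negbTE pi) /= => /esym /eqP.
by rewrite piE qi sh.
Qed.

Lemma quadratic_parallel h phi x (Gam : 'rV[R]_n -> 'I_n -> 'I_n -> 'I_n -> R) k z :
  (forall i j, h phi x i j = h phi x j i) ->
  (forall p q, da (quadratic_components h phi) x [:: p; q] k = \sum_(l < n)
    (Gam x l k p * h phi x l q + Gam x l k q * h phi x p l)) ->
  dAform 2 (quadratic_components h phi) x k z = 2%:R * \sum_(j < n)
    (\sum_(l < n) Gam x j k l * z ord0 l) * Aform1 2 (quadratic_components h phi) x j z.
Proof.
move=> sh D; pose b := quadratic_components h phi.
transitivity (\sum_(p < n) \sum_(q < n) \sum_(l < n) (z ord0 p * (z ord0 q * (Gam x l k p * h phi x l q))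
   + z ord0 p * (z ord0 q * (Gam x l k q * h phi x p l)))).
  apply: eq_bigr => p _; rewrite /= mulr_sumr; apply: eq_bigr => q _.
  by rewrite D !mulr_sumr; apply: eq_bigr => l _; rewrite /crd; ring.
have A1E j : Aform1 2 b x j z = \sum_(q < n) z ord0 q * h phi x j q by [].
under [in RHS]eq_bigr do rewrite A1E.
pose S := \sum_(p < n) \sum_(q < n) \sum_(l < n) z ord0 p * (z ord0 q * (Gam x l k p * h phi x l q)).
transitivity (S + S).
  under eq_bigr do under eq_bigr do rewrite big_split /=.
  under eq_bigr do rewrite big_split /=.
  rewrite big_split /=; congr (_ + _); rewrite /S [in LHS]exchange_big.
  apply: eq_bigr => p _; apply: eq_bigr => q _; apply: eq_bigr => l _.
  rewrite (sh q l); ring.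
rewrite mulr_natl mulr2n; have -> // : S = \sum_(j < n) (\sum_(l < n) Gam x j k l * z ord0 l) *
   (\sum_(q < n) z ord0 q * h phi x j q).
rewrite /S; under eq_bigr do rewrite exchange_big /=.
rewrite exchange_big; apply: eq_bigr => j _ /=; rewrite mulr_suml.
apply: eq_bigr => p _; rewrite mulr_sumr; apply: eq_bigr => q _; ring.
Qed.

Lemma riemannian_root G : riemannian_metric G -> exists2 h,
  mth_root_metric 2 (quadratic_components h) G &
  forall phi, atlas phi -> forall i j, smooth (cimage phi) (fun x => h phi x i j).
Proof.
move=> [fG [h H]]; exists h; last by move=> phi /H[].
split=> // phi ph; have [Ch sh GE] := H phi ph; split.
- move=> [|i [|j [|k I]]] //= _; exact: Ch.
- by move=> x I J Ux; apply: quadratic_symk => i j; exact: sh.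
- move=> x y Ux; rewrite mform_Aform quadratic_Aform.
  (* The function [Num.sqrt] is 0 on negative numbers, so a negative value would contradict the
     positivity of G. *)
  have P : 0 <= \sum_(i < n) \sum_(j < n) h phi x i j * y ord0 i * y ord0 j.
    have [->|y0] := eqVneq y 0.
      by rewrite big1 // => i _; rewrite big1 // => j _; rewrite !mxE mulr0.
    rewrite leNgt; apply/negP => /ltW N; have [_ /(_ phi ph)[_ G0 _ _]] := fG.
    by have := G0 x y Ux y0; rewrite GE // ler0_sqrtr // ltxx.
  by split=> //; rewrite GE // powR12_sqrt.
Qed.

End Manifold.

(** * The Riemannian metric of Loewner ellipsoids *)

Section LoewnerMetric.
Variables (R : realType) (n m : nat) (M : smooth_manifold R n).
Variables (a : components M) (F : TM_function M).
Implicit Types (phi psi : chart R n M).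
Hypothesis m2 : (2 <= m)%N.
Hypothesis hF : mth_root_metric m a F.

(** F^2 written as a function of A alone, the shape required for parallel transport to preserve
    it. *)
Definition square phi x y : R := Aform m (a phi) x y `^ (2 / m%:R).

Lemma squareE phi x y : atlas phi -> cimage phi x -> square phi x y = F phi x y ^+ 2.
Proof.
move=> ph Ux; rewrite (root_E hF ph y Ux) -powR_mulrn ?powR_ge0 // -powRrM.
by rewrite mulrC.
Qed.

Lemma square0 phi x : square phi x 0 = 0.
Proof.
rewrite /square -(scale0r (0 : 'rV[R]_n)) Aform_scale expr0n.
have -> : (m == 0)%N = false by lia.
by rewrite mul0r powR0 // mulf_neq0 ?pnatr_eq0 // invr_eq0 (m_neq0 R m2).
Qed.

Lemma square_gt0 phi x y : atlas phi -> cimage phi x -> y != 0 -> 0 < square phi x y.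
Proof. by move=> ph Ux y0; rewrite powR_gt0 // (root_A_gt0 m2 hF ph Ux). Qed.

(** A Finsler metric is homogeneous for positive factors only. For negative ones, A (- y) is A y up
    to the sign given by the parity of m, and positivity of A at both vectors excludes odd m when y
    is not 0. *)
Lemma square_scale phi x c y : atlas phi -> cimage phi x ->
  square phi x (c *: y) = c ^+ 2 * square phi x y.
Proof.
move=> ph Ux.
have pos b z : 0 < b -> square phi x (b *: z) = b ^+ 2 * square phi x z.
  move=> b0; have [[_ /(_ phi ph)[_ _ hom _]] _] := hF.
  by rewrite !squareE // hom // exprMn.
have neg z : square phi x (- z) = square phi x z.
  have [->|z0] := eqVneq z 0; first by rewrite oppr0.
  have z1 : - z != 0 by rewrite oppr_eq0.
  have A0 := root_A_gt0 m2 hF ph Ux z0; have := root_A_gt0 m2 hF ph Ux z1.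
  rewrite /square -scaleN1r Aform_scale; case: (boolP (odd m)) => om.
    by rewrite -signr_odd om expr1 mulN1r oppr_gt0 ltNge ltW.
  by rewrite -signr_odd (negbTE om) expr0 mul1r.
have [->|c0] := eqVneq c 0; first by rewrite scale0r square0 expr0n mul0r.
have [c1|c1] := ltP 0 c; first exact: pos.
have c2 : 0 < - c by rewrite oppr_gt0 lt_neqAle c0.
by rewrite -[c *: y]opprK neg -scaleNr pos // sqrrN.
Qed.

Lemma Aform_Ck phi x (W : set 'rV[R]_n) k : open W -> Ck W k (Aform m (a phi) x).
Proof.
move=> oW; apply: (Ck_pform (c := fun _ => a phi x) (y := fun z => crd z) oW).
  by move=> I _; exact: Ck_cst.
by move=> i; exact: Ck_coord.
Qed.

Lemma square_continuous phi x : atlas phi -> cimage phi x -> continuous (square phi x).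
Proof.
move=> ph Ux y; have [->|y0] := eqVneq y 0; last first.
  have oW : open [set y : 'rV[R]_n | y != 0] by exact: open_nonzero.
  have C : Ck [set y : 'rV[R]_n | y != 0] 0 (square phi x).
    apply: (Ck_powR _ oW); last exact: Aform_Ck.
    by move=> z z0; exact: (root_A_gt0 m2 hF ph Ux).
  exact: (Ck_cont C).
have cA : {for 0, continuous (Aform m (a phi) x)}.
  exact: (Ck_cont (Aform_Ck phi x 0 openT)).
have A0 : Aform m (a phi) x 0 = 0.
  rewrite -(scale0r (0 : 'rV[R]_n)) Aform_scale expr0n; have -> : (m == 0)%N = false by lia.
  by rewrite mul0r.
have mn := m_neq0 R m2.
apply: (@cvgrPdist_le _ _ _ (nbhs (0 : 'rV[R]_n)) _ _ _).2 => e e0.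
have d0 : 0 < e `^ (m%:R / 2) by rewrite powR_gt0.
have /cvgrPdist_lt /(_ _ d0) := cA; rewrite A0; apply: filterS => z.
rewrite !sub0r square0 sub0r !normrN => zd.
have Az : 0 <= Aform m (a phi) x z.
  by have [->|z0] := eqVneq z 0; [rewrite A0|rewrite ltW // (root_A_gt0 m2 hF ph Ux)].
rewrite ger0_norm ?powR_ge0 //.
have -> : e = (e `^ (m%:R / 2)) `^ (2 / m%:R).
  by rewrite -powRrM (_ : _ * _ = 1) ?powRr1 ?ltW //; field.
apply: ge0_ler_powR; rewrite ?nnegrE ?powR_ge0 //.
by apply: ltW; apply: le_lt_trans zd; exact: ler_norm.
Qed.

Definition loewner_matrix phi x : 'M[R]_n :=
  xget 0 [set H | loewner (square phi x) H /\ 0 < \det H].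

Lemma loewner_matrixP phi x : atlas phi -> cimage phi x ->
  loewner (square phi x) (loewner_matrix phi x) /\ 0 < \det (loewner_matrix phi x).
Proof.
move=> ph Ux; rewrite /loewner_matrix; apply: (@xgetPex _ 0 [set H | loewner (square phi x) H /\ 0 < \det H]).
have [|||H lH H0] := @loewner_exists R n (square phi x); last by exists H.
- exact: square_continuous.
- by move=> y; exact: square_gt0.
- by move=> c y; exact: square_scale.
Qed.

Lemma loewner_matrix_pd phi x y : atlas phi -> cimage phi x -> y != 0 ->
  0 < qf (loewner_matrix phi x) y.
Proof. by move=> ph Ux; have [lo d0] := loewner_matrixP ph Ux; exact: loewner_pd d0 lo y. Qed.

(** Invariance of F makes the pulled-back form a Loewner form at x, and there is only one. *)
Lemma loewner_matrix_transition phi psi x : atlas phi -> atlas psi -> overlap phi psi x ->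
  loewner_matrix phi x = jacobian phi psi x *m loewner_matrix psi (transition phi psi x)
    *m (jacobian phi psi x)^T.
Proof.
move=> ph ps Ox; have [Ux dp] := (overlapP _ _ _).1 Ox.
have [Ux' _] := (overlapP _ _ _).1 (transition_image Ox).
have [lo d0] := loewner_matrixP ph Ux; have [lo' _] := loewner_matrixP ps Ux'.
have [uJ _] := mulmx1_unit (jacobianM ph ps Ox).
apply: (loewner_unique d0 lo).
have -> : square phi x = fun y => square psi (transition phi psi x) (y *m jacobian phi psi x).
  apply/funext => y; rewrite !squareE //; congr (_ ^+ 2).
  have [[inv _] _] := hF; rewrite (inv phi psi ph ps x y Ox).
  by have [_ ->] := transition_derive y ph ps Ox.
exact: loewner_congr.
Qed.

Definition loewner_coef phi x i j : R := loewner_matrix phi x i j.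
Definition loewner_metric : TM_function M := fun phi x y => Num.sqrt (qf (loewner_matrix phi x) y).

Hypothesis smooth_L : forall phi, atlas phi -> forall i j,
  smooth (cimage phi) (fun x => loewner_coef phi x i j).

Lemma loewner_matrix_sym phi x i j : atlas phi -> cimage phi x ->
  loewner_coef phi x i j = loewner_coef phi x j i.
Proof.
move=> ph Ux; have [[[sH _ _] _] _] := loewner_matrixP ph Ux.
by rewrite /loewner_coef -[in LHS]sH mxE.
Qed.

Lemma loewner_Aform phi x y :
  Aform 2 (quadratic_components loewner_coef phi) x y = qf (loewner_matrix phi x) y.
Proof. by rewrite quadratic_Aform. Qed.

Lemma loewner_riemannian : riemannian_metric loewner_metric.
Proof.
have qf_gt0 := loewner_matrix_pd.
split; last first.
  exists loewner_coef => phi ph; split.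
  - exact: smooth_L.
  - by move=> x i j Ux; exact: loewner_matrix_sym.
  - by [].
split.
  move=> phi psi ph ps x y Ox; rewrite /loewner_metric (loewner_matrix_transition ph ps Ox).
  by rewrite qf_congr; have [_ ->] := transition_derive y ph ps Ox.
move=> phi ph; split.
- move=> k; pose W := [set z : 'rV[R]_n * 'rV[R]_n | cimage phi z.1 /\ z.2 != 0].
  have oW : open W.
    have o1 := @open_fst R n n (cimage phi) (@cimage_openP R n M phi).
    have o2 : open [set z : 'rV[R]_n * 'rV[R]_n | z.2 != 0].
      apply: (@open_comp _ _ (@snd 'rV[R]_n 'rV[R]_n) [set y | y != 0]).
        by move=> z _; exact: cvg_snd.
      exact: open_nonzero.
    exact: openI o1 o2.
  have C2 i : Ck W k (fun z : 'rV[R]_n * 'rV[R]_n => z.2 ord0 i).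
    exact: (Ck_mx _ _ oW).1 (Ck_snd k oW) ord0 i.
  have C : Ck W k (fun z : 'rV[R]_n * 'rV[R]_n => qf (loewner_matrix phi z.1) z.2).
    apply: (Ck_sum _ oW) => i _; apply: (Ck_sum _ oW) => j _.
    apply: (Ck_mul oW _ (C2 j)); apply: (Ck_mul oW _ (C2 i)).
    apply: (Ck_comp_fst (@cimage_openP R n M phi) oW _ (smooth_L ph i j k)).
    by move=> z [].
  have C' := Ck_powR 2^-1 oW _ C.
  apply: (Ck_eq oW _ (C' _)); last by move=> z [Uz z0]; exact: qf_gt0.
  move=> z [Uz z0]; rewrite /loewner_metric powR12_sqrt //.
  by apply: ltW; exact: qf_gt0.
- by move=> x y Ux y0; rewrite /loewner_metric sqrtr_gt0 qf_gt0.
- move=> x y l Ux l0; rewrite /loewner_metric qf_scale sqrtrM ?sqr_ge0 //.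
  by rewrite sqrtr_sqr gtr0_norm.
- move=> x y v Ux y0 v0.
  have sL : forall z, cimage phi z -> symk 2 (quadratic_components loewner_coef phi z).
    by move=> z Uz; apply: quadratic_symk => i j; exact: loewner_matrix_sym.
  have Apos z w : cimage phi z -> w != 0 -> 0 < Aform 2 (quadratic_components loewner_coef phi) z w.
    by move=> Uz w0; rewrite loewner_Aform qf_gt0.
  (* For m = 2 the expression of [root_hessian] collapses to the coefficients of the quadratic
     form. *)
  have E : forall i j, fundamental_tensor loewner_metric phi x y i j = loewner_coef phi x i j.
    move=> i j; have := @root_hessian R n 2 (cimage phi) _ isT sL Apos (loewner_metric phi x) x y i j Ux y0 _.
    rewrite /fundamental_tensor => ->.
      have -> : 2 / 2%:R - 2 = -1 :> R by field.
      rewrite powR_inv1 ?ltW ?Apos // (_ : (2%:R - 1) = 1); last by rewrite [LHS]addrK.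
      rewrite mul1r subrK mulrA mulVf ?mul1r ?gt_eqF ?Apos //.
    move=> z; rewrite /loewner_metric loewner_Aform powR12_sqrt //.
    by have [->|z0] := eqVneq z 0; [rewrite qf0|rewrite ltW // qf_gt0].
  by under eq_bigr do under eq_bigr do rewrite E; exact: qf_gt0.
Qed.

End LoewnerMetric.

(** * From the equation to a projective Riemannian metric *)

Section Backward.
Variables (R : realType) (n m : nat).

Lemma smooth_theta (U : set 'rV[R]_n) (b : 'rV[R]_n -> seq 'I_n -> R) Gam i :
  open U -> (forall I, size I = m -> smooth U (b ^~ I)) -> (2 <= m)%N ->
  (forall x, U x -> symk m (b x)) ->
  (forall i j k, smooth U (fun x => Gam x i j k)) ->
  (forall x y, U x -> y != 0 -> 0 < Aform m b x y) ->
  smooth U (fun x => theta m b Gam x i).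
Proof.
move=> oU Cb m2 sb CG A0 k.
have e0 : basis_vec R i != 0 :> 'rV[R]_n.
  apply/eqP => /rowP /(_ i); rewrite !mxE !eqxx => /eqP.
  by rewrite oner_eq0.
have Cp d (c : 'rV[R]_n -> seq 'I_n -> R) : (forall I, size I = d -> Ck U k (c ^~ I)) ->
    Ck U k (fun x => pform d (c x) (crd (basis_vec R i))).
  move=> Cc; apply: (Ck_pform (y := fun _ => crd (basis_vec R i)) oU Cc) => j.
  exact: Ck_cst.
apply: (Ck_mul oU); last first.
  apply: (Ck_inv oU); first by move=> x Ux; rewrite gt_eqF // A0.
  by apply: Cp => I sI; exact: Cb.
apply: (Ck_sub_fun oU).
  apply: (Ck_sum _ oU) => l _; apply: (Ck_mull _ oU); apply: Cp => I sI.
  by have := smooth_da Cb l sI k.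
apply: (Ck_mull _ oU); apply: (Ck_sum _ oU) => j _; apply: (Ck_mul oU).
  apply: (Ck_sum _ oU) => p _; apply: (Ck_sum _ oU) => q _.
  by do 2!apply: (Ck_mul oU _ (Ck_cst _ _ oU)); exact: CG.
by apply: Cp => I sI; apply: Cb; rewrite /= sI; lia.
Qed.

(** Removing the torsion gives [Gs], and absorbing theta gives [Gt], for which A is parallel and
    therefore the Loewner form as well. F and the Loewner metric then satisfy Rapcsak's equation for
    the same connection. *)
Theorem riemann_projective_of_equation (M : smooth_manifold R n) (a : components M)
    (F : TM_function M) (Gam : chart R n M -> 'rV[R]_n -> 'I_n -> 'I_n -> 'I_n -> R) :
  (2 <= m)%N -> mth_root_metric m a F ->
  (forall phi, atlas phi -> forall i j k, smooth (cimage phi) (fun x => Gam phi x i j k)) ->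
  (forall phi, atlas phi -> forall x, cimage phi x ->
    forall y i, rapcsak m (a phi) (Gam phi) x y i) ->
  riemann_projective F.
Proof.
move=> m2 hF CG rap.
pose Gs phi := symmetric_part (Gam phi).
pose Gt phi := correct_connection m (Gs phi) (theta m (a phi) (Gs phi)).
have sGs phi x j k l : Gs phi x j k l = Gs phi x j l k.
  by rewrite /Gs /symmetric_part addrC.
have sGt phi x j k l : Gt phi x j k l = Gt phi x j l k.
  by rewrite /Gt /correct_connection sGs; ring.
have CGs phi : atlas phi -> forall i j k, smooth (cimage phi) (fun x => Gs phi x i j k).
  move=> ph i j k d; have oU := @cimage_openP R n M phi.
  apply: (Ck_mull _ oU); apply: (Ck_add oU); exact: CG.
have rapS phi : atlas phi -> forall x y i, cimage phi x -> rapcsak m (a phi) (Gs phi) x y i.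
  move=> ph x y i Ux; apply: (eq_rapcsak (Gam := Gam phi)); last exact: rap.
  by move=> j; rewrite spray_symmetric_part.
have CGt phi : atlas phi -> forall i j k, smooth (cimage phi) (fun x => Gt phi x i j k).
  move=> ph i j k d; have oU := @cimage_openP R n M phi.
  have Cth l : smooth (cimage phi) (fun x => theta m (a phi) (Gs phi) x l).
    apply: (smooth_theta l oU (root_smooth hF ph) m2 (root_sym hF ph) (CGs phi ph)).
    by move=> z w Uz w0; exact: (root_A_gt0 m2 hF ph Uz w0).
  apply: (Ck_add oU); first exact: CGs.
  by apply: (Ck_mull _ oU); apply: (Ck_add oU); apply: (Ck_mull _ oU); exact: Cth.
have par phi : atlas phi -> forall x, cimage phi x -> parallel m (a phi) (Gt phi) x.
  move=> ph x Ux; have oU := @cimage_openP R n M phi.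
  apply: (parallel_correction oU m2 (root_sym hF ph) (root_A_gt0 m2 hF ph) Ux) => //.
    by move=> y i; exact: rapS.
  move=> y; apply: (Bform_factor oU m2 (root_smooth hF ph) (CGs phi ph) (root_sym hF ph)) => //.
    by move=> z w Uz w0; exact: (root_A_gt0 m2 hF ph Uz w0).
  by move=> z w i Uz; exact: rapS.
have cont phi : atlas phi -> forall x y, cimage phi x ->
    {for x, continuous (fun x => square m a phi x y)}.
  move=> ph x y Ux; have oU := @cimage_openP R n M phi.
  have [->|y0] := eqVneq y 0.
    rewrite (_ : (fun x => _) = fun=> 0); first exact: (Ck_cont (Ck_cst 0 (0 : R) oU) Ux).
    by apply/funext => z; exact: square0.
  have C : Ck (cimage phi) 0 (fun x => square m a phi x y).
    apply: (Ck_powR _ oU); first by move=> z Uz; exact: (root_A_gt0 m2 hF ph Uz y0).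
    apply: (Ck_pform (c := a phi) (y := fun _ => crd y) oU).
      by move=> I sI; exact: (root_smooth hF ph sI 0).
    by move=> i; exact: Ck_cst.
  exact: (Ck_cont C Ux).
pose det_pos phi (ph : atlas phi) x Ux := (loewner_matrixP m2 hF ph (x := x) Ux).2.
pose lo phi (ph : atlas phi) x Ux := (loewner_matrixP m2 hF ph (x := x) Ux).1.
have smL phi : atlas phi -> forall i j, smooth (cimage phi) (fun x => loewner_coef m a phi x i j).
  move=> ph i j.
  exact: (invariant_smooth (phi := fun r => r `^ (2 / m%:R)) (@cimage_openP R n M phi)
    (root_smooth hF ph) (root_sym hF ph) (CGt phi ph) (par phi ph) (cont phi ph)
    (det_pos phi ph) (lo phi ph)).
have hG := loewner_riemannian m2 hF smL.
exists (loewner_metric m a); split=> //.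
have oU phi := @cimage_openP R n M phi.
pose b := quadratic_components (loewner_coef m a).
have sb phi : atlas phi -> forall x, cimage phi x -> symk 2 (b phi x).
  by move=> ph x Ux; apply: quadratic_symk => i j; exact: (loewner_matrix_sym m2 hF).
have hG2 : mth_root_metric 2 b (loewner_metric m a).
  split; first exact: hG.1.
  move=> phi ph; split; last first.
  - move=> x y Ux; rewrite mform_Aform loewner_Aform /loewner_metric.
    have P : 0 <= qf (loewner_matrix m a phi x) y.
      by have [[_ p _] _] := lo phi ph x Ux; exact: p.
    by split=> //; rewrite powR12_sqrt.
  - by move=> x I J Ux; exact: sb.
  - by move=> [|i [|j [|k I]]] //= _; exact: smL.
apply: (projective_of_rapcsak (Gam := Gt) m2 (isT : (2 <= 2)%N) hF hG2).
  move=> phi ph x y i Ux.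
  exact: (rapcsak_of_parallel (oU phi) m2 (root_sym hF ph) y i Ux (sGt phi x) (par phi ph x Ux)).
move=> phi ph x y i Ux.
apply: (rapcsak_of_parallel (m := 2) (oU phi) isT (sb phi ph) y i Ux (sGt phi x)) => k z.
have D p q : da (b phi) x [:: p; q] k = \sum_(l < n) (Gt phi x l k p * loewner_coef m a phi x l q
    + Gt phi x l k q * loewner_coef m a phi x p l).
  have H := invariant_derive (phi := fun r => r `^ (2 / m%:R)) (@cimage_openP R n M phi)
    (root_smooth hF ph) (root_sym hF ph) (CGt phi ph) (par phi ph)
    (det_pos phi ph) (lo phi ph) (basis_vec R k) p q Ux.
  rewrite /da /partial; have [_ ->] := H; rewrite /nablaL (bigD1 k) //= [X in _ + X]big1.
    by rewrite mxE !eqxx mul1r addr0.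
  by move=> r rk; rewrite mxE (negbTE rk) andbF mul0r.
exact: (@quadratic_parallel R n M (loewner_coef m a) phi x (Gt phi) k z (fun i j => loewner_matrix_sym m2 hF i j ph Ux) D).
Qed.

End Backward.

(** * The Levi-Civita connection and its geodesics *)

Section MetricConnection.
Variables (R : realType) (n : nat).
Implicit Types (H : 'M[R]_n) (C D : 'I_n -> 'I_n -> 'I_n -> R).

Definition metric_compatible H D C : Prop := forall k i j,
  D k i j = \sum_(l < n) (C l k i * H l j + C l k j * H i l).

(* The difference of two such connections, with its upper index lowered, is
   symmetric in its first two indices and antisymmetric in the last two. *)
Lemma metric_connection_unique H D C C' : H^T = H -> H \in unitmx ->
  (forall l p q, C l p q = C l q p) -> (forall l p q, C' l p q = C' l q p) ->
  metric_compatible H D C -> metric_compatible H D C' ->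
  forall l p q, C l p q = C' l p q.
Proof.
move=> sH uH sC sC' mC mC' l p q.
pose Y p q r := \sum_(l < n) (C l p q - C' l p q) * H l r.
have Hs i j : H i j = H j i by rewrite -[in LHS]sH mxE.
have Ys p' q' r' : Y p' q' r' = Y q' p' r'.
  by apply: eq_bigr => i _; rewrite sC sC'.
have Ya p' q' r' : Y p' q' r' = - Y p' r' q'.
  apply/eqP; rewrite -subr_eq0 opprK; apply/eqP.
  have := mC p' q' r'; rewrite (mC' p' q' r') => /esym /eqP; rewrite -subr_eq0 -sumrB => /eqP <-.
  rewrite -big_split; apply: eq_bigr => i _ /=; rewrite (Hs q' i); ring.
have Y0 p' q' r' : Y p' q' r' = 0.
  have E : Y p' q' r' = - Y p' q' r'.
    rewrite {1}Ya Ys Ya opprK Ys Ya Ys; by [].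
  by clear -E; lra.
pose X : 'rV[R]_n := \row_i (C i p q - C' i p q).
have X0 : X *m H = 0.
  apply/rowP => r; rewrite !mxE -[RHS](Y0 p q r).
  by apply: eq_bigr => i _; rewrite mxE.
have /rowP /(_ l) : X = 0 by rewrite -[X](mulmxK uH) X0 mul0mx.
by rewrite !mxE => /eqP; rewrite subr_eq0 => /eqP.
Qed.

(** Koszul's formula, with D k i j in the role of the derivative of H i j in x^k. *)
Definition levi_civita H D i j k : R :=
  \sum_(l < n) invmx H i l * (2^-1 * (D j l k + D k l j - D l j k)).

Lemma levi_civita_sym H D i j k : (forall k i j, D k i j = D k j i) ->
  levi_civita H D i j k = levi_civita H D i k j.
Proof.
by move=> sD; apply: eq_bigr => l _; rewrite (sD l j k) [D j l k + _]addrC.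
Qed.

Lemma levi_civita_compatible H D : H^T = H -> H \in unitmx ->
  (forall k i j, D k i j = D k j i) -> metric_compatible H D (levi_civita H D).
Proof.
move=> sH uH sD k i j.
have low p q r : \sum_(l < n) levi_civita H D l p q * H l r =
    2^-1 * (D p r q + D q r p - D r p q).
  have Hs i' j' : H i' j' = H j' i' by rewrite -[in LHS]sH mxE.
  transitivity (\sum_(s < n) (H *m invmx H) r s * (2^-1 * (D p s q + D q s p - D s p q))).
    rewrite /levi_civita; under eq_bigr do rewrite mulr_suml.
    rewrite exchange_big; apply: eq_bigr => s _ /=; rewrite mxE mulr_suml.
    by apply: eq_bigr => l _; rewrite (Hs r l); ring.
  rewrite mulmxV // (bigD1 r) //= mxE eqxx mul1r big1 ?addr0 // => s sr.
  by rewrite mxE eq_sym (negbTE sr) mul0r.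
have Hs i' j' : H i' j' = H j' i' by rewrite -[in LHS]sH mxE.
rewrite big_split /= low.
under [X in _ + X]eq_bigr do rewrite Hs.
rewrite low (sD k j i) (sD j k i) (sD i k j) (sD j i k).
by field.
Qed.

Lemma qf_inj H H' : H^T = H -> H'^T = H' -> (forall y, qf H y = qf H' y) -> H = H'.
Proof.
move=> sH sH' E.
have bE A i j : bf A (basis_vec R i) (basis_vec R j) = A i j.
  by rewrite /bf /basis_vec trmx_delta -rowE -colE !mxE.
apply/matrixP => i j; rewrite -!bE.
have := E (basis_vec R i + basis_vec R j).
by rewrite !qfD // !E => /addIr /addrI /mulfI; apply; rewrite pnatr_eq0.
Qed.

End MetricConnection.

Section LeviCivita.
Variables (R : realType) (n : nat) (M : smooth_manifold R n).
Variables (G : TM_function M) (h : chart R n M -> 'rV[R]_n -> 'I_n -> 'I_n -> R).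
Implicit Types (phi psi : chart R n M).
Hypothesis hG : mth_root_metric 2 (quadratic_components h) G.
Hypothesis smooth_h : forall phi, atlas phi -> forall i j,
  smooth (cimage phi) (fun x => h phi x i j).

Definition hmx phi x : 'M[R]_n := \matrix_(i, j) h phi x i j.
Definition dh phi x k i j : R := partial k (fun x => h phi x i j) x.
Definition christoffel phi x : 'I_n -> 'I_n -> 'I_n -> R := levi_civita (hmx phi x) (dh phi x).

Lemma h_sym phi x i j : atlas phi -> cimage phi x -> h phi x i j = h phi x j i.
Proof.
move=> ph Ux; have := root_sym hG ph Ux (I := [:: i; j]) (J := [:: j; i]) erefl.
by apply; rewrite (perm_catC [:: i] [:: j]).
Qed.

Lemma hmx_sym phi x : atlas phi -> cimage phi x -> (hmx phi x)^T = hmx phi x.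
Proof. by move=> ph Ux; apply/matrixP => i j; rewrite !mxE h_sym. Qed.

Lemma qf_hmx phi x y : qf (hmx phi x) y = Aform 2 (quadratic_components h phi) x y.
Proof.
rewrite quadratic_Aform; apply: eq_bigr => i _; apply: eq_bigr => j _.
by rewrite mxE.
Qed.

Lemma hmx_unit phi x : atlas phi -> cimage phi x -> hmx phi x \in unitmx.
Proof.
move=> ph Ux; apply: pd_unitmx => y y0; rewrite qf_hmx.
exact: (root_A_gt0 (m := 2) isT hG ph Ux y0).
Qed.

Lemma dh_sym phi x k i j : atlas phi -> cimage phi x -> dh phi x k i j = dh phi x k j i.
Proof.
move=> ph Ux; rewrite /dh /partial; apply: near_eq_derive.
have : nbhs x (cimage phi) by apply: open_nbhs_nbhs; split=> //; exact: cimage_open.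
by apply: filterS => z Uz; exact: h_sym.
Qed.

Lemma christoffel_sym phi x i j k : atlas phi -> cimage phi x ->
  christoffel phi x i j k = christoffel phi x i k j.
Proof. by move=> ph Ux; apply: levi_civita_sym => *; exact: dh_sym. Qed.

Lemma christoffel_smooth phi i j k : atlas phi ->
  smooth (cimage phi) (fun x => christoffel phi x i j k).
Proof.
move=> ph d; have oU := @cimage_openP R n M phi.
have Cd p q r : Ck (cimage phi) d (fun x => dh phi x p q r) by exact: Ck_D (smooth_h ph q r d.+1).
apply: (Ck_sum _ oU) => l _; apply: (Ck_mul oU).
  apply: (Ck_inv_mx i l oU); first by move=> x Ux; exact: hmx_unit.
  move=> p q; apply: (Ck_eq oU _ (smooth_h ph p q d)) => x _.
  by rewrite mxE.
by apply: (Ck_mull _ oU); apply: (Ck_sub_fun oU) => //; apply: (Ck_add oU).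
Qed.

Lemma christoffel_compatible phi x : atlas phi -> cimage phi x ->
  metric_compatible (hmx phi x) (dh phi x) (christoffel phi x).
Proof.
move=> ph Ux; apply: levi_civita_compatible; [exact: hmx_sym|exact: hmx_unit|].
by move=> k i j; exact: dh_sym.
Qed.

Lemma christoffel_parallel phi x : atlas phi -> cimage phi x ->
  parallel 2 (quadratic_components h phi) (christoffel phi) x.
Proof.
move=> ph Ux k z.
have D p q : da (quadratic_components h phi) x [:: p; q] k =
    \sum_(l < n) (christoffel phi x l k p * h phi x l q + christoffel phi x l k q * h phi x p l).
  have := christoffel_compatible ph Ux k p q; rewrite /dh => E.
  transitivity (partial k (fun x => h phi x p q) x); first by [].
  by rewrite E; apply: eq_bigr => l _; rewrite !mxE.
exact: (@quadratic_parallel R n M h phi x (christoffel phi) k z (fun i j => h_sym i j ph Ux) D).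
Qed.

Lemma hmx_transition phi psi x : atlas phi -> atlas psi -> overlap phi psi x ->
  hmx phi x = jacobian phi psi x *m hmx psi (transition phi psi x) *m (jacobian phi psi x)^T.
Proof.
move=> ph ps Ox; have [Ux dp] := (overlapP _ _ _).1 Ox.
have [Ux' _] := (overlapP _ _ _).1 (transition_image Ox).
apply: qf_inj; first exact: hmx_sym.
  by rewrite !trmx_mul trmxK hmx_sym // mulmxA.
move=> y; rewrite qf_congr !qf_hmx.
have sqE ch z w : atlas ch -> cimage ch z -> Aform 2 (quadratic_components h ch) z w = G ch z w ^+ 2.
  move=> pc Uz; have := squareE hG w pc Uz; rewrite /square => <-.
  rewrite divff ?pnatr_eq0 // powRr1 //; have [->|w0] := eqVneq w 0.
    by rewrite -qf_hmx qf0.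
  by rewrite ltW // (root_A_gt0 (m := 2) isT hG pc Uz w0).
rewrite !sqE //; congr (_ ^+ 2).
have [[inv _] _] := hG; rewrite (inv phi psi ph ps x y Ox).
by have [_ ->] := transition_derive y ph ps Ox.
Qed.

(** Inverse matrices are not differentiated: the coefficients prescribed by the transformation rule
    are shown to be symmetric and compatible with the metric of the new chart, and
    [metric_connection_unique] concludes. *)
Lemma christoffel_connection : linear_connection christoffel.
Proof.
split; first by move=> phi ph i j k; exact: christoffel_smooth.
move=> phi psi ph ps x Ox l p q x'.
have Ox' : overlap psi phi x' := transition_image Ox.
have xE : transition psi phi x' = x := transitionK Ox.
have [Ux _] := (overlapP _ _ _).1 Ox; have [Ux' _] := (overlapP _ _ _).1 Ox'.
pose J := jacobian phi psi x; pose K := jacobian psi phi x'.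
have KJ : K *m J = 1%:M by apply: mulmx1C; exact: jacobianM.
pose d2 p q i := partial p (partial q (transition_coord psi phi i)) x'.
have d2s p' q' i : d2 p' q' i = d2 q' p' i.
  exact: Schwarz (@overlap_open R n M psi phi) (smooth_transition i ps ph 2) Ox'.
(* E is the bracket of the transformation rule and C its right-hand side; contracting C with K, the
   inverse of J, returns E. *)
pose E p q i := \sum_(j < n) \sum_(k < n) christoffel phi x i j k * K p j * K q k + d2 p q i.
pose C l p q := \sum_(i < n) J i l * E p q i.
have Es p' q' i : E p' q' i = E q' p' i.
  rewrite /E d2s; congr (_ + _); rewrite exchange_big; apply: eq_bigr => j _.
  by apply: eq_bigr => k _ /=; rewrite christoffel_sym //; ring.
have CE p' q' i : \sum_(s < n) C s p' q' * K s i = E p' q' i.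
  transitivity (\sum_(r < n) (J *m K) r i * E p' q' r).
    rewrite /C; under eq_bigr do rewrite mulr_suml.
    rewrite exchange_big; apply: eq_bigr => r _ /=; rewrite mxE mulr_suml.
    by apply: eq_bigr => s _; ring.
  rewrite (mulmx1C KJ) (bigD1 i) //= mxE eqxx mul1r big1 ?addr0 // => r ri.
  by rewrite mxE (negbTE ri) mul0r.
have hE z p' q' : overlap psi phi z -> h psi z p' q' = \sum_(i < n) \sum_(j < n)
    partial p' (transition_coord psi phi i) z * partial q' (transition_coord psi phi j) z
      * h phi (transition psi phi z) i j.
  move=> Oz; have /matrixP /(_ p' q') := hmx_transition ps ph Oz.
  rewrite [LHS]mxE => ->; rewrite mxE exchange_big; apply: eq_bigr => j _.
  rewrite !mxE mulr_suml; apply: eq_bigr => i _; rewrite !mxE; ring.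
(* The transformation law of h is differentiated: second derivatives of the coordinates come from
   the Jacobians, and the derivatives of h are replaced by Christoffel terms. The two together make
   up E. *)
have compC : metric_compatible (hmx psi x') (dh psi x') C.
  move=> r p' q'.
  have hx' i j : h psi x' i j = \sum_(i' < n) \sum_(j' < n) K i i' * K j j' * h phi x i' j'.
    rewrite hE // xE; apply: eq_bigr => i' _; apply: eq_bigr => j' _.
    by rewrite !mxE.
  have dK s i : is_derive x' (basis_vec R r) (partial s (transition_coord psi phi i)) (d2 r s i).
    exact: (Ck_derive _ (Ck_D _ (smooth_transition i ps ph 2)) Ox').
  have dhS i j : is_derive x' (basis_vec R r) (fun z => h phi (transition psi phi z) i j)
      (\sum_(k < n) K r k * dh phi x k i j).
    have Us : cimage phi (transition psi phi x') by rewrite xE.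
    have H := isd_comp (@cimage_openP R n M phi) (smooth_h ph i j 1) Us
      (transition_derive (basis_vec R r) ps ph Ox').
    apply: is_derive_eq H _; apply: eq_bigr => k _.
    by rewrite xE -rowE [row _ _ _ _]mxE mulrC.
  have D : is_derive x' (basis_vec R r) (fun z => h psi z p' q')
     (\sum_(i < n) \sum_(j < n) ((d2 r p' i * K q' j + K p' i * d2 r q' j) * h phi x i j
        + K p' i * K q' j * \sum_(k < n) K r k * dh phi x k i j)).
    apply: (isd_near (@overlap_open R n M psi phi) Ox' (fun z Oz => esym (hE z p' q' Oz))).
    apply: isd_sum => i _; apply: isd_sum => j _.
    have H := isd_mul (isd_mul (dK p' i) (dK q' j)) (dhS i j).
    by apply: is_derive_eq H _; rewrite xE !mxE.
  rewrite /dh /partial; have [_ ->] := D.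
  transitivity (\sum_(i < n) \sum_(j < n) (E r p' i * K q' j + K p' i * E r q' j) * h phi x i j).
    pose P s i := \sum_(j < n) \sum_(k < n) christoffel phi x i j k * K r j * K s k.
    transitivity (\sum_(i < n) \sum_(j < n) (d2 r p' i * K q' j + K p' i * d2 r q' j) * h phi x i j
      + \sum_(i < n) \sum_(j < n) (P p' i * K q' j + K p' i * P q' j) * h phi x i j); last first.
      rewrite -big_split; apply: eq_bigr => i _; rewrite -big_split; apply: eq_bigr => j _ /=.
      have alg (d d' u v w w' t : R) : ((w + d) * u + v * (w' + d')) * t =
        (d * u + v * d') * t + (w * u + v * w') * t by ring.
      by symmetry; exact: alg.
    under eq_bigr do rewrite big_split /=.
    rewrite big_split /=; congr (_ + _).
    have comp k i j : dh phi x k i j = \sum_(s < n) (christoffel phi x s k i * h phi x s j +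
        christoffel phi x s k j * h phi x i s).
      rewrite (christoffel_compatible ph Ux k i j); apply: eq_bigr => s _.
      by rewrite !mxE.
    transitivity (\sum_(i < n) \sum_(j < n) \sum_(k < n) \sum_(s < n)
        (K p' i * K q' j * K r k * christoffel phi x s k i * h phi x s j)
      + \sum_(i < n) \sum_(j < n) \sum_(k < n) \sum_(s < n)
        (K p' i * K q' j * K r k * christoffel phi x s k j * h phi x i s)).
      rewrite -big_split; apply: eq_bigr => i _; rewrite -big_split; apply: eq_bigr => j _ /=.
      rewrite mulr_sumr -big_split; apply: eq_bigr => k _ /=.
      rewrite comp -big_split !mulr_sumr; apply: eq_bigr => s _ /=; ring.
    transitivity (\sum_(i < n) \sum_(j < n) P p' i * K q' j * h phi x i j
      + \sum_(i < n) \sum_(j < n) K p' i * P q' j * h phi x i j); last first.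
      rewrite -big_split; apply: eq_bigr => i _; rewrite -big_split; apply: eq_bigr => j _ /=.
      ring.
    congr (_ + _).
      transitivity (\sum_(s < n) \sum_(j < n) \sum_(k < n) \sum_(i < n)
        (K p' i * K q' j * K r k * christoffel phi x s k i * h phi x s j)).
        under eq_bigr do under eq_bigr do rewrite exchange_big /=.
        under eq_bigr do rewrite exchange_big /=.
        rewrite exchange_big /=; apply: eq_bigr => s _.
        rewrite exchange_big /=; apply: eq_bigr => j _.
        by rewrite exchange_big.
      apply: eq_bigr => s _; apply: eq_bigr => j _; rewrite /P !mulr_suml.
      apply: eq_bigr => k _; rewrite !mulr_suml; apply: eq_bigr => i _; ring.
    apply: eq_bigr => i _.
    transitivity (\sum_(s < n) \sum_(k < n) \sum_(j < n)
        (K p' i * K q' j * K r k * christoffel phi x s k j * h phi x i s)).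
      under eq_bigr do rewrite exchange_big /=.
      rewrite exchange_big /=; apply: eq_bigr => s _.
      by rewrite exchange_big.
    apply: eq_bigr => s _; rewrite /P mulr_sumr mulr_suml; apply: eq_bigr => k _.
    rewrite mulr_sumr mulr_suml; apply: eq_bigr => j _; ring.
  transitivity (\sum_(s < n) C s r p' * h psi x' s q' + \sum_(s < n) C s r q' * h psi x' p' s); last first.
    by rewrite -big_split; apply: eq_bigr => s _; rewrite !mxE.
  transitivity (\sum_(i < n) \sum_(j < n) E r p' i * K q' j * h phi x i j
    + \sum_(i < n) \sum_(j < n) K p' i * E r q' j * h phi x i j).
    rewrite -big_split; apply: eq_bigr => i _; rewrite -big_split; apply: eq_bigr => j _ /=.
    by move: (E r p' i) (E r q' j) (K q' j) (K p' i) (h phi x i j) => *; ring.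
  congr (_ + _).
    under [RHS]eq_bigr do rewrite hx' mulr_sumr.
    rewrite [RHS]exchange_big; apply: eq_bigr => i _ /=.
    under [RHS]eq_bigr do rewrite mulr_sumr.
    rewrite [RHS]exchange_big; apply: eq_bigr => j _ /=.
    by rewrite -CE !mulr_suml; apply: eq_bigr => s _; ring.
  under [RHS]eq_bigr do rewrite hx' mulr_sumr.
  rewrite [RHS]exchange_big; apply: eq_bigr => i _ /=.
  under [RHS]eq_bigr do rewrite mulr_sumr.
  rewrite [RHS]exchange_big; apply: eq_bigr => j _ /=.
  by rewrite -CE mulr_sumr !mulr_suml; apply: eq_bigr => s _; ring.
have Cs s p' q' : C s p' q' = C s q' p' by apply: eq_bigr => i _; rewrite Es.
rewrite (metric_connection_unique (hmx_sym ps Ux') (hmx_unit ps Ux') _ Cs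
  (christoffel_compatible ps Ux') compC).
  rewrite /C; apply: eq_bigr => i _; rewrite /E /d2 /J /K mxE; congr (_ * (_ + _)).
  by apply: eq_bigr => j _; apply: eq_bigr => k _; rewrite !mxE.
by move=> s p' q'; exact: christoffel_sym.
Qed.

End LeviCivita.

(** * Geodesics parametrized by a coordinate *)

Section Pregeodesics.
Variables (R : realType) (n : nat).
Implicit Types (Gam : 'rV[R]_n -> 'I_n -> 'I_n -> 'I_n -> R).

(* Geodesics of a connection, parametrized by their [i0]-th coordinate. *)
Lemma pregeodesic_exists (U : set 'rV[R]_n) Gam (x0 y0 : 'rV[R]_n) (i0 : 'I_n) :
  open U -> U x0 -> (forall i j k, smooth U (fun x => Gam x i j k)) -> y0 ord0 i0 != 0 ->
  exists (e : R) (x y : R -> 'rV[R]_n) (c : R -> R),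
  [/\ 0 < e, x 0 = x0, y 0 = y0, smooth (ball (0 : R) e) x &
    forall t : R, ball 0 e t -> [/\ U (x t), is_derive t 1 x (y t),
      is_derive t 1 y (c t *: y t - \row_j spray Gam (x t) (y t) j) &
      y t ord0 i0 = y0 ord0 i0]].
Proof.
move=> oU Ux0 CG y00.
have subE (c : R) (u w : 'rV[R]_n) j : (c *: u - w) ord0 j = c * u ord0 j - w ord0 j.
  by rewrite !mxE.
pose l (y : 'rV[R]_n) : R := y ord0 i0 / y0 ord0 i0.
pose W : set 'rV[R]_(n + n) := [set s | U (lsubmx s)].
have cl : continuous (fun s : 'rV[R]_(n + n) => lsubmx s).
  move=> s; apply: (@cvg_mx R _ (nbhs s) _ 1 n (fun s => lsubmx s) (lsubmx s)).2 => i j; rewrite mxE.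
  rewrite (_ : (fun x => _) = fun x : 'rV[R]_(n + n) => x i (lshift n j)).
    exact: continuous_coord.
  by apply/funext => z; rewrite mxE.
have oW : open W by apply: open_comp.
(* The velocity is projected along y0 onto the hyperplane l = 1. Then l (Yf s) = 1 holds
   identically, and the flow need not be shown to preserve the hyperplane. *)
pose Yf (s : 'rV[R]_(n + n)) : 'rV[R]_n := rsubmx s + (1 - l (rsubmx s)) *: y0.
pose Sp (s : 'rV[R]_(n + n)) : 'rV[R]_n := \row_j spray Gam (lsubmx s) (Yf s) j.
(* The factor l (Sp s) cancels the [i0]-th component of the acceleration. *)
pose fld (s : 'rV[R]_(n + n)) : 'rV[R]_(n + n) := row_mx (Yf s) (l (Sp s) *: Yf s - Sp s).
have lY s : l (Yf s) = 1.
  by rewrite /l /Yf !mxE /l mxE; field.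
have Cl k : Ck W k (fun s => lsubmx s).
  apply/(Ck_mx _ _ oW) => i j.
  apply: (@Ck_eq _ _ _ _ _ (fun s : 'rV[R]_(n + n) => s ord0 (lshift n j)) _ oW); last exact: Ck_coord.
  by move=> s _; rewrite mxE (ord1 i).
have CY k j : Ck W k (fun s => Yf s ord0 j).
  apply: (@Ck_eq _ _ _ _ _ (fun s : 'rV[R]_(n + n) => s ord0 (rshift n j)
      + (1 - (y0 ord0 i0)^-1 * s ord0 (rshift n i0)) * y0 ord0 j) _ oW).
    by move=> s _; rewrite !mxE /l mxE; congr (_ + (_ - _) * _); rewrite mulrC.
  apply: (Ck_add oW); first exact: Ck_coord.
  apply: (Ck_mul oW); last exact: Ck_cst.
  apply: (Ck_sub_fun oW); first exact: Ck_cst.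
  by apply: (Ck_mull _ oW); exact: Ck_coord.
have CS k j : Ck W k (fun s => Sp s ord0 j).
  apply: (@Ck_eq _ _ _ _ _ (fun s => spray Gam (lsubmx s) (Yf s) j) _ oW).
    by move=> s _; rewrite mxE.
  apply: (Ck_sum _ oW) => p _; apply: (Ck_sum _ oW) => q _.
  apply: (Ck_mul oW _ (CY k q)); apply: (Ck_mul oW _ (CY k p)).
  exact: (Ck_comp oW oU (fun s Ws => Ws) (CG j p q k) (Cl k)).
have Cf : smooth W fld.
  move=> k; apply/(Ck_mx _ _ oW) => i j; rewrite (ord1 i).
  rewrite /fld; case: (split_ordP j) => r ->.
    apply: (@Ck_eq _ _ _ _ _ (fun s : 'rV[R]_(n + n) => Yf s ord0 r) _ oW); last exact: CY.
    by move=> s _; rewrite row_mxEl.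
  apply: (@Ck_eq _ _ _ _ _ (fun s : 'rV[R]_(n + n) =>
      ((y0 ord0 i0)^-1 * Sp s ord0 i0) * Yf s ord0 r - Sp s ord0 r) _ oW).
    by move=> s _; rewrite row_mxEr subE /l; congr (_ * _ - _); rewrite mulrC.
  apply: (Ck_sub_fun oW _ (CS k r)); apply: (Ck_mul oW _ (CY k r)).
  exact: (Ck_mull _ oW (CS k i0)).
have Ws : W (row_mx x0 y0) by rewrite /W /= row_mxKl.
have [e [s [e0 s0 sW ds Cs]]] := ODE_solution oW Ws Cf.
have oB : open (ball (0 : R) e) by exact: ball_open.
exists e, (fun t => lsubmx (s t)), (fun t => Yf (s t)), (fun t => l (Sp (s t))); split=> //.
- by rewrite s0 row_mxKl.
- by rewrite s0 /Yf row_mxKr /l divff // subrr scale0r addr0.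
- move=> k; apply/(Ck_mx _ _ oB) => i j.
  have := (Ck_mx _ _ oB).1 (Cs k) ord0 (lshift n j); apply: (Ck_eq oB) => t _.
  by rewrite mxE (ord1 i).
move=> t te; have /isd_mx dt := ds t te.
have dr j : is_derive t 1 (fun t => s t ord0 (rshift n j)) ((l (Sp (s t)) *: Yf (s t) - Sp (s t)) ord0 j).
  by apply: is_derive_eq (dt ord0 _) _; rewrite row_mxEr.
have l0 : (l (Sp (s t)) *: Yf (s t) - Sp (s t)) ord0 i0 = 0.
  have := lY (s t); rewrite /l => E; rewrite subE.
  have -> : Yf (s t) ord0 i0 = y0 ord0 i0.
    by rewrite -[LHS](divfK y00) E mul1r.
  by rewrite divfK // subrr.
split.
- exact: sW.
- apply/isd_mx => i j; rewrite (ord1 i).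
  rewrite (_ : (fun z => _) = fun z => s z ord0 (lshift n j)); last by apply/funext => z; rewrite mxE.
  by apply: is_derive_eq (dt ord0 _) _; rewrite row_mxEl.
- apply/isd_mx => i j; rewrite (ord1 i).
  rewrite (_ : (fun z => _) = fun z => s z ord0 (rshift n j)
      + (1 - s z ord0 (rshift n i0) * (y0 ord0 i0)^-1) * y0 ord0 j); last first.
    by apply/funext => z; rewrite !mxE /l mxE.
  have H := isd_add (dr j) (isd_mulr (y0 ord0 j)
    (isd_sub (isd_cst 1 t (1 : R)) (isd_mulr (y0 ord0 i0)^-1 (dr i0)))).
  by apply: is_derive_eq H _; rewrite l0 mul0r subrr mul0r addr0.
- by have := lY (s t); rewrite /l => E; rewrite -[LHS](divfK y00) E mul1r.
Qed.

Lemma spray_scale Gam x c (y : 'rV[R]_n) j : spray Gam x (c *: y) j = c ^+ 2 * spray Gam x y j.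
Proof.
rewrite /spray mulr_sumr; apply: eq_bigr => k _; rewrite mulr_sumr.
by apply: eq_bigr => l _; rewrite !mxE; ring.
Qed.

Lemma pform_crd_scale k (b : seq 'I_n -> R) c (y : 'rV[R]_n) :
  pform k b (crd (c *: y)) = c ^+ k * pform k b (crd y).
Proof.
rewrite -pform_homog; apply: eq_pform => // i; by rewrite /crd mxE.
Qed.

Lemma rapcsak_scale m b Gam x c (y : 'rV[R]_n) i : (2 <= m)%N -> c != 0 ->
  rapcsak m b Gam x (c *: y) i -> rapcsak m b Gam x y i.
Proof.
case: m => [|[|m]] // _ c0; rewrite /rapcsak /Bform; set M := m.+2.
have e1 : \sum_(k < n) (c *: y) ord0 k * dAform1 M b x i k (c *: y) =
    c ^+ M * \sum_(k < n) y ord0 k * dAform1 M b x i k y.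
  rewrite mulr_sumr; apply: eq_bigr => k _.
  by rewrite /dAform1 -[M.-1]/(m.+1) pform_crd_scale mxE !exprS; ring.
have e2 : \sum_(j < n) spray Gam x (c *: y) j * Aform2 M b x i j (c *: y) =
    c ^+ M * \sum_(j < n) spray Gam x y j * Aform2 M b x i j y.
  rewrite mulr_sumr; apply: eq_bigr => k _.
  by rewrite /Aform2 -[M.-2]/m pform_crd_scale spray_scale !exprS expr0; ring.
have e3 : \sum_(k < n) (c *: y) ord0 k * dAform M b x k (c *: y) =
    c ^+ M.+1 * \sum_(k < n) y ord0 k * dAform M b x k y.
  rewrite mulr_sumr; apply: eq_bigr => k _.
  by rewrite /dAform pform_crd_scale mxE !exprS; ring.
have e4 : \sum_(j < n) spray Gam x (c *: y) j * Aform1 M b x j (c *: y) =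
    c ^+ M.+1 * \sum_(j < n) spray Gam x y j * Aform1 M b x j y.
  rewrite mulr_sumr; apply: eq_bigr => k _.
  by rewrite /Aform1 -[M.-1]/(m.+1) pform_crd_scale spray_scale !exprS expr0; ring.
rewrite e1 e2 e3 e4 /Aform /Aform1 /dAform -[M.-1]/(m.+1) !pform_crd_scale.
set s1 := \sum_(k < n) _; set s2 := \sum_(k < n) _; set s3 := \sum_(k < n) _.
set s4 := \sum_(j < n) _; set A := pform M _ _; set A1 := pform m.+1 _ _; set d := pform M _ _.
move=> H; have cM : c ^+ M * c ^+ M != 0 by rewrite mulf_neq0 // expf_neq0.
apply: (mulfI cM).
transitivity (c ^+ M * A * (M%:R * (c ^+ M * s1) - M%:R * (M%:R - 1) * (c ^+ M * s2) - c ^+ M * d)).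
  by ring.
rewrite H -/M !exprS; ring.
Qed.

End Pregeodesics.

(** * Sprays under changes of coordinates *)

Section ConnectionCharts.
Variables (R : realType) (n : nat) (M : smooth_manifold R n).
Implicit Types (phi psi : chart R n M).

(** The term with second derivatives is the one that appears in the acceleration of a curve under a
    change of coordinates. Hence the form c y - spray of an acceleration does not depend on the
    chart. *)
Lemma connection_spray (Gam : chart R n M -> 'rV[R]_n -> 'I_n -> 'I_n -> 'I_n -> R)
    phi psi x (v : 'rV[R]_n) s : linear_connection Gam -> atlas phi -> atlas psi ->
  overlap phi psi x ->
  \sum_(l < n) spray (Gam phi) x v l * jacobian phi psi x l s =
  spray (Gam psi) (transition phi psi x) (v *m jacobian phi psi x) s
  + \sum_(p < n) \sum_(q < n) v ord0 p * v ord0 q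
      * partial p (partial q (transition_coord phi psi s)) x.
Proof.
move=> [_ law] ph ps Ox; pose x' := transition phi psi x.
have Ox' : overlap psi phi x' := transition_image Ox.
have xE : transition psi phi x' = x := transitionK Ox.
pose J := jacobian phi psi x; pose K := jacobian psi phi x'.
have KJ : K *m J = 1%:M by apply: mulmx1C; exact: jacobianM.
pose d2 p q i := partial p (partial q (transition_coord phi psi i)) x.
pose E p q i := \sum_(j < n) \sum_(k < n) Gam psi x' i j k * J p j * J q k + d2 p q i.
have GE l p q : Gam phi x l p q = \sum_(i < n) K i l * E p q i.
  have := law psi phi ps ph x' Ox' l p q; rewrite /= xE => ->.
  apply: eq_bigr => i _; rewrite /K mxE; congr (_ * (_ + _)).
  by apply: eq_bigr => j _; apply: eq_bigr => k _; rewrite !mxE.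
have GJ p q : \sum_(l < n) Gam phi x l p q * J l s = E p q s.
  transitivity (\sum_(i < n) (K *m J) i s * E p q i).
    under eq_bigr do rewrite GE mulr_suml.
    rewrite exchange_big; apply: eq_bigr => i _ /=; rewrite mxE mulr_suml.
    by apply: eq_bigr => l _; ring.
  rewrite KJ (bigD1 s) //= mxE eqxx mul1r big1 ?addr0 // => i ri.
  by rewrite mxE (negbTE ri) mul0r.
transitivity (\sum_(p < n) \sum_(q < n) v ord0 p * v ord0 q * E p q s).
  under eq_bigr do rewrite /spray mulr_suml.
  rewrite exchange_big; apply: eq_bigr => p _ /=.
  under eq_bigr do rewrite mulr_suml.
  rewrite exchange_big; apply: eq_bigr => q _ /=.
  by rewrite -GJ mulr_sumr; apply: eq_bigr => l _; rewrite -/J; ring.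
transitivity (\sum_(p < n) \sum_(q < n) v ord0 p * v ord0 q *
    (\sum_(j < n) \sum_(k < n) Gam psi x' s j k * J p j * J q k)
  + \sum_(p < n) \sum_(q < n) v ord0 p * v ord0 q * d2 p q s).
  rewrite -big_split; apply: eq_bigr => p _; rewrite -big_split; apply: eq_bigr => q _ /=.
  by rewrite /E mulrDr.
congr (_ + _); rewrite /spray -/x' -/J.
transitivity (\sum_(j < n) \sum_(k < n) \sum_(p < n) \sum_(q < n)
   Gam psi x' s j k * (v ord0 p * J p j) * (v ord0 q * J q k)).
  transitivity (\sum_(p < n) \sum_(q < n) \sum_(j < n) \sum_(k < n)
    Gam psi x' s j k * (v ord0 p * J p j) * (v ord0 q * J q k)).
    apply: eq_bigr => p _; apply: eq_bigr => q _; rewrite mulr_sumr.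
    apply: eq_bigr => j _; rewrite mulr_sumr; apply: eq_bigr => k _; ring.
  under eq_bigr do rewrite exchange_big /=.
  rewrite exchange_big /=; apply: eq_bigr => j _.
  under eq_bigr do rewrite exchange_big /=.
  by rewrite exchange_big.
apply: eq_bigr => j _; apply: eq_bigr => k _.
have vJ r : (v *m J) ord0 r = \sum_(p < n) v ord0 p * J p r by rewrite mxE.
rewrite !vJ [X in _ = X * _]mulr_sumr mulr_suml; apply: eq_bigr => p _.
by rewrite mulr_sumr; apply: eq_bigr => q _; ring.
Qed.

End ConnectionCharts.

Section Forward.
Variables (R : realType) (n : nat) (M : smooth_manifold R n).
Variables (G : TM_function M) (h : chart R n M -> 'rV[R]_n -> 'I_n -> 'I_n -> R).
Implicit Types (phi psi : chart R n M).
Hypothesis hG : mth_root_metric 2 (quadratic_components h) G.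
Hypothesis smooth_h : forall phi, atlas phi -> forall i j,
  smooth (cimage phi) (fun x => h phi x i j).

Local Notation Gam := (christoffel h).

Lemma christoffel_rapcsak phi x y i : atlas phi -> cimage phi x ->
  rapcsak 2 (quadratic_components h phi) (Gam phi) x y i.
Proof.
move=> ph Ux; apply: (rapcsak_of_parallel (m := 2) (@cimage_openP R n M phi) isT
  (root_sym hG ph) y i Ux) => [j k l|].
  exact: (christoffel_sym hG j k l ph Ux).
exact: (christoffel_parallel hG ph Ux).
Qed.

Lemma geodesic_of_pregeodesic phi (e : R) (x y : R -> 'rV[R]_n) (c : R -> R) : atlas phi ->
  0 < e -> smooth (ball (0 : R) e) x ->
  (forall t : R, ball 0 e t -> [/\ cimage phi (x t), is_derive t 1 x (y t),
      is_derive t 1 y (c t *: y t - \row_j spray (Gam phi) (x t) (y t) j) & y t != 0]) ->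
  geodesic G (ball (0 : R) e) (fun t => cinv phi (x t)).
Proof.
move=> ph e0 Cx H.
have oB : open (ball (0 : R) e) by exact: ball_open.
have cc (t : R) : ball 0 e t -> {for t, continuous (fun t => cinv phi (x t))}.
  move=> te; have [Ut dx _ _] := H t te.
  apply: (@continuous_comp _ _ _ x (cinv phi)); first exact: is_derive_continuous dx.
  exact: cinv_continuous.
split=> //.
- move=> u v; rewrite -!ball_normE /ball_ /= !sub0r !normrN !ltr_norml.
  move=> /andP[u1 u2] /andP[v1 v2] w /andP[uw wv]; rewrite sub0r normrN ltr_norml.
  by rewrite (lt_le_trans u1 uw) (le_lt_trans wv v2).
- by exists 0; exact: ballxx.
move=> psi ps Tpsi X.
have oT : open Tpsi by apply: open_preimage => //; exact: cdom_open.
have Ov t : Tpsi t -> overlap phi psi (x t).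
  by move=> [te dp]; apply/overlapP; split=> //; have [] := H t te.
pose J := jacobian phi psi.
have oO := @overlap_open R n M phi psi.
have dX t : Tpsi t -> is_derive (t : R) 1 X (y t *m J (x t)).
  move=> Tt; have [_ dx _ _] := H t Tt.1; apply/isd_mx => i j; rewrite (ord1 i).
  have D := isd_comp oO (smooth_transition j ph ps 1) (Ov t Tt) dx.
  apply: is_derive_eq D _; rewrite mxE; apply: eq_bigr => k _.
  by rewrite [J _ _ _]mxE mulrC.
have X'E t : Tpsi t -> derive1 X t = y t *m J (x t).
  by move=> Tt; rewrite derive1E; have [_ ->] := dX t Tt.
have CX : smooth Tpsi X.
  move=> k; apply/(Ck_mx _ _ oT) => i j; rewrite (ord1 i).
  apply: (Ck_comp oT oO Ov (smooth_transition j ph ps k)).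
  by apply: (Ck_sub _ (Cx k)) => t [].
have X0 t : Tpsi t -> derive1 X t != 0.
  move=> Tt; rewrite X'E //; have [_ _ _ yt0] := H t Tt.1.
  apply: contraNneq yt0 => yJ.
  by rewrite -[y t]mulmx1 -(jacobianM ph ps (Ov t Tt)) mulmxA yJ mul0mx.
split=> // t i Tt.
apply: (geodesic_chart (m := 2) isT hG ps i oB cc CX X0 Tt).2.
have [Ut dx dy _] := H t Tt.1.
have Ux' : cimage psi (X t) by exists (cinv phi (x t)) => //; case: Tt.
apply: (euler_lagrange_geodesic (m := 2) isT _ Ux' (X0 t Tt) (root_regular (m := 2) isT hG ps Ux')
  (fun i => christoffel_rapcsak _ i ps Ux')).2.
exists (c t).
pose dJ : 'M[R]_n := \matrix_(p, s) \sum_(k < n)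
  partial k (partial p (transition_coord phi psi s)) (x t) * y t ord0 k.
have dJx : is_derive t (1 : R) (fun t => J (x t)) dJ.
  apply/isd_mx => p s; rewrite mxE.
  rewrite (_ : (fun t => _) = fun t => partial p (transition_coord phi psi s) (x t)); last first.
    by apply/funext => u; rewrite mxE.
  exact: (isd_comp oO (Ck_D _ (smooth_transition s ph ps 2)) (Ov t Tt) dx).
have D2 : is_derive t (1 : R) (derive1 X)
    ((c t *: y t - \row_j spray (Gam phi) (x t) (y t) j) *m J (x t) + y t *m dJ).
  apply: (isd_near oT Tt (fun s Ts => esym (X'E s Ts))).
  exact: isd_mulmx dy dJx.
rewrite derive1E; have [_ ->] := D2.
rewrite X'E // mulmxBl -scalemxAl -addrA; congr (_ + _).
apply/rowP => s; have CS := connection_spray (y t) s (christoffel_connection hG smooth_h) ph ps (Ov t Tt).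
have e1 : ((\row_j spray (Gam phi) (x t) (y t) j) *m J (x t)) ord0 s =
   \sum_(l < n) spray (Gam phi) (x t) (y t) l * jacobian phi psi (x t) l s.
  by rewrite mxE; apply: eq_bigr => l _; rewrite [(\row__ _) _ _]mxE.
have e2 : (y t *m dJ) ord0 s = \sum_(p < n) \sum_(q < n) y t ord0 p * y t ord0 q
      * partial p (partial q (transition_coord phi psi s)) (x t).
  rewrite mxE exchange_big; apply: eq_bigr => q _; rewrite mxE mulr_sumr.
  by apply: eq_bigr => p _; ring.
rewrite [LHS]mxE [X in X + _]mxE e1 CS e2 [RHS]mxE [in RHS]mxE.
by rewrite opprD addrNK.
Qed.

Variables (m : nat) (a : components M) (F : TM_function M).
Hypothesis m2 : (2 <= m)%N.
Hypothesis hF : mth_root_metric m a F.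
Hypothesis GF : forall T c, geodesic G T c ->
  exists T' c', geodesic F T' c' /\ c @` T = c' @` T'.

Lemma rapcsak_of_projective phi x0 y0 i : atlas phi -> cimage phi x0 ->
  rapcsak m (a phi) (Gam phi) x0 y0 i.
Proof.
move=> ph Ux0; have [->|y00] := eqVneq y0 0.
  have A0 : Aform m (a phi) x0 0 = 0.
    rewrite -(scale0r (0 : 'rV[R]_n)) Aform_scale expr0n.
    have -> : (m == 0)%N = false by lia.
    by rewrite mul0r.
  have B0 : Bform m (a phi) (Gam phi) x0 0 = 0.
    by rewrite -(scale0r (0 : 'rV[R]_n)) (Bform_scale _ _ m2) expr0n mul0r.
  by rewrite /rapcsak A0 B0 !mul0r !mulr0.
have [i0 y0i] : exists i0, y0 ord0 i0 != 0.
  apply: contrapT => N; case/eqP: y00; apply/rowP => j; rewrite mxE.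
  by apply: contrapT => /eqP yj; apply: N; exists j.
have oU := @cimage_openP R n M phi.
have [e [x [y [c [e0 x00 yE Cx H]]]]] := pregeodesic_exists oU Ux0
  (fun i j k => christoffel_smooth hG smooth_h i j k ph) y0i.
have b0 : ball (0 : R) e 0 by exact: ballxx.
have [|T' [c' [[oT iT T0 cc EL] im]]] := GF (geodesic_of_pregeodesic ph e0 Cx (c := c) (y := y) _).
  move=> t te; have [Ut dx dy yi] := H t te; split=> //.
  by apply: contraNneq y0i => yt; rewrite -yi yt mxE.
have xi (t : R) : ball 0 e t -> x t ord0 i0 = x0 ord0 i0 + t * y0 ord0 i0.
  move=> te.
  have K (s : R) : ball 0 e s -> is_derive s 1
      (fun s => (x s ord0 i0 - s * y0 ord0 i0)%:M : 'M[R]_1) 0.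
    move=> se; have [_ /isd_mx dx _ yi] := H s se; apply/isd_mx => p q; rewrite (ord1 p) (ord1 q) mxE.
    rewrite (_ : (fun z => _) = fun z => x z ord0 i0 - z * y0 ord0 i0); last first.
      by apply/funext => z; rewrite mxE eqxx.
    apply: is_derive_eq (isd_sub (dx ord0 i0) (isd_mulr (y0 ord0 i0) (is_derive_id s (1 : R)))) _.
    by rewrite yi mul1r subrr.
  have /(congr1 (fun N : 'M[R]_1 => N ord0 ord0)) := isd0_cst K te.
  by rewrite !mxE !mulr1n mul0r subr0 x00 => <-; rewrite subrK.
pose z (s : R) := cmap phi (c' s).
pose tau (s : R) := (z s ord0 i0 - x0 ord0 i0) * (y0 ord0 i0)^-1.
have zx s : T' s -> [/\ cdom phi (c' s), ball (0 : R) e (tau s) & z s = x (tau s)].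
  move=> Ts; have [t te ct] : ((fun t => cinv phi (x t)) @` ball (0 : R) e) (c' s).
    by rewrite im; exists s.
  have [Ut _ _ _] := H t te; have zE : z s = x t by rewrite /z -ct cinvK.
  have tE : tau s = t by rewrite /tau zE xi // addrAC subrr add0r mulfK.
  by split; [rewrite -ct; exact: cimage_cinv|rewrite tE|rewrite tE].
have [s0 Ts0 cs0] : (c' @` T') (cinv phi (x 0)) by rewrite -im; exists 0.
have zs0 : z s0 = x0 by rewrite /z cs0 x00 cinvK.
have tau0 : tau s0 = 0 by rewrite /tau zs0 subrr mul0r.
have [Cz z0 ELz] := EL phi ph.
have TpE : [set t | T' t /\ cdom phi (c' t)] = T'.
  by apply/seteqP; split=> s; [case|move=> Ts; split=> //; have [] := zx s Ts].
have dz s : T' s -> is_derive (s : R) 1 z (derive1 z s).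
  by rewrite -{1}TpE derive1E => Ts; exact: (Ck_derive _ (Cz 1) Ts).
pose dt s := derive1 z s ord0 i0 * (y0 ord0 i0)^-1.
have dtau s : T' s -> is_derive (s : R) 1 tau (dt s).
  move=> /dz /isd_mx D; have D1 := D ord0 i0.
  have D2 := isd_mulr (y0 ord0 i0)^-1 (isd_sub D1 (isd_cst (x0 ord0 i0) s (1 : R))).
  by apply: is_derive_eq D2 _; rewrite subr0.
have z'E s : T' s -> derive1 z s = dt s *: y (tau s).
  move=> Ts; have [_ te _] := zx s Ts; have [_ /isd_mx dx _ _] := H _ te.
  have D : is_derive (s : R) 1 z (dt s *: y (tau s)).
    apply: (isd_near oT Ts (f := fun s => x (tau s))).
      by move=> u Tu; have [_ _ ->] := zx u Tu.
    apply/isd_mx => p q; have D := isd_comp1 (dtau s Ts) (dx p q).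
    by apply: is_derive_eq D _; rewrite mxE mulrC.
  exact: isd_unique (dz s Ts) D.
have Tp0 : [set t | T' t /\ cdom phi (c' t)] s0 by rewrite TpE.
have dz' : is_derive s0 (1 : R) (derive1 z) (derive1 (derive1 z) s0).
  rewrite derive1E; apply: derivableP.
  have -> : derive1 z = 'D_(1 : R) z by apply/funext => s; rewrite derive1E.
  by have [_ /(_ 1)[D _]] := Ck_D (1 : R) (Cz 2); exact: D.
pose ddt := derive1 (derive1 z) s0 ord0 i0 * (y0 ord0 i0)^-1.
have ddtau : is_derive s0 (1 : R) dt ddt.
  by move/isd_mx: dz' => D; exact: (isd_mulr (y0 ord0 i0)^-1 (D ord0 i0)).
have b00 : ball (0 : R) e (tau s0) by rewrite tau0.
have [_ _ dy _] := H _ b00.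
set w := c (tau s0) *: y (tau s0) - \row_j spray (Gam phi) (x (tau s0)) (y (tau s0)) j in dy.
have z''E : derive1 (derive1 z) s0 = ddt *: y0 + (dt s0 * dt s0) *: w.
  have D : is_derive s0 (1 : R) (derive1 z) (ddt *: y0 + (dt s0 * dt s0) *: w).
    apply: (isd_near oT Ts0 (f := fun s => dt s *: y (tau s))).
      by move=> u Tu; rewrite z'E.
    apply/isd_mx => p q; rewrite (ord1 p).
    rewrite (_ : (fun s => _) = fun s => dt s * y (tau s) ord0 q); last first.
      by apply/funext => u; rewrite mxE.
    move/isd_mx: dy => dy.
    have D := isd_mul ddtau (isd_comp1 (dtau s0 Ts0) (dy ord0 q)).
    apply: is_derive_eq D _; rewrite tau0 yE [RHS]mxE [X in _ = X + _]mxE [X in _ = _ + X]mxE.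
    by congr (_ + _); ring.
  exact: isd_unique dz' D.
have z's0 : derive1 z s0 = dt s0 *: y0 by rewrite z'E // tau0 yE.
have dt0 : dt s0 != 0.
  by have := z0 s0 Tp0; rewrite -/z z's0; apply: contraNneq => ->; rewrite scale0r.
have K : euler_lagrange m (a phi) (z s0) (derive1 z s0) (derive1 (derive1 z) s0) i = 0.
  exact: ((geodesic_chart m2 hF ph i oT cc Cz z0 Tp0).1 (ELz s0 i Tp0)).
rewrite zs0 z's0 z''E /w tau0 yE x00 in K.
apply: (rapcsak_scale m2 dt0); apply/rapcsak_euler_lagrange.
have lin : ddt *: y0 + (dt s0 * dt s0) *: (c 0 *: y0 - \row_j spray (Gam phi) x0 y0 j) =
   - \row_j spray (Gam phi) x0 (dt s0 *: y0) j
   + (ddt / dt s0 + dt s0 * c 0) *: (dt s0 *: y0).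
  by apply/rowP => j; rewrite !mxE spray_scale; field.
rewrite lin euler_lagrange_shift in K; move: K.
set r := ddt / dt s0 + dt s0 * c 0; set v := dt s0 *: y0.
have rv j : (r *: v) ord0 j = r * v ord0 j by rewrite mxE.
rewrite (eq_bigr (fun j => r * ((Aform m (a phi) x0 v * Aform2 m (a phi) x0 i j v
   - Aform1 m (a phi) x0 i v * Aform1 m (a phi) x0 j v) * v ord0 j))); last first.
  by move=> j _; rewrite rv; ring.
by rewrite -mulr_sumr radial_kernel // !mulr0 addr0.
Qed.

End Forward.

Theorem theorem20 (R : realType) (n m : nat) (hm : (2 <= m)%N)
    (M : smooth_manifold R n) (a : components M) (F : TM_function M)
    (hF : mth_root_metric m a F) :
  riemann_projective F <->
  exists Gam : chart R n M -> 'rV[R]_n -> 'I_n -> 'I_n -> 'I_n -> R,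
    linear_connection Gam /\
    forall phi, atlas phi -> forall x, cimage phi x ->
    forall (i : 'I_n) (I J : m.-tuple 'I_n),
      symmetrize (root_lhs m (a phi) x i) I J
      = symmetrize (root_rhs (a phi) (Gam phi) x i) I J.
Proof.
split=> [[G [rG [_ GF]]]|[Gam [[CG _] E]]].
  have [h hG Ch] := riemannian_root rG.
  exists (christoffel h); split; first exact: christoffel_connection hG Ch.
  move=> phi ph x Ux; apply: (equation_rapcsak (a phi) _ x hm).2 => y i.
  exact: (rapcsak_of_projective hG Ch hm hF GF y i ph Ux).
apply: (riemann_projective_of_equation hm hF CG) => phi ph x Ux.
by apply: (equation_rapcsak (a phi) _ x hm).1 => i; exact: E.
Qed.
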